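(* Let $k$ be a field and let $\mathfrak q=(q_{ij})$ be an $n\times n$ multiplicatively antisymmetric matrix with entries in $k^\times$. Let $\Lambda_{\mathfrak q}$ be the corresponding $n$-dimensional quantum torus, and assume that the Krull dimension of $\Lambda_{\mathfrak q}$ equals $n-1$. Then for every simple $\Lambda_{\mathfrak q}$-module $M$ the following dichotomy holds: \[\operatorname{GKdim}(M)=1 \quad\text{or}\quad \operatorname{GKdim}(M)=\operatorname{GKdim}(\Lambda_{\mathfrak q})-\operatorname{GKdim}(\mathcal Z(\Lambda_{\mathfrak q}))-1,\] where $\mathcal Z(\Lambda_{\mathfrak q})$ denotes the center of $\Lambda_{\mathfrak q}$.
   Context: An $n\times n$ matrix $\mathfrak q=(q_{ij})$ over $k^\times=k\setminus\{0\}$ is multiplicatively antisymmetric if $q_{ii}=1$ and $q_{ji}=q_{ij}^{-1}$ for all $i,j$. The $n$-dimensional quantum torus $\Lambda_{\mathfrak q}$ is the associative $k$-algebra generated by $X_1,\dots,X_n$ and their inverses $X_1^{-1},\dots,X_n^{-1}$ subject to the relations $X_iX_j=q_{ij}X_jX_i$ for all $1\le i,j\le n$. Krull dimension means the (Gabriel–Rentschler) Krull dimension of the noncommutative ring. $\operatorname{GKdim}$ denotes Gelfand–Kirillov dimension, measured relative to the ground field $k$. *)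

(* Defs.v *)
From HB Require Import structures.
From mathcomp Require Import all_boot all_order all_algebra.
From mathcomp Require Import boolp classical_sets reals ereal topology
  normedtype sequences exp Rstruct.
Set Implicit Arguments. Unset Strict Implicit. Unset Printing Implicit Defensive.
Import Order.TTheory GRing.Theory Num.Theory.
Local Open Scope ring_scope.

Notation RR := Rdefinitions.R.

Definition mult_antisym (k : fieldType) (n : nat) (q : 'M[k]_n) : Prop :=
  (forall i j, q i j != 0) /\ (forall i, q i i = 1) /\
  (forall i j, q j i = (q i j)^-1).

Definition is_alg_hom (k : fieldType) (A B : algType k) (f : A -> B) : Prop :=
  (forall (c : k) (x y : A), f (c *: x + y) = c *: f x + f y) /\
  (forall x y : A, f (x * y) = f x * f y) /\ f 1 = 1.

Definition qtorus_rel (k : fieldType) (n : nat) (q : 'M[k]_n) (B : algType k)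
  (Y Yi : 'I_n -> B) : Prop :=
  (forall i, Y i * Yi i = 1 /\ Yi i * Y i = 1) /\
  (forall i j, Y i * Y j = q i j *: (Y j * Y i)).

(* A (with the elements X i and X i^{-1} = Xi i) is the k-algebra presented by
   generators X_1^{+-1},...,X_n^{+-1} and the relations X_i X_j = q_ij X_j X_i,
   i.e. it satisfies the universal property of this presentation. *)
Definition is_quantum_torus (k : fieldType) (n : nat) (q : 'M[k]_n)
  (A : algType k) (X Xi : 'I_n -> A) : Prop :=
  qtorus_rel q X Xi /\
  forall (B : algType k) (Y Yi : 'I_n -> B), qtorus_rel q Y Yi ->
    exists f : A -> B,
      [/\ is_alg_hom f, (forall i, f (X i) = Y i /\ f (Xi i) = Yi i) &
          forall g : A -> B, is_alg_hom g ->
            (forall i, g (X i) = Y i /\ g (Xi i) = Yi i) -> forall x, g x = f x].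

Definition is_left_module (k : fieldType) (A : algType k) (V : lmodType k)
  (act : A -> V -> V) : Prop :=
  [/\ (forall (c : k) (a b : A) (v : V), act (c *: a + b) v = c *: act a v + act b v),
      (forall (c : k) (a : A) (v w : V), act a (c *: v + w) = c *: act a v + act a w),
      (forall v, act 1 v = v) &
      (forall (a b : A) (v : V), act (a * b) v = act a (act b v))].

Definition is_submodule (k : fieldType) (A : algType k) (V : lmodType k)
  (act : A -> V -> V) (S : V -> Prop) : Prop :=
  [/\ S 0, (forall v w, S v -> S w -> S (v + w)) &
      (forall a v, S v -> S (act a v))].

Definition simple_module (k : fieldType) (A : algType k) (V : lmodType k)
  (act : A -> V -> V) : Prop :=
  (exists v : V, v != 0) /\
  forall S : V -> Prop, is_submodule act S ->
    (forall v, S v -> v = 0) \/ (forall v, S v).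

Definition free_seq (k : fieldType) (V : lmodType k) (s : seq V) : Prop :=
  forall c : 'I_(size s) -> k,
    \sum_(i < size s) c i *: s`_i = 0 -> forall i, c i = 0.

Definition dimspan (k : fieldType) (V : lmodType k) (s : seq V) : nat :=
  \max_(b : {ffun 'I_(size s) -> bool})
     (if `[< free_seq (mask (fgraph b) s) >] then size (mask (fgraph b) s) else 0%N).

(* all products of length m of elements of 1 :: w (a spanning set of W^m,
   where W = span(1 :: w)) *)
Definition words (k : fieldType) (A : algType k) (w : seq A) (m : nat) : seq A :=
  [seq \prod_(i < m) (1 :: w)`_(t i) | t : {ffun 'I_m -> 'I_(size w).+1}].

Definition gk_growth (d : nat -> nat) : \bar RR :=
  limn_esup (fun m => ((ln (d m)%:R / ln m%:R)%R)%:E).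

(* GKdim of a subalgebra P of A (P given as a subset of A):
   sup over finite-dimensional subspaces W = span(1 :: w) of P containing 1 *)
Definition GKdim_sub (k : fieldType) (A : algType k) (P : set A) : \bar RR :=
  ereal_sup [set x | exists w : seq A, (forall a, a \in w -> P a) /\
                       x = gk_growth (fun m => dimspan (words w m))].

Definition GKdim_alg (k : fieldType) (A : algType k) : \bar RR :=
  GKdim_sub (@setT A).

(* GKdim of a left A-module: sup over W = span(1 :: w) and finite-dim F = span(f)
   of limsup log dim(W^m F) / log m *)
Definition GKdim_mod (k : fieldType) (A : algType k) (V : lmodType k)
  (act : A -> V -> V) : \bar RR :=
  ereal_sup [set x | exists (w : seq A) (f : seq V),
     x = gk_growth (fun m => dimspan [seq act a v | a <- words w m, v <- f])].

Definition alg_center (k : fieldType) (A : algType k) : set A :=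
  [set z | forall a : A, z * a = a * z].

Definition right_ideal (R : pzRingType) (I : R -> Prop) : Prop :=
  [/\ I 0, (forall x y, I x -> I y -> I (x + y)) & (forall x a, I x -> I (x * a))].

(* dev_lt m a b : the interval [a, b] of the lattice of right ideals
   (a ⊆ b) has deviation < m, i.e. deviation <= m - 1
   (deviation -1 meaning the interval is trivial). *)
Fixpoint dev_lt (R : pzRingType) (m : nat) (a b : R -> Prop) : Prop :=
  match m with
  | 0%N => forall x, b x -> a x
  | m'.+1 =>
    forall c : nat -> R -> Prop,
      (forall i, right_ideal (c i)) ->
      (forall x, c 0%N x -> b x) ->
      (forall i x, c i.+1 x -> c i x) ->
      (forall i x, a x -> c i x) ->
      exists N, forall i, (N <= i)%N -> dev_lt m' (c i.+1) (c i)
  end.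

Definition krull_dim (R : pzRingType) (d : int) : Prop :=
  exists m : nat,
    [/\ d = m%:Z - 1, dev_lt m (fun x : R => x = 0) (fun _ : R => True) &
        forall m', dev_lt m' (fun x : R => x = 0) (fun _ : R => True) -> (m <= m')%N].

Arguments alg_center : clear implicits.
Arguments alg_center {k} A.

(* Main.v *)
Require Import Defs.
From HB Require Import structures.
From mathcomp Require Import all_boot all_order all_algebra.
From mathcomp Require Import boolp zify ring.
Set Implicit Arguments. Unset Strict Implicit. Unset Printing Implicit Defensive.
Import Order.TTheory GRing.Theory Num.Theory.
Local Open Scope ring_scope.

(** A large Krull dimension yields a cyclic right module whose leading exponents
    have dimension at most one, hence of linear growth.  If all variables act on
    it algebraically it is finite dimensional, and determinants give
    q_ij ^ c = 1.  Otherwise some X_i1 acts freely, the module has finite rank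
    over k[X_i1], and comparing the leading coefficients of the determinants of
    the other variables shows that the c e_h - w_h e_i1 commute pairwise.  So a
    sublattice of finite index has a basis b_i0, b_1, ... in which all b_h with
    h <> i0 commute; it can be chosen such that b_i0 commutes with b_h for h
    outside I + i0, while the character lambda(b_i0, -) is injective on the span
    of the b_h, h in I.  Here I is not empty, for otherwise the q_ij are roots of
    unity and the ideals generated by the products of the X_i ^ N - 1 show that
    the Krull dimension is n.  Consequently the centre has dimension
    n - 1 - #|I|.

    A simple module V is cut down to a maximal proper submodule N over the
    sublattice, which changes growth only by constants.  Choose v whose
    annihilator modulo N in the commutative algebra P spanned by the b_h, h <> i0,
    is prime.  If the translates T^j P v of T = b_i0 are independent modulo N,
    then P v is simple over P, so by the Nullstellensatz every b_h is algebraic on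
    v and V grows linearly.  Otherwise some T^l with l <> 0 preserves the
    annihilator of v; then the monomials in the b_h, h in I, applied to v are
    independent, and one linear relation bounds the growth from above by the
    degree #|I|. *)

(** * Linear algebra modulo a subspace *)

(** Quotients are never formed: independence, spans and leading terms are all taken modulo a
    subspace [N], so that one theory serves modules, their submodules and right ideals. The exact
    value n - 1 of the Krull dimension enters twice: not being smaller forces the commuting part,
    not being larger rules out roots of unity. As the algebra has dimension n and its centre n - 1 -
    #|I|, the second alternative of the theorem reads GKdim M = #|I|. The obstacle is that
    commutation is obtained only for the vectors c e_h - w_h e_i1: the module need not stay simple
    over the sublattice, and finitely many twists of V / N must be kept to recover V. The numbers
    w_h are degrees of determinants: passing a monomial rescales the variable of k[X_i1], so a
    leading coefficient picks up a power given by the degree. Since Dickson's lemma and the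
    degree-lexicographic order need nonnegative exponents, Laurent monomials are shifted by units or
    covered by twice as many variables. *)

Section LinearAlgebra.
Variables (k : fieldType) (V : lmodType k).
Implicit Types (N P S : V -> Prop).

Definition lsubspace N := N 0 /\ forall (c : k) x y, N x -> N y -> N (c *: x + y).

Lemma sub0 N : lsubspace N -> N 0. Proof. by case. Qed.
Lemma subD N x y : lsubspace N -> N x -> N y -> N (x + y).
Proof. by move=> [_ h] hx hy; rewrite -(scale1r x); apply: h. Qed.
Lemma subZ N c x : lsubspace N -> N x -> N (c *: x).
Proof. by move=> [h0 h] hx; rewrite -(addr0 (c *: x)); apply: h. Qed.
Lemma subN N x : lsubspace N -> N x -> N (- x).
Proof. by move=> hN hx; rewrite -scaleN1r; apply: subZ. Qed.
Lemma subB N x y : lsubspace N -> N x -> N y -> N (x - y).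
Proof. by move=> hN hx hy; apply: subD => //; apply: subN. Qed.
Lemma sub_sum N (I : Type) (r : seq I) (Q : pred I) (F : I -> V) :
  lsubspace N -> (forall i, Q i -> N (F i)) -> N (\sum_(i <- r | Q i) F i).
Proof.
move=> hN hF; elim/big_ind: _ => //; first exact: sub0.
by move=> x y; apply: subD.
Qed.
Lemma subDl N x y : lsubspace N -> N x -> N (x + y) -> N y.
Proof. by move=> hN hx hxy; rewrite -(addKr x y) addrC; apply: subB. Qed.
Lemma subDr N x y : lsubspace N -> N y -> N (x + y) -> N x.
Proof. by move=> hN hy; rewrite addrC; apply: subDl. Qed.
Lemma subZ_inv N c x : lsubspace N -> c != 0 -> N (c *: x) -> N x.
Proof. by move=> hN c0 /(subZ (c^-1) hN); rewrite scalerA mulVf // scale1r. Qed.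

Lemma subspace_eq0 : lsubspace (fun x => x = 0).
Proof. by split=> // c x y -> ->; rewrite scaler0 addr0. Qed.

(** The intersection of all subspaces containing [P]: an inclusion is proved by exhibiting one
    subspace, and coefficients appear only when needed. *)
Definition lspan P : V -> Prop :=
  fun x => forall S, lsubspace S -> (forall y, P y -> S y) -> S x.

Lemma lspan_subspace P : lsubspace (lspan P).
Proof.
split=> [S hS _|c x y hx hy S hS hP]; first exact: sub0.
by case: (hS) => _; apply; [apply: hx|apply: hy].
Qed.
Lemma lspan_in P x : P x -> lspan P x. Proof. by move=> hx S _; apply. Qed.
Lemma lspan_le P S x : lsubspace S -> (forall y, P y -> S y) -> lspan P x -> S x.
Proof. by move=> hS hP; apply. Qed.
Lemma lspan_mono P Q x : (forall y, P y -> Q y) -> lspan P x -> lspan Q x.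
Proof.
by move=> hPQ; apply: lspan_le; [exact: lspan_subspace|move=> y /hPQ; exact: lspan_in].
Qed.

Definition lspanm N P := lspan (fun x => N x \/ P x).

Lemma lspanm_subspace N P : lsubspace (lspanm N P). Proof. exact: lspan_subspace. Qed.
Lemma lspanmN N P x : N x -> lspanm N P x. Proof. by move=> h; apply: lspan_in; left. Qed.
Lemma lspanmP N P x : P x -> lspanm N P x. Proof. by move=> h; apply: lspan_in; right. Qed.
Lemma lspanm_le N P S x : lsubspace S -> (forall y, N y -> S y) ->
  (forall y, P y -> S y) -> lspanm N P x -> S x.
Proof. by move=> hS hN hP; apply: lspan_le => // y [/hN|/hP]. Qed.
Lemma lspanm_mono N P Q x : (forall y, P y -> lspanm N Q y) -> lspanm N P x -> lspanm N Q x.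
Proof.
by move=> h; apply: lspanm_le => //; [exact: lspanm_subspace|move=> y; exact: lspanmN].
Qed.

Definition indep (I : finType) N (u : I -> V) :=
  forall c : I -> k, N (\sum_i c i *: u i) -> forall i, c i = 0.

Lemma inspanP (J : finType) N (w : J -> V) x : lsubspace N ->
  lspanm N (fun y => exists j, y = w j) x ->
  exists c : J -> k, N (x - \sum_j c j *: w j).
Proof.
move=> hN; apply: (@lspanm_le _ _ (fun x => exists c : J -> k, N (x - \sum_j c j *: w j))).
- split=> [|a x1 y1 [c hc] [d hd]].
    by exists (fun=> 0); rewrite big1 ?subr0; [exact: sub0|move=> i _; rewrite scale0r].
  exists (fun j => a * c j + d j).
  have -> : a *: x1 + y1 - \sum_j (a * c j + d j) *: w j =
     a *: (x1 - \sum_j c j *: w j) + (y1 - \sum_j d j *: w j).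
    rewrite scalerBr scaler_sumr addrACA -opprD -big_split /=.
    by congr (_ + - _); apply: eq_bigr => j _; rewrite scalerDl scalerA.
  by case: hN => _; apply.
- by move=> y hy; exists (fun=> 0); rewrite big1 ?subr0 // => i _; rewrite scale0r.
- move=> y [j ->]; exists (fun i => (i == j)%:R).
  rewrite (bigD1 j) //= eqxx scale1r big1 ?addr0 ?subrr; first exact: sub0.
  by move=> i /negPf ->; rewrite scale0r.
Qed.

(** With fewer generators than vectors the coefficient matrix has a nonzero row in its left kernel,
    and this row is a relation between the [u i] modulo [N]. *)
Lemma steinitz (I J : finType) N (u : I -> V) (w : J -> V) : lsubspace N ->
  indep N u -> (forall i, lspanm N (fun y => exists j, y = w j) (u i)) ->
  (#|I| <= #|J|)%N.
Proof.
move=> hN hu hw.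
have /(_ _)/cid hc := fun i => inspanP hN (hw i).
pose c i := sval (hc i).
have hcP i : N (u i - \sum_j c i j *: w j) by rewrite /c; case: (hc i).
pose M : 'M[k]_(#|I|, #|J|) := \matrix_(i, j) c (enum_val i) (enum_val j).
rewrite leqNgt; apply/negP => hlt.
have : kermx M != 0.
  by rewrite kermx_eq0 /row_free neq_ltn (leq_ltn_trans (rank_leq_col M)).
case/rowV0Pn => x /sub_kermxP xM /eqP x0; apply: x0.
apply/rowP => i; rewrite [RHS]mxE.
pose d i := x 0 (enum_rank i).
rewrite -(enum_valK i); apply: (hu d).
have -> : \sum_i d i *: u i =
   \sum_i d i *: (u i - \sum_j c i j *: w j) + \sum_i \sum_j (d i * c i j) *: w j.
  rewrite -big_split /=; apply: eq_bigr => i1 _.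
  rewrite scalerBr scaler_sumr.
  under [X in _ = _ + X]eq_bigr do rewrite -scalerA.
  by rewrite subrK.
apply: subD => //; first by apply: sub_sum => // i1 _; apply: subZ.
rewrite exchange_big big1 /=; first exact: sub0.
move=> j _; rewrite -scaler_suml.
suff -> : \sum_i0 d i0 * c i0 j = 0 by rewrite scale0r.
move/matrixP: xM => /(_ 0 (enum_rank j)); rewrite !mxE => e.
rewrite -[RHS]e (reindex (@enum_val I I)) /=; last first.
  by exists enum_rank => z _; rewrite ?enum_valK ?enum_rankK.
by apply: eq_bigr => i1 _; rewrite mxE /d enum_valK enum_rankK.
Qed.


Lemma dimspan_le (J : finType) (w : J -> V) (s : seq V) :
  (forall x, x \in s -> lspan (fun y => exists j, y = w j) x) ->
  (dimspan s <= #|J|)%N.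
Proof.
move=> hs; apply/bigmax_leqP => b _; case: asboolP => // hfree.
set t := mask _ _ in hfree *.
rewrite -[size t]card_ord.
apply: (@steinitz _ _ (fun x => x = 0) (fun i : 'I_(size t) => t`_i) w subspace_eq0).
  by move=> c hc i; apply: hfree.
move=> i; apply: (@lspan_mono (fun y => exists j, y = w j)); first by move=> y; right.
by apply: hs; apply: mem_mask (mem_nth _ (ltn_ord i)).
Qed.

Lemma dimspan_ge (I : finType) (s : seq V) (f : I -> 'I_(size s)) :
  injective f -> indep (fun x => x = 0) (fun i => s`_(f i)) -> (#|I| <= dimspan s)%N.
Proof.
(* The mask marks the positions hit by [f]. The masked sequence lists them in increasing order, so
   [h] below reindexes it by [I]. *)
move=> finj hu; pose b := [ffun j : 'I_(size s) => j \in codom f].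
apply: leq_trans (leq_bigmax b).
set t := mask _ _.
have et : t = [seq s`_j | j : 'I_(size s) <- enum (codom f)].
  have eb : fgraph b = [seq b j | j <- enum 'I_(size s)] :> seq bool.
    by rewrite -codomE fgraph_codom.
  have es : s = [seq s`_j | j : 'I_(size s) <- enum 'I_(size s)].
    by rewrite -[LHS](mkseq_nth 0) /mkseq -val_enum_ord -map_comp.
  rewrite /t eb [X in mask _ X]es -map_mask -filter_mask; congr map.
  by rewrite enumT /enum_mem; apply: eq_filter => j; rewrite ffunE.
have size_t : size t = #|I| by rewrite et size_map -cardE card_codom.
rewrite size_t; case: asboolP => //; case.
pose r := enum (codom f).
have sr : size t = size r by rewrite et size_map.
move=> c hc i.
have hr x : f x \in r by rewrite mem_enum codom_f.
have hh0 x : t`_(index (f x) r) = s`_(f x).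
  by rewrite et (nth_map (f x)) ?index_mem // nth_index.
have hlt x : (index (f x) r < size t)%N by rewrite sr index_mem.
pose h x := Ordinal (hlt x).
have hh x : t`_(h x) = s`_(f x) by exact: hh0.
have hinj : injective h.
  move=> x y [] e; apply: finj.
  by rewrite -(nth_index (f x) (hr x)) e nth_index.
have hbij : bijective h by apply: inj_card_bij => //; rewrite card_ord size_t.
have [h' h1 h2] := hbij.
rewrite -(h2 i); apply: (hu (fun x => c (h x))).
rewrite -[RHS]hc (reindex h) /=; last exact: onW_bij.
by apply: eq_bigr => x _; rewrite hh.
Qed.

End LinearAlgebra.

Section AlgebraSpans.
Variables (k : fieldType) (A : algType k).
Implicit Types (P Q S : A -> Prop).

Lemma preim_mulr_subspace S y : lsubspace S -> lsubspace (fun x => S (x * y)).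
Proof.
move=> hS; split=> [|c u v hu hv]; first by rewrite mul0r; apply: sub0.
by rewrite mulrDl -scalerAl; apply: hS.2.
Qed.
Lemma preim_mull_subspace S y : lsubspace S -> lsubspace (fun x => S (y * x)).
Proof.
move=> hS; split=> [|c u v hu hv]; first by rewrite mulr0; apply: sub0.
by rewrite mulrDr -scalerAr; apply: hS.2.
Qed.

Lemma lspan_mul P Q S x y : lsubspace S -> (forall x y, P x -> Q y -> S (x * y)) ->
  lspan P x -> lspan Q y -> S (x * y).
Proof.
move=> hS hPQ hx hy; apply: (lspan_le (preim_mulr_subspace y hS) _ hx) => u hu.
by apply: (lspan_le (preim_mull_subspace u hS) _ hy) => v; apply: hPQ.
Qed.

Lemma lspan_commute P y x : (forall u, P u -> u * y = y * u) -> lspan P x -> x * y = y * x.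
Proof.
apply: (lspan_le (S := fun x => x * y = y * x)).
split=> [|c u v hu hv]; first by rewrite mul0r mulr0.
by rewrite mulrDl mulrDr -scalerAl -scalerAr hu hv.
Qed.
End AlgebraSpans.

(** * Exponents, upsets and leading terms *)

Definition exps n := {ffun 'I_n -> nat}.

Section Exponents.
Variable n : nat.
Implicit Types a b c : exps n.

Definition eadd a b : exps n := [ffun i => (a i + b i)%N].
Definition ele a b := forall i, (a i <= b i)%N.
Definition esub a b : exps n := [ffun i => (a i - b i)%N].
Definition edelta (j : 'I_n) m : exps n := [ffun i => if i == j then m else 0%N].
Definition e0 : exps n := [ffun=> 0%N].
Definition deg a := (\sum_i a i)%N.
Definition trunc K a : exps n := [ffun i => minn (a i) K].

Lemma eaddE a b i : eadd a b i = (a i + b i)%N. Proof. by rewrite ffunE. Qed.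
Lemma eadd0 a : eadd a e0 = a. Proof. by apply/ffunP => i; rewrite !ffunE addn0. Qed.
Lemma eaddC a b : eadd a b = eadd b a.
Proof. by apply/ffunP => i; rewrite !ffunE addnC. Qed.
Lemma esubK a b : ele a b -> eadd (esub b a) a = b.
Proof. by move=> h; apply/ffunP => i; rewrite !ffunE subnK. Qed.
Lemma degD a b : deg (eadd a b) = (deg a + deg b)%N.
Proof. by rewrite /deg -big_split; apply: eq_bigr => i _; rewrite eaddE. Qed.
Lemma leq_deg a i : (a i <= deg a)%N.
Proof. by rewrite /deg (bigD1 i) //= leq_addr. Qed.

Definition lexlt a b :=
  [exists i, (a i < b i)%N && [forall j : 'I_n, (j < i)%N ==> (a j == b j)]].
Definition dlt a b := (deg a < deg b)%N || (deg a == deg b) && lexlt a b.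

Lemma lexltP a b : reflect
  (exists i, (a i < b i)%N /\ forall j : 'I_n, (j < i)%N -> a j = b j) (lexlt a b).
Proof.
apply: (iffP existsP) => -[i].
  by case/andP => h /forallP h2; exists i; split=> // j hj; apply/eqP/(implyP (h2 j)).
by case=> h h2; exists i; rewrite h /=; apply/forallP => j; apply/implyP => /h2 ->.
Qed.

Lemma lexlt_trans a b c : lexlt a b -> lexlt b c -> lexlt a c.
Proof.
move=> /lexltP[i [hi hi2]] /lexltP[j [hj hj2]]; apply/lexltP.
have [ij|ji|/val_inj e] := ltngtP i j.
- by exists i; rewrite -hj2 //; split=> // l hl; rewrite hi2 // hj2 // (ltn_trans hl).
- by exists j; rewrite hi2 //; split=> // l hl; rewrite hi2 ?hj2 // (ltn_trans hl).
- by subst j; exists i; rewrite (ltn_trans hi) //; split=> // l hl; rewrite hi2 ?hj2.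
Qed.

Lemma lexlt_total a b : a != b -> lexlt a b || lexlt b a.
Proof.
move=> hab.
have [i0 hi0] : exists i, a i != b i.
  apply: contrapT => h; case/eqP: hab; apply/ffunP => i; apply/eqP.
  by apply: contrapT => hi; apply: h; exists i; apply/negP.
have := @arg_minnP _ i0 (fun i => a i != b i) (fun i => nat_of_ord i) hi0.
case=> i hi hmin.
have hj (j : 'I_n) : (j < i)%N -> a j = b j.
  move=> hj; apply/eqP; apply: contraTT hj => /hmin; by rewrite -leqNgt.
case: (ltngtP (a i) (b i)) hi => // h _; apply/orP; [left|right]; apply/lexltP; exists i.
  by split.
by split=> // j /hj.
Qed.

Lemma dlt_trans a b c : dlt a b -> dlt b c -> dlt a c.
Proof.
rewrite /dlt => /orP[h|/andP[/eqP e h]] /orP[h'|/andP[/eqP e' h']].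
- by rewrite (ltn_trans h).
- by rewrite -e' h.
- by rewrite e h'.
- by rewrite e e' eqxx (lexlt_trans h h') orbT.
Qed.

Lemma dlt_irr a : dlt a a = false.
Proof. by rewrite /dlt ltnn eqxx /=; apply/lexltP => -[i]; rewrite ltnn => -[]. Qed.

Lemma dlt_total a b : a != b -> dlt a b || dlt b a.
Proof. by rewrite /dlt => /lexlt_total; case: ltngtP. Qed.

Lemma dltD a b c : dlt a b -> dlt (eadd a c) (eadd b c).
Proof.
rewrite /dlt !degD ltn_add2r eqn_add2r => /orP[->//|/andP[-> /lexltP[i [hi h]]]] /=.
apply/orP; right; apply/lexltP; exists i; rewrite !eaddE ltn_add2r; split=> // j hj.
by rewrite !eaddE h.
Qed.

Definition emb M (b : {ffun 'I_n -> 'I_M.+1}) : exps n := [ffun i => nat_of_ord (b i)].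
Definition cut M a : {ffun 'I_n -> 'I_M.+1} := [ffun i => inord (a i)].

Lemma cutK M a : (forall i, a i <= M)%N -> emb (cut M a) = a.
Proof. by move=> h; apply/ffunP => i; rewrite !ffunE inordK // ltnS. Qed.
Lemma emb_inj M : injective (@emb M).
Proof.
move=> b c /ffunP h; apply/ffunP => i; apply: val_inj; by have := h i; rewrite !ffunE.
Qed.
Lemma emb_le M (b : {ffun 'I_n -> 'I_M.+1}) i : (emb b i <= M)%N.
Proof. by rewrite ffunE -ltnS. Qed.

(* The number of predecessors in the degree-lexicographic order, so that this
   order has type omega. *)
Definition rank a := #|[set b : {ffun 'I_n -> 'I_(deg a).+1} | dlt (emb b) a]|.

(** Predecessors of [a] have degree at most deg a, so they embed into the box for [b], where [a]
    itself is an additional element. *)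
Lemma rank_dlt a b : dlt a b -> (rank a < rank b)%N.
Proof.
move=> hab; have dab : (deg a <= deg b)%N by case/orP: hab => [/ltnW //|/andP[/eqP ->]].
pose f (x : {ffun 'I_n -> 'I_(deg a).+1}) := cut (deg b) (emb x).
have fE x : emb (f x) = emb x by rewrite cutK // => i; rewrite (leq_trans (emb_le _ _)).
have finj : injective f by move=> x y e; apply: emb_inj; rewrite -!fE e.
rewrite /rank -(card_imset _ finj); apply: proper_card; apply/properP; split.
  apply/subsetP => y /imsetP[x]; rewrite !inE => hx ->; rewrite fE.
  exact: dlt_trans hab.
have ea : emb (cut (deg b) a) = a by rewrite cutK // => i; rewrite (leq_trans (leq_deg _ _)).
exists (cut (deg b) a); first by rewrite inE ea.
apply/negP => /imsetP[x]; rewrite inE => hx e.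
by move: hx; rewrite -fE -e ea dlt_irr.
Qed.

Lemma rank_ltE a b : (rank a < rank b)%N = dlt a b.
Proof.
apply/idP/idP; last exact: rank_dlt.
case: (eqVneq a b) => [->|/dlt_total/orP[//|/rank_dlt h]]; first by rewrite ltnn.
by rewrite ltnNge ltnW.
Qed.

Lemma rank_inj : injective rank.
Proof.
move=> a b e; apply/eqP; apply: contraT => /dlt_total; by rewrite -!rank_ltE e ltnn.
Qed.

Lemma rankD a b c : (rank a < rank b)%N -> (rank (eadd a c) < rank (eadd b c))%N.
Proof. by rewrite !rank_ltE; apply: dltD. Qed.

Lemma rank_deg a b : (deg a < deg b)%N -> (rank a < rank b)%N.
Proof. by rewrite rank_ltE /dlt => ->. Qed.

Lemma rank_deg_le a b : (rank a <= rank b)%N -> (deg a <= deg b)%N.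
Proof. by rewrite leqNgt; apply: contraR; rewrite -ltnNge; apply: rank_deg. Qed.

Definition upset (U : exps n -> Prop) := forall a b, U a -> U (eadd a b).

Lemma upset_ele U a b : upset U -> ele a b -> U a -> U b.
Proof. by move=> hU hab; rewrite -(esubK hab) eaddC; apply: hU. Qed.

End Exponents.

(* Dickson's lemma, by induction on the number of truncated coordinates. *)
Lemma dickson_aux (m : nat) : forall (n : nat) (P : pred 'I_n), #|P| = m ->
  forall U : exps n -> Prop,
  upset U -> (forall a b : exps n, (forall i, P i -> a i = b i) -> U a -> U b) ->
  exists K, forall a, U a -> U (trunc K a).
Proof.
elim: m => [|m IH] n P hP U hU hUP.
  exists 0%N => a; apply: hUP => i hi; by move/card0_eq: hP => /(_ i); rewrite unfold_in hi.
have [j hj] : exists j, P j by have /card_gt0P[j hj] : (0 < #|P|)%N; [rewrite hP|exists j].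
pose Q i := P i && (i != j).
have hQ : #|Q| = m.
  have := cardD1 j P; rewrite [j \in P]hj hP add1n => -[->]; apply: eq_card => i.
  by rewrite [RHS]inE /= andbC.
pose upd t (a : exps n) : exps n := [ffun i => if i == j then t else a i].
pose Ut t a := U (upd t a).
have hUt t : upset (Ut t).
  move=> a b h; rewrite /Ut; apply: (upset_ele hU _ h) => i; rewrite !ffunE.
  by case: eqP => // _; rewrite leq_addr.
have hUtQ t (a b : exps n) : (forall i, Q i -> a i = b i) -> Ut t a -> Ut t b.
  move=> h; apply: hUP => i hi; rewrite !ffunE; case: eqP => // /eqP ne.
  by apply: h; rewrite /Q hi.
have Utm t t' (a : exps n) : (t <= t')%N -> Ut t a -> Ut t' a.
  move=> htt; apply: (@upset_ele _ U (upd t a) (upd t' a) hU) => i.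
  by rewrite !ffunE; case: eqP.
have /choice[K hK] t := IH n Q hQ (Ut t) (hUt t) (hUtQ t).
have [Ki hKi] := IH n Q hQ (fun a => exists t, Ut t a) (fun a b '(ex_intro t h) => ex_intro _ t (hUt t a b h))
  (fun a b h '(ex_intro t h') => ex_intro _ t (hUtQ t a b h h')).
(* The slices [Ut t] increase with t; on the finitely many exponents bounded by [Ki] their union is
   already reached at one height [t0]. *)
have [t0 ht0] : exists t0, forall b : {ffun 'I_n -> 'I_Ki.+1},
    (exists t, Ut t (emb b)) -> Ut t0 (emb b).
  have /choice[g hg] (b : {ffun 'I_n -> 'I_Ki.+1}) : exists t, (exists t, Ut t (emb b)) -> Ut t (emb b).
    case: (pselect (exists t, Ut t (emb b))) => [[t ht]|h]; first by exists t.
    by exists 0%N.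
  exists (\max_b g b) => b h; apply: (Utm (g b)); first exact: leq_bigmax.
  exact: hg.
(* Above height [t0] the bound [Ki] suffices; each of the finitely many lower slices has its own
   bound [K t]. *)
exists (maxn Ki (maxn t0 (\max_(t < t0.+1) K t))) => a ha.
set L := maxn _ _.
have ea t : a j = t -> upd t a = a by move=> <-; apply/ffunP => i; rewrite ffunE; case: eqP => // ->.
have haj : Ut (a j) a by rewrite /Ut ea.
case: (leqP (a j) t0) => hjt.
  have h1 : Ut (a j) (trunc (K (a j)) a) by apply: hK.
  apply: (upset_ele hU _ h1) => i; rewrite !ffunE; case: eqP => [->|_].
    by rewrite leq_min leqnn /L; lia.
  rewrite leq_min geq_minl /= (leq_trans (geq_minr _ _)) // /L.
  have := @leq_bigmax _ (fun t : 'I_t0.+1 => K t) (Ordinal (n:=t0.+1) (m:=a j) hjt) => /=.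
  lia.
have h1 : exists t, Ut t (trunc Ki a) by apply: hKi; exists (a j).
have h2 : Ut t0 (trunc Ki a).
  have e : emb (cut Ki (trunc Ki a)) = trunc Ki a by rewrite cutK // => i; rewrite ffunE geq_minr.
  by rewrite -e; apply: ht0; rewrite e.
apply: (upset_ele hU _ h2) => i; rewrite !ffunE; case: eqP => [->|_]; rewrite /L; lia.
Qed.

Lemma dickson n (U : exps n -> Prop) : upset U ->
  exists K, forall a, U a -> U (trunc K a).
Proof.
move=> hU; apply: (@dickson_aux _ _ predT erefl) => // a b h.
by have -> : a = b by apply/ffunP => i; apply: h.
Qed.

(** Every larger bound works as well, so a common bound can be taken for two upsets. *)
Lemma dickson_iff n (U : exps n -> Prop) : upset U ->
  exists K, forall K' a, (K <= K')%N -> U a <-> U (trunc K' a).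
Proof.
move=> hU; have [K hK] := dickson hU; exists K => K' a hKK; split.
  move/hK; apply: upset_ele => // i; rewrite !ffunE; lia.
by apply: upset_ele => // i; rewrite ffunE geq_minl.
Qed.

(* Noetherianity: an ascending sequence of up-sets is stationary. *)
Lemma upset_acc n (U : nat -> exps n -> Prop) : (forall i, upset (U i)) ->
  (forall i a, U i a -> U i.+1 a) -> exists i, forall a, U i.+1 a -> U i a.
Proof.
move=> hU hm.
have hmm i j a : (i <= j)%N -> U i a -> U j a.
  by elim: j => [|j IH]; rewrite leq_eqVlt => /orP[/eqP<- //|//]; rewrite ltnS => /IH h /h/hm.
have hV : upset (fun a => exists i, U i a) by move=> a b [i hi]; exists i; apply: hU.
have [K hK] := dickson hV.
have /choice[g hg] (b : {ffun 'I_n -> 'I_K.+1}) : exists i, (exists i, U i (emb b)) -> U i (emb b).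
  case: (pselect (exists t, U t (emb b))) => [[t ht]|h]; first by exists t.
  by exists 0%N.
exists (\max_b g b) => a ha.
have ha2 : exists i, U i (trunc K a) by apply: hK; exists (\max_b g b).+1.
have e : emb (cut K (trunc K a)) = trunc K a by rewrite cutK // => i; rewrite ffunE geq_minr.
apply: (@upset_ele _ _ (trunc K a)) => //; first by move=> i; rewrite ffunE geq_minl.
rewrite -e; apply: (@hmm (g (cut K (trunc K a)))); first exact: leq_bigmax.
by apply: hg; rewrite e.
Qed.

Section LeadingTerms.
Variables (k : fieldType) (V : lmodType k) (N : V -> Prop).
Hypothesis hN : lsubspace N.

(** Summands with the same index are merged, which is possible because each [Y i] is a subspace. A
    list without repetitions is what [leading_term] asks for. *)
Lemma lspanm_seq (I : eqType) (P : I -> Prop) (Y : I -> V -> Prop) x :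
  (forall i, lsubspace (Y i)) ->
  lspanm N (fun y => exists i, P i /\ Y i y) x ->
  exists s : seq I, exists y : I -> V,
    [/\ uniq s, forall i, i \in s -> P i, forall i, i \in s -> Y i (y i)
      & N (x - \sum_(i <- s) y i)].
Proof.
move=> hY; apply: (@lspanm_le _ _ _ _ (fun x => exists s : seq I, exists y : I -> V,
    [/\ uniq s, forall i, i \in s -> P i, forall i, i \in s -> Y i (y i)
      & N (x - \sum_(i <- s) y i)])).
- split=> [|a x1 x2 [s1 [y1 [u1 p1 q1 n1]]] [s2 [y2 [u2 p2 q2 n2]]]].
    by exists [::], (fun=> 0); rewrite big_nil subrr; split=> //; exact: sub0.
  pose z1 i := if i \in s1 then y1 i else 0.
  pose z2 i := if i \in s2 then y2 i else 0.
  have ext (s t : seq I) (y : I -> V) : uniq s -> uniq t -> {subset s <= t} ->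
      \sum_(i <- s) y i = \sum_(i <- t) (if i \in s then y i else 0).
    move=> us ut st; rewrite -big_mkcond /= -[RHS]big_filter; apply: perm_big.
    apply: uniq_perm => //; first exact: filter_uniq.
    move=> i; rewrite mem_filter; apply/idP/andP => [h|[]//]; split=> //; exact: st.
  exists (undup (s1 ++ s2)), (fun i => a *: z1 i + z2 i).
  split=> [|i|i|]; rewrite ?undup_uniq // ?mem_undup ?mem_cat.
  - by case/orP => [/p1|/p2].
  - move=> _; case: (hY i) => h0 h; apply: (h); rewrite /z1 /z2; case: ifP => // hi.
      exact: q1.
    exact: q2.
  - rewrite big_split /= -scaler_sumr.
    rewrite /z1 /z2 -!ext ?undup_uniq //; try by move=> i hi; rewrite mem_undup mem_cat hi ?orbT.
    have -> : a *: x1 + x2 - (a *: \sum_(i <- s1) y1 i + \sum_(i <- s2) y2 i)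
      = a *: (x1 - \sum_(i <- s1) y1 i) + (x2 - \sum_(i <- s2) y2 i).
      by rewrite scalerBr opprD addrACA.
    by case: hN => _; apply.
- move=> y hy; exists [::], (fun=> 0); rewrite big_nil subr0; split=> //.
- move=> y [i [pi yi]]; exists [:: i], (fun=> y); rewrite big_seq1 subrr.
  split=> // [j|j|]; rewrite ?inE; [by move/eqP->|by move/eqP->|exact: sub0].
Qed.

(** Among the terms outside [N] take the one with the largest value of [f]; the relation expresses
    it by the others, and terms inside [N] do not count. *)
Lemma leading_term (I : eqType) (s : seq I) (f : I -> nat) (x : I -> V) :
  uniq s -> {in s &, injective f} -> N (\sum_(i <- s) x i) ->
  (exists2 i, i \in s & ~ N (x i)) ->
  exists i, [/\ i \in s, ~ N (x i) &
    lspanm N (fun y => exists j, [/\ j \in s, (f j < f i)%N & y = - x j]) (x i)].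
Proof.
move=> us finj hs [i0 hi0 ni0].
have [R hR] : exists R, forall i, i \in s -> (f i < R)%N.
  exists (\max_(i <- s) f i).+1 => i hi; rewrite ltnS.
  by rewrite (big_rem i) //= leq_maxl.
pose Q m := exists i, [/\ i \in s, ~ N (x i) & f i = m].
have [i [hi ni hmax]] : exists i, [/\ i \in s, ~ N (x i) &
    forall j, j \in s -> ~ N (x j) -> (f j <= f i)%N].
  have exQ : exists m, `[< Q m >] by exists (f i0); apply/asboolP; exists i0.
  have bQ m : `[< Q m >] -> (m <= R)%N by move/asboolP => [i [hi _ <-]]; apply/ltnW/hR.
  case: (ex_maxnP exQ bQ) => m /asboolP[i [hi ni <-]] hm.
  by exists i; split=> // j hj nj; apply: hm; apply/asboolP; exists j.
exists i; split=> //.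
have -> : x i = \sum_(j <- s) x j + \sum_(j <- rem i s) - x j.
  by rewrite (big_rem i) //= sumrN addrK.
have hS := lspanm_subspace N
  (fun y => exists j, [/\ j \in s, (f j < f i)%N & y = - x j]).
apply: (subD hS); first exact: lspanmN.
rewrite big_seq; apply: (sub_sum _ hS) => j hj.
have hjs := mem_rem hj.
have ji : j != i by move: hj; rewrite rem_filter // mem_filter /= => /andP[].
have [nj|nj] := pselect (N (x j)); first by apply: lspanmN; apply: subN.
apply: lspanmP; exists j; split=> //.
rewrite ltn_neqAle hmax // andbT; apply: contra ji => /eqP e; apply/eqP.
exact: finj.
Qed.

Section Monomials.
Variables (n : nat) (m : exps n -> V).

(** The counterpart of an initial ideal. By [indep_nlead] and [span_nlead] the monomials of the
    remaining exponents form a basis, modulo [N], of the span of all monomials. *)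
Definition lead (a : exps n) : Prop :=
  lspanm N (fun y => exists b, (rank b < rank a)%N /\ y = m b) (m a).

Lemma indep_nlead (I : finType) (f : I -> exps n) : injective f ->
  (forall i, ~ lead (f i)) -> indep N (fun i => m (f i)).
Proof.
move=> finj hf c hc i; apply/eqP; apply: contrapT => /negP ci.
have hi : ~ N (c i *: m (f i)).
  by move/(subZ_inv hN ci) => h; apply: (hf i); apply: lspanmN.
have inj2 : {in index_enum I &, injective (fun i => rank (f i))}.
  by move=> x y _ _ /rank_inj /finj.
have [j [_ nj hj]] := leading_term (index_enum_uniq I) inj2 hc
  (ex_intro2 _ _ i (mem_index_enum i) hi).
have cj : c j != 0 by apply: contra_notN nj => /eqP ->; rewrite scale0r; exact: sub0.
apply: (hf j); apply: (subZ_inv (lspanm_subspace _ _) cj).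
apply: lspanm_mono hj => y [l [_ hl ->]].
have hS := lspanm_subspace N (fun y => exists b, (rank b < rank (f j))%N /\ y = m b).
by apply: (subN hS); apply: (subZ _ hS); apply: lspanmP; exists (f l).
Qed.

Lemma span_nlead (a : exps n) :
  lspanm N (fun y => exists b, [/\ (rank b <= rank a)%N, ~ lead b & y = m b]) (m a).
Proof.
move: {2}(rank a).+1 (ltnSn (rank a)) => r; elim: r a => // r IH a; rewrite ltnS => ha.
have [hl|hl] := pselect (lead a); last by apply: lspanmP; exists a.
apply: lspanm_mono hl => y [b [hb ->]].
apply: lspanm_mono (IH b (leq_trans hb ha)) => z [c [hc1 hc2 ->]].
by apply: lspanmP; exists c; split=> //; apply: leq_trans hc1 (ltnW hb).
Qed.

End Monomials.
End LeadingTerms.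

(** * Modules over a quantum torus *)

(** The cocycle of [monM] is only known to be nonzero, because all arguments ignore scalars; the
    commutation character [lam] alone is named. Spanning and independence of the monomials are
    separate assumptions, so that the record also fits the monomials of a sublattice. *)
Record torus_mon (k : fieldType) (A : algType k) (G : zmodType)
    (mon : G -> A) (lam : G -> G -> k) : Prop := TorusMon {
  mon0 : mon 0 = 1;
  monM : forall a b, exists2 c, c != 0 & mon a * mon b = c *: mon (a + b);
  monC : forall a b, mon a * mon b = lam a b *: (mon b * mon a);
  lam_neq0 : forall a b, lam a b != 0;
  lamDl : forall a b c, lam (a + b) c = lam a c * lam b c;
  lamDr : forall a b c, lam c (a + b) = lam c a * lam c b }.

Section TorusModules.
Variables (k : fieldType) (A : algType k) (G : zmodType).
Variables (mon : G -> A) (lam : G -> G -> k).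
Hypothesis ht : torus_mon mon lam.

Lemma lam0l b : lam 0 b = 1.
Proof. by apply: (mulfI (lam_neq0 ht 0 b)); rewrite -(lamDl ht) addr0 mulr1. Qed.
Lemma lam0r b : lam b 0 = 1.
Proof. by apply: (mulfI (lam_neq0 ht b 0)); rewrite -(lamDr ht) addr0 mulr1. Qed.
Lemma lamNl a b : lam (- a) b = (lam a b)^-1.
Proof.
apply: (mulfI (lam_neq0 ht a b)).
by rewrite -(lamDl ht) subrr lam0l mulfV // (lam_neq0 ht).
Qed.
Lemma lamNr a b : lam b (- a) = (lam b a)^-1.
Proof.
apply: (mulfI (lam_neq0 ht b a)).
by rewrite -(lamDr ht) subrr lam0r mulfV // (lam_neq0 ht).
Qed.
Lemma lamMnl a b i : lam (a *+ i) b = lam a b ^+ i.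
Proof. by elim: i => [|i IH]; rewrite ?lam0l // mulrS (lamDl ht) IH exprS. Qed.
Lemma lamMnr a b i : lam b (a *+ i) = lam b a ^+ i.
Proof. by elim: i => [|i IH]; rewrite ?lam0r // mulrS (lamDr ht) IH exprS. Qed.
Lemma lamMzlr a b i : lam (a *~ i) b = lam a (b *~ i).
Proof.
case: i => i; first by rewrite -!pmulrn lamMnl lamMnr.
by rewrite !NegzE !mulrNz -!pmulrn lamNl lamNr lamMnl lamMnr.
Qed.

Lemma monNK a : exists2 c, c != 0 & mon (- a) * mon a = c *: 1.
Proof. by have [c c0] := monM ht (- a) a; rewrite addNr (mon0 ht) => e; exists c. Qed.
Lemma mon_neq0 a : mon a != 0.
Proof.
have [c c0 e] := monNK a; apply/eqP => h; move: e; rewrite h mulr0 => /esym/eqP.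
by rewrite scaler_eq0 (negPf c0) oner_eq0.
Qed.
Lemma monMM_neq0 a b : mon a * mon b != 0.
Proof. by have [c c0 ->] := monM ht a b; rewrite scaler_eq0 negb_or c0 mon_neq0. Qed.
Lemma lamV a b : lam a b * lam b a = 1.
Proof.
have := monC ht a b; rewrite (monC ht b a) scalerA => /eqP.
rewrite -subr_eq0 -{1}(scale1r (mon a * mon b)) -scalerBl scaler_eq0.
by rewrite (negPf (monMM_neq0 a b)) orbF subr_eq0 => /eqP <-.
Qed.
Lemma lamaa a : lam a a = 1.
Proof.
have := monC ht a a => /eqP.
rewrite -subr_eq0 -{1}(scale1r (mon a * mon a)) -scalerBl scaler_eq0.
by rewrite (negPf (monMM_neq0 a a)) orbF subr_eq0 => /eqP <-.
Qed.

Variables (V : lmodType k) (act : A -> V -> V).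
Hypothesis hact : is_left_module act.

Lemma actP f c v w : act f (c *: v + w) = c *: act f v + act f w.
Proof. by case: hact => _ h _ _; apply: h. Qed.
Lemma actPl c f g v : act (c *: f + g) v = c *: act f v + act g v.
Proof. by case: hact => h _ _ _; apply: h. Qed.
Lemma act1 v : act 1 v = v.
Proof. by case: hact => _ _ h _; apply: h. Qed.
Lemma actM f g v : act (f * g) v = act f (act g v).
Proof. by case: hact => _ _ _ h; apply: h. Qed.
Lemma actD f v w : act f (v + w) = act f v + act f w.
Proof. by rewrite -[v]scale1r actP !scale1r. Qed.
Lemma act0 f : act f 0 = 0.
Proof. by apply: (addrI (act f 0)); rewrite -actD !addr0. Qed.
Lemma actZ f c v : act f (c *: v) = c *: act f v.
Proof. by rewrite -[c *: v]addr0 actP act0 addr0. Qed.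
Lemma actN f v : act f (- v) = - act f v.
Proof. by rewrite -scaleN1r actZ scaleN1r. Qed.
Lemma act_sum f (I : Type) (r : seq I) (P : pred I) F :
  act f (\sum_(i <- r | P i) F i) = \sum_(i <- r | P i) act f (F i).
Proof.
by apply: (big_morph (act f) (id1 := 0)); [move=> x y; exact: actD|exact: act0].
Qed.
Lemma actDl f g v : act (f + g) v = act f v + act g v.
Proof. by rewrite -[f]scale1r actPl !scale1r. Qed.
Lemma act0l v : act 0 v = 0.
Proof. by apply: (addrI (act 0 v)); rewrite -actDl !addr0. Qed.
Lemma actZl f c v : act (c *: f) v = c *: act f v.
Proof. by rewrite -[c *: f]addr0 actPl act0l addr0. Qed.
Lemma actNl f v : act (- f) v = - act f v.
Proof. by rewrite -[- f]scaleN1r actZl scaleN1r. Qed.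
Lemma act_suml v (I : Type) (r : seq I) (P : pred I) F :
  act (\sum_(i <- r | P i) F i) v = \sum_(i <- r | P i) act (F i) v.
Proof.
by apply: (big_morph (act^~ v) (id1 := 0)); [move=> x y; exact: actDl|exact: act0l].
Qed.

Local Notation op a := (act (mon a)).

Lemma op0 v : op 0 v = v. Proof. by rewrite (mon0 ht) act1. Qed.
Lemma opM a b : exists2 c, c != 0 & forall v, op a (op b v) = c *: op (a + b) v.
Proof.
by have [c c0 e] := monM ht a b; exists c => // v; rewrite -actM e actZl.
Qed.
Lemma opC a b v : op a (op b v) = lam a b *: op b (op a v).
Proof. by rewrite -!actM (monC ht) actZl. Qed.

Definition stable (N : V -> Prop) := lsubspace N /\ forall a v, N v -> N (op a v).

Lemma preim_subspace f N : lsubspace N -> lsubspace (fun v => N (act f v)).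
Proof.
by move=> hN; split=> [|c x y hx hy]; rewrite ?act0 ?actP; [exact: sub0|apply: hN.2].
Qed.
Lemma preiml_subspace v N : lsubspace N -> lsubspace (fun f => N (act f v)).
Proof.
by move=> hN; split=> [|c x y hx hy]; rewrite ?act0l ?actPl; [exact: sub0|apply: hN.2].
Qed.

Lemma act_lspanm f (N P Q : V -> Prop) x : (forall y, N y -> N (act f y)) ->
  (forall y, P y -> lspanm N Q (act f y)) -> lspanm N P x -> lspanm N Q (act f x).
Proof.
move=> hN hP; apply: (@lspanm_le _ _ N P (fun x => lspanm N Q (act f x))).
- exact: (preim_subspace _ (lspanm_subspace _ _)).
- by move=> y /hN; apply: lspanmN.
- exact: hP.
Qed.

Lemma opV_stable N a v : stable N -> N (op a v) -> N v.
Proof.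
move=> [hN hs] /(hs (- a)); have [c c0 ->] := opM (- a) a.
by rewrite addNr op0; apply: subZ_inv hN c0.
Qed.

Section Polynomials.
Variable z : A.
Definition pact (f : {poly k}) := act (horner_alg z f).

Lemma pactM f g v : pact (f * g) v = pact f (pact g v).
Proof. by rewrite /pact rmorphM actM. Qed.
Lemma pactC f g v : pact f (pact g v) = pact g (pact f v).
Proof. by rewrite -!pactM mulrC. Qed.
Lemma pact1 v : pact 1 v = v. Proof. by rewrite /pact rmorph1 act1. Qed.
Lemma pactX v : pact 'X v = act z v. Proof. by rewrite /pact horner_algX. Qed.
Lemma pactDl f g v : pact (f + g) v = pact f v + pact g v.
Proof. by rewrite /pact rmorphD actDl. Qed.
Lemma pactNl f v : pact (- f) v = - pact f v.
Proof. by rewrite /pact rmorphN actNl. Qed.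
Lemma pactZl c f v : pact (c *: f) v = c *: pact f v.
Proof. by rewrite /pact -mul_polyC rmorphM /= horner_algC mulr_algl actZl. Qed.
Lemma pactCl c v : pact c%:P v = c *: v.
Proof. by rewrite -[c%:P]mulr1 mul_polyC pactZl pact1. Qed.

Lemma pact0l v : pact 0 v = 0. Proof. by rewrite /pact rmorph0 act0l. Qed.
Lemma pact0 f : pact f 0 = 0. Proof. exact: act0. Qed.
Lemma pactD f v w : pact f (v + w) = pact f v + pact f w. Proof. exact: actD. Qed.
Lemma pactZ f c v : pact f (c *: v) = c *: pact f v. Proof. exact: actZ. Qed.
Lemma pactN f v : pact f (- v) = - pact f v. Proof. exact: actN. Qed.

Lemma pact_ind (S : V -> Prop) f v : lsubspace S -> (forall x, S x -> S (act z x)) ->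
  S v -> S (pact f v).
Proof.
move=> hS hz hv; elim/poly_ind: f => [|f c IH].
  by rewrite /pact rmorph0 act0l; apply: sub0.
rewrite pactDl mulrC pactM pactX pactCl; apply: subD => //; first exact: hz.
exact: subZ.
Qed.

Lemma pact_comm f g v : (forall x, act z (act g x) = act g (act z x)) ->
  pact f (act g v) = act g (pact f v).
Proof.
move=> h; elim/poly_ind: f => [|f c IH].
  by rewrite /pact rmorph0 !act0l act0.
by rewrite !pactDl [f * 'X]mulrC !pactM !pactX !pactCl IH h actD actZ.
Qed.

End Polynomials.
End TorusModules.

(** * A Nullstellensatz by generic freeness *)

Section CentralAlgebraic.
Variables (k : fieldType) (A : algType k) (G : zmodType).
Variables (mon : G -> A) (lam : G -> G -> k).
Hypothesis ht : torus_mon mon lam.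
Variables (V : lmodType k) (act : A -> V -> V).
Hypothesis hact : is_left_module act.
Local Notation op a := (act (mon a)).
Variables (p : nat) (E : exps p -> G) (N : V -> Prop).
Hypothesis hE : forall a b, E (eadd a b) = E a + E b.
Hypothesis hN : stable mon act N.

Lemma E0 : E (@e0 p) = 0.
Proof. by apply: (addrI (E (@e0 p))); rewrite -hE eadd0 addr0. Qed.

Let m v (a : exps p) := op (E a) v.

Lemma opE v a b : exists2 c, c != 0 & op (E a) (m v b) = c *: m v (eadd b a).
Proof.
have [c c0 e] := opM ht hact (E a) (E b); exists c => //.
by rewrite /m e hE addrC.
Qed.

(** A monomial operator turns a relation into another one, shifting all exponents by [b] up to
    nonzero scalars, and the order is translation invariant. *)
Lemma lead_upset v : upset (lead N (m v)).
Proof.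
move=> a b ha.
have [c c0 e] := opE v b a.
apply: (subZ_inv (lspanm_subspace _ _) c0); rewrite -e.
apply: (act_lspanm hact _ _ ha); first by move=> y; apply: hN.2.
move=> y [d [hd ->]]; have [c' c'0 ->] := opE v b d.
apply: (subZ _ (lspanm_subspace _ _)); apply: lspanmP; exists (eadd d b); split=> //.
exact: rankD.
Qed.

(* If every generator acts algebraically on [v], then [v] generates a finite
   dimensional space: high powers of a generator are leading monomials. *)
Lemma algebraic_fin v :
  (forall j, exists2 f, f != 0 & N (pact act (mon (E (edelta j 1))) f v)) ->
  exists D, forall a, lspanm N (fun y => exists b : {ffun 'I_p -> 'I_D.+1},
     y = op (E (emb b)) v) (op (E a) v).
Proof.
move=> hf.
have /choice[D hD] j : exists D, lead N (m v) (edelta j D).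
  have [f f0 hfj] := hf j; exists (size f).-1.
  set z := mon _ in hfj.
  have hz i : exists2 c, c != 0 & m v (edelta j i) = c *: pact act z 'X^i v.
    elim: i => [|i [c c0 e]].
      exists 1; rewrite ?oner_neq0 // expr0 pact1 // scale1r /m.
      have -> : edelta j 0 = @e0 p by apply/ffunP => i; rewrite !ffunE; case: eqP.
      by rewrite E0 (op0 ht hact).
    have [c' c'0 e'] := opE v (edelta j 1) (edelta j i).
    have ej : eadd (edelta j i) (edelta j 1) = edelta j i.+1.
      by apply/ffunP => l; rewrite !ffunE; case: eqP; rewrite // addn1.
    rewrite ej e in e'.
    exists (c'^-1 * c); first by rewrite mulf_neq0 // invr_eq0.
    apply: (scalerI c'0); rewrite -e' (actZ hact) -/z !scalerA mulrA mulfV // mul1r.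
    by rewrite exprS (pactM hact) pactX.
  have [c c0 ec] := hz (size f).-1.
  rewrite /lead ec.
  have hS := lspanm_subspace N (fun y => exists b, (rank b < rank (edelta j (size f).-1))%N /\ y = m v b).
  apply: (subZ _ hS).
  have hlead : N (\sum_(i < size f) f`_i *: pact act z 'X^i v).
    suff <- : pact act z f v = \sum_(i < size f) f`_i *: pact act z 'X^i v by [].
    rewrite -{1}(coefK f) poly_def /pact raddf_sum (act_suml hact).
    by apply: eq_bigr => i _; apply: (pactZl hact).
  have sf : size f = (size f).-1.+1 by rewrite prednK // lt0n size_poly_eq0.
  rewrite sf big_ord_recr /= in hlead.
  apply: (subZ_inv hS (c := lead_coef f)); first by rewrite lead_coef_eq0.
  rewrite lead_coefE; apply: (@subDl _ _ _ _ _ hS _ (lspanmN hlead)).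
  apply: (sub_sum _ hS) => i _; apply: (subZ _ hS).
  have [ci ci0 eci] := hz i.
  apply: (subZ_inv hS ci0); rewrite -eci; apply: lspanmP; exists (edelta j i); split=> //.
  apply: rank_deg; rewrite /deg (bigD1 j) // big1 => [|l]; last first.
    by rewrite ffunE; case: eqP.
  rewrite [X in (_ < X)%N](bigD1 j) //= !ffunE eqxx addn0; exact: leq_trans (ltn_ord i) (leq_addr _ _).
exists (\max_j D j) => a.
apply: (lspanm_mono _ (@span_nlead _ _ N _ (m v) a)) => y [b [_ nb ->]].
apply: lspanmP; exists (cut _ b); rewrite cutK // => i.
apply/ltnW; rewrite ltnNge; apply/negP => hi; apply: nb.
apply: (upset_ele (@lead_upset v) _ (hD i)) => l; rewrite ffunE.
by case: eqP => // ->; apply: leq_trans hi; apply: leq_bigmax.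
Qed.

Variables (z : G) (v : V).
Hypothesis hz : exists a, E a = z.
Hypothesis zC : forall a, lam z (E a) = 1.
Hypothesis simple : forall w, lspanm N (fun y => exists a, y = op (E a) v) w ->
  ~ N w -> lspanm N (fun y => exists a, y = op (E a) w) v.

Local Notation P f := (pact act (mon z) f).

Let P_N f x : N x -> N (P f x).
Proof. by move=> hx; apply: (pact_ind hact) => // [|y]; [exact: hN.1|apply: hN.2]. Qed.

Let P_op f a x : P f (op (E a) x) = op (E a) (P f x).
Proof.
by apply: (pact_comm hact) => y; rewrite (opC ht hact) zC scale1r.
Qed.

Let P_span f (Q : exps p -> Prop) x :
  lspanm N (fun y => exists b g, Q b /\ y = P g (m v b)) x ->
  lspanm N (fun y => exists b g, Q b /\ y = P g (m v b)) (P f x).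
Proof.
apply: (act_lspanm hact); first exact: P_N.
move=> y [b [g [hb ->]]]; apply: lspanmP; exists b, (f * g); split=> //.
by rewrite (pactM hact).
Qed.

(* Generic freeness over [k[z]]: after inverting one polynomial [c] the module
   becomes free over [k[z]] with [v] among its basis elements, whereas by
   simplicity [v] is divisible by [1 + c * 'X]. *)
Lemma central_algebraic : exists2 f, f != 0 & N (P f v).
Proof.
apply: contrapT => hno.
have {}hno f : f != 0 -> ~ N (P f v) by move=> f0 hf; apply: hno; exists f.
(* [L] collects the exponents whose monomial becomes, after multiplication by a nonzero polynomial
   in z, a k[z]-combination of smaller monomials. *)
pose W (a : exps p) := lspanm N (fun y => exists b g, (rank b < rank a)%N /\ y = P g (m v b)).
pose L (a : exps p) := exists2 f, f != 0 & W a (P f (m v a)).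
have opW f a b : W a (P f (m v a)) -> W (eadd a b) (P f (m v (eadd a b))).
  move=> h; have [c c0 e] := opE v b a.
  apply: (subZ_inv (lspanm_subspace _ _) c0); rewrite -(pactZ hact) -e P_op.
  apply: (act_lspanm hact _ _ h); first by move=> y; apply: hN.2.
  move=> y [d [g [hd ->]]]; rewrite -P_op; have [c' c'0 ->] := opE v b d.
  rewrite (pactZ hact); apply: (subZ _ (lspanm_subspace _ _)).
  by apply: lspanmP; exists (eadd d b), g; split=> //; apply: rankD.
have upL : upset L by move=> a b [f f0 hf]; exists f => //; exact: opW.
have [K hK] := dickson upL.
have /choice[F hF] (b : {ffun 'I_p -> 'I_K.+1}) : exists f : {poly k},
    f != 0 /\ (L (emb b) -> W (emb b) (P f (m v (emb b)))).
  have [[f f0 hf]|h] := pselect (L (emb b)); first by exists f.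
  by exists 1; split; [exact: oner_neq0|move=> h'; case: h].
(* Finitely many truncated exponents determine [L], and relations can be translated, so the single
   polynomial [c] works for all of [L]. *)
pose c := \prod_b F b.
have c0 : c != 0 by apply/prodf_neq0 => b _; case: (hF b).
have Wc a : L a -> W a (P c (m v a)).
  move=> /hK ha.
  have e : emb (cut K (trunc K a)) = trunc K a by rewrite cutK // => i; rewrite ffunE geq_minr.
  have ea : a = eadd (trunc K a) (esub a (trunc K a)).
    by rewrite eaddC esubK // => i; rewrite ffunE geq_minl.
  rewrite ea; apply: opW; rewrite -e in ha *.
  rewrite /c (bigD1 (cut K (trunc K a))) //= mulrC (pactM hact); apply: P_span.
  by case: (hF (cut K (trunc K a))) => _; apply.
pose Q := lspanm N (fun y => exists b g, ~ L b /\ y = P g (m v b)).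
(* [S] is membership in [Q] after inverting [c]; all monomials satisfy it, by induction on the
   rank. *)
pose S x := exists e, Q (P (c ^+ e) x).
have Smono e e' x : (e <= e')%N -> Q (P (c ^+ e) x) -> Q (P (c ^+ e') x).
  by move=> he h; rewrite -(subnK he) exprD (pactM hact); apply: P_span.
have hS : lsubspace S.
  split=> [|a x y [e1 h1] [e2 h2]]; first by exists 0%N; rewrite (pact0 hact); exact: (sub0 (lspanm_subspace _ _)).
  exists (e1 + e2)%N; rewrite (pactD hact) (pactZ hact); apply: (lspanm_subspace _ _).2.
    by apply: Smono h1; apply: leq_addr.
  by apply: Smono h2; apply: leq_addl.
have SP f x : S x -> S (P f x) by move=> [e h]; exists e; rewrite (pactC hact); apply: P_span.
have Sm a : S (m v a).
  move: {2}(rank a).+1 (ltnSn (rank a)) => r; elim: r a => // r IH a; rewrite ltnS => ha.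
  have [hl|hl] := pselect (L a); last first.
    exists 0%N; rewrite expr0 (pact1 hact); apply: lspanmP; exists a, 1.
    by rewrite (pact1 hact).
  have [e he] : S (P c (m v a)).
    apply: (lspanm_le hS _ _ (Wc a hl)); first by move=> y hy; exists 0%N; apply: lspanmN; apply: P_N.
    by move=> y [b [g [hb ->]]]; apply: SP; apply: IH; apply: leq_trans ha.
  by exists e.+1; rewrite exprSr (pactM hact).
have mv0 : m v (@e0 p) = v by rewrite /m E0 (op0 ht hact).
(* [pi] is coprime to [c] and has positive degree even when [c] is constant, so it divides no power
   of [c]. *)
pose pi : {poly k} := 1 + c * 'X.
have sc : (0 < size c)%N by rewrite lt0n size_poly_eq0.
have spi : size pi = (size c).+1.
  by rewrite /pi addrC size_polyDl size_mulX // size_poly1 ltnS.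
have pi0 : pi != 0 by rewrite -size_poly_eq0 spi.
have vspan : lspanm N (fun y => exists a, y = op (E a) (P pi v)) v.
  apply: simple; last exact: hno.
  apply: (@pact_ind _ _ _ _ hact _ (lspanm N (fun y => exists a, y = op (E a) v))).
  - exact: lspanm_subspace.
  - move=> x; have [a0 <-] := hz; apply: (act_lspanm hact); first by move=> y; apply: hN.2.
    move=> y [a ->]; have [c' c'0 ->] := opM ht hact (E a0) (E a); rewrite -hE.
    by apply: (subZ _ (lspanm_subspace _ _)); apply: lspanmP; exists (eadd a0 a).
  - by apply: lspanmP; exists (@e0 p); rewrite E0 (op0 ht hact).
have [u hu hvu] : exists2 u, S u & N (v - P pi u).
  apply: (lspanm_le _ _ _ vspan (S := fun x => exists2 u, S u & N (x - P pi u))).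
  - split=> [|a x y [u1 s1 h1] [u2 s2 h2]].
      by exists 0; [exact: sub0|rewrite (pact0 hact) subrr; apply: sub0 hN.1].
    exists (a *: u1 + u2); first by apply: hS.2.
    rewrite (pactD hact) (pactZ hact) opprD addrACA -scalerBr; exact: hN.1.2.
  - move=> y hy; exists 0; first exact: sub0.
    by rewrite (pact0 hact) subr0.
  - by move=> y [a ->]; exists (m v a) => //; rewrite P_op subrr; apply: sub0 hN.1.
have [e he] := hu.
pose Q' := lspanm N (fun y => exists b, (~ L b /\ b <> @e0 p) /\ exists g, y = P g (m v b)).
have nL0 : ~ L (@e0 p).
  move=> [f f0]; rewrite /W mv0 => h; apply: (hno f f0).
  apply: (lspanm_le hN.1 _ _ h) => // y [b [g [hb _]]]; exfalso; move: hb.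
  rewrite ltnNge; apply/negP; rewrite negbK leqNgt rank_ltE /dlt.
  have -> : deg (@e0 p) = 0%N by rewrite /deg big1 // => i _; rewrite ffunE.
  by rewrite ltn0 /= negb_and; apply/orP; right; apply/lexltP => -[i [+ _]]; rewrite !ffunE.
have [g0 hg0] : exists g, Q' (P (c ^+ e) u - P g v).
  apply: (lspanm_le _ _ _ he (S := fun x => exists g, Q' (x - P g v))).
  - split=> [|a x y [g1 h1] [g2 h2]].
      exists 0; rewrite (pact0l hact) subrr; exact: (sub0 (lspanm_subspace _ _)).
    exists (a *: g1 + g2); rewrite (pactDl hact) (pactZl hact) opprD addrACA -scalerBr.
    exact: (lspanm_subspace _ _).2.
  - move=> y hy; exists 0; rewrite (pact0l hact) subr0; exact: lspanmN.
  - move=> y [b [g [hb ->]]]; have [->|hb0] := eqVneq b (@e0 p).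
      exists g; rewrite mv0 subrr; exact: (sub0 (lspanm_subspace _ _)).
    exists 0; rewrite (pact0l hact) subr0; apply: lspanmP; exists b.
    by split; [split=> //; apply/eqP|exists g].
have Q'P f x : Q' x -> Q' (P f x).
  apply: (act_lspanm hact); first exact: P_N.
  move=> y [b [hb [g ->]]]; apply: lspanmP; exists b; split=> //; exists (f * g).
  by rewrite (pactM hact).
(* The exponent 0 is not in [L], so modulo [N] the vector [v] is free over k[z] and independent of
   the other basis monomials. *)
have key f : Q' (P f v) -> f = 0.
  move=> hf; apply/eqP; apply: contrapT => /negP f0.
  have subY b : lsubspace (fun y => exists g, y = P g (m v b)).
    split=> [|a x y [g1 ->] [g2 ->]]; first by exists 0; rewrite (pact0l hact).
    by exists (a *: g1 + g2); rewrite (pactDl hact) (pactZl hact).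
  have [s [y [us hs hy hfy]]] := lspanm_seq hN.1 subY hf.
  have n0 : @e0 p \notin s by apply/negP => /hs [].
  pose x b := if b == @e0 p then P f v else - y b.
  have hsum : N (\sum_(b <- @e0 p :: s) x b).
    rewrite big_cons {1}/x eqxx (eq_big_seq (fun b => - y b)) ?sumrN //.
    by move=> b hb; rewrite /x; case: eqP => // eb; move: n0; rewrite -eb hb.
  have nx0 : ~ N (x (@e0 p)) by rewrite /x eqxx; apply: hno.
  have us0 : uniq (@e0 p :: s) by rewrite /= n0.
  have inj : {in (@e0 p :: s) &, injective (@rank p)} by move=> ? ? _ _; apply: rank_inj.
  have [b [hb nb hlead]] := leading_term hN.1 us0 inj hsum
    (ex_intro2 _ _ (@e0 p) (mem_head _ _) nx0).
  have hform b' : b' \in @e0 p :: s -> exists g, x b' = P g (m v b').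
    rewrite inE /x; case: eqP => [-> _|_ /= /hy [g ->]]; first by exists f; rewrite mv0.
    by exists (- g); rewrite (pactNl hact).
  have [g eg] := hform b hb.
  have Lb : L b.
    exists g; first by apply: contra_notN nb => /eqP g0'; rewrite eg g0' (pact0l hact); apply: sub0 hN.1.
    rewrite -eg; apply: lspanm_mono hlead => w [b' [hb' hr ->]].
    apply: (subN (lspanm_subspace _ _)).
    have [g' eg'] := hform b' hb'; rewrite eg'.
    by apply: lspanmP; exists b', g'.
  by move: hb Lb; rewrite inE => /orP[/eqP ->|/hs [nb' _]].
(* Comparing the coefficients of [v] in c^e v = pi c^e u gives the divisibility that coprimality
   forbids. *)
have : c ^+ e = pi * g0.
  apply/eqP; rewrite -subr_eq0; apply/eqP; apply: key.
  rewrite (pactDl hact) (pactNl hact) (pactM hact).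
  have -> : P (c ^+ e) v - P pi (P g0 v) = P (c ^+ e) (v - P pi u) +
      P pi (P (c ^+ e) u - P g0 v).
    rewrite !(pactD hact) !(pactN hact) addrA.
    by rewrite [P pi (P (c ^+ e) u)](pactC hact) subrK.
  apply: (subD (lspanm_subspace _ _)); first by apply: lspanmN; apply: P_N.
  exact: Q'P.
move=> ec.
have : coprimep pi (c ^+ e).
  apply: coprimep_expr; apply/Bezout_eq1_coprimepP; exists (1, - 'X) => /=.
  rewrite /pi; ring.
move/coprimepP/(_ pi (dvdpp pi)).
rewrite ec dvdp_mulr // => /(_ isT) /eqp_size.
by rewrite spi size_poly1 => -[] e1; rewrite e1 in sc.
Qed.

End CentralAlgebraic.

Notation lattice n := {ffun 'I_n -> int}.

Section LatticeMaps.
Variable n : nat.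
Implicit Types (S : pred 'I_n).

Definition restr S (a : lattice n) : lattice n := [ffun i => if S i then a i else 0].
Definition epos S (a : exps n) : lattice n := [ffun i => if S i then (a i)%:Z else 0].
(** Leading terms need exponents in N^p. An integer vector is written as a difference, so a Laurent
    polynomial ring is treated as an image of a polynomial ring in 2n variables. *)
Definition epm S (a : exps (n + n)) : lattice n :=
  [ffun i => if S i then (a (lshift n i))%:Z - (a (rshift n i))%:Z else 0].
Definition lbasis (i : 'I_n) : lattice n := [ffun j => (j == i)%:Z].

Lemma latMzE (a : lattice n) (j : int) i : (a *~ j) i = a i * j.
Proof.
have hn m : (a *+ m) i = a i * m%:Z.
  elim: m => [|m IH]; first by rewrite mulr0n ffunE mulr0.
  by rewrite mulrS ffunE IH -add1n PoszD mulrDr mulr1.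
case: j => m; first by rewrite -pmulrn hn.
by rewrite NegzE mulrNz -pmulrn ffunE hn mulrN.
Qed.

Lemma eposD S (a b : exps n) : epos S (eadd a b) = epos S a + epos S b.
Proof. by apply/ffunP => i; rewrite !ffunE; case: ifP => // _; rewrite PoszD. Qed.
Lemma epmD S (a b : exps (n + n)) : epm S (eadd a b) = epm S a + epm S b.
Proof.
by apply/ffunP => i; rewrite !ffunE; case: ifP => // _; rewrite !PoszD; ring.
Qed.
Lemma epm_onto S (a : lattice n) : (forall i, ~~ S i -> a i = 0) -> exists b, epm S b = a.
Proof.
move=> ha; pose f (z : int) := if z is Posz m then m else 0%N.
exists [ffun j => match split j with inl i => f (a i) | inr i => f (- a i) end].
apply/ffunP => i; rewrite !ffunE; case: ifP => [_|/negbT /ha //].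
rewrite !(unsplitK (inl _)) !(unsplitK (inr _)) /f.
move: (a i) => z; case: z => m; last by rewrite NegzE opprK /= sub0r.
by case: m => [|m] //=; rewrite subr0.
Qed.

Lemma epm_supp S a i : ~~ S i -> epm S a i = 0.
Proof. by rewrite ffunE => /negPf ->. Qed.
End LatticeMaps.

(** * Subalgebras and orbits spanned by sets of monomials *)

Section Spans.
Variables (k : fieldType) (A : algType k) (G : zmodType).
Variables (mon : G -> A) (lam : G -> G -> k).
Hypothesis ht : torus_mon mon lam.
Variables (V : lmodType k) (act : A -> V -> V).
Hypothesis hact : is_left_module act.
Local Notation op a := (act (mon a)).
Variables (N : V -> Prop) (hN : stable mon act N).
Implicit Types (H : G -> Prop).

Definition alg H : A -> Prop := lspan (fun f => exists2 a, H a & f = mon a).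
Definition orb H v : V -> Prop := lspanm N (fun y => exists2 a, H a & y = op a v).

Lemma orb_op H a v x : (forall c, H c -> H (a + c)) ->
  orb H v x -> orb H v (op a x).
Proof.
move=> hH; apply: (act_lspanm hact); first by move=> y; apply: hN.2.
move=> y [c hc ->]; have [d d0 ->] := opM ht hact a c.
by apply: (subZ _ (lspanm_subspace _ _)); apply: lspanmP; exists (a + c) => //; apply: hH.
Qed.

Lemma orb_alg H v x : orb H v x -> exists2 f, alg H f & N (x - act f v).
Proof.
apply: (lspanm_le (S := fun x => exists2 f, alg H f & N (x - act f v))).
- split=> [|c y1 y2 [f1 h1 n1] [f2 h2 n2]].
    exists 0; first exact: (sub0 (lspan_subspace _)).
    by rewrite (act0l hact) subrr; apply: sub0 hN.1.
  exists (c *: f1 + f2); first exact: (lspan_subspace _).2.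
  by rewrite (actPl hact) opprD addrACA -scalerBr; apply: hN.1.2.
- move=> y hy; exists 0; first exact: (sub0 (lspan_subspace _)).
  by rewrite (act0l hact) subr0.
- move=> y [a ha ->]; exists (mon a); first by apply: lspan_in; exists a.
  by rewrite subrr; apply: sub0 hN.1.
Qed.


Lemma alg_N H f x : alg H f -> N x -> N (act f x).
Proof.
move=> hf hx; apply: (lspan_le (S := fun f => N (act f x)) _ _ hf).
  exact: (preiml_subspace hact x hN.1).
by move=> y [a ha ->]; apply: hN.2.
Qed.

Lemma algM H f g : (forall a b, H a -> H b -> H (a + b)) -> alg H f -> alg H g ->
  alg H (f * g).
Proof.
move=> hH; apply: lspan_mul; first exact: lspan_subspace.
move=> _ _ [a ha ->] [b hb ->]; have [c c0 ->] := monM ht a b.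
by apply: (subZ _ (lspan_subspace _)); apply: lspan_in; exists (a + b) => //; apply: hH.
Qed.

Lemma alg_mon_comm H b f : (forall a, H a -> lam a b = 1) -> alg H f ->
  f * mon b = mon b * f.
Proof.
by move=> hH; apply: lspan_commute => _ [a ha ->]; rewrite (monC ht a b) hH // scale1r.
Qed.

Lemma alg_comm H f g : (forall a b, H a -> H b -> lam a b = 1) ->
  alg H f -> alg H g -> f * g = g * f.
Proof.
move=> hH hf hg; apply/esym; apply: (lspan_commute _ hg) => _ [b hb ->].
by apply/esym; apply: (alg_mon_comm _ hf) => a ha; apply: hH.
Qed.

(** Commuting past a monomial only rescales each monomial, so a subspace spanned by monomials is
    carried to itself. *)
Lemma alg_conj H b f : alg H f -> exists2 g, alg H g & f * mon b = mon b * g.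
Proof.
apply: (lspan_le (S := fun f => exists2 g, alg H g & f * mon b = mon b * g)).
  split=> [|c x y [g1 h1 e1] [g2 h2 e2]].
    by exists 0; rewrite ?mul0r ?mulr0 //; apply: (sub0 (lspan_subspace _)).
  exists (c *: g1 + g2); first exact: (lspan_subspace _).2.
  by rewrite mulrDl mulrDr -scalerAl -scalerAr e1 e2.
move=> _ [a ha ->]; exists (lam a b *: mon a).
  by apply: (subZ _ (lspan_subspace _)); apply: lspan_in; exists a.
by rewrite (monC ht a b) scalerAr.
Qed.

Lemma alg_conjV H b f : alg H f -> exists2 g, alg H g & g * mon b = mon b * f.
Proof.
apply: (lspan_le (S := fun f => exists2 g, alg H g & g * mon b = mon b * f)).
  split=> [|c x y [g1 h1 e1] [g2 h2 e2]].
    by exists 0; rewrite ?mul0r ?mulr0 //; apply: (sub0 (lspan_subspace _)).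
  exists (c *: g1 + g2); first exact: (lspan_subspace _).2.
  by rewrite mulrDl mulrDr -scalerAl -scalerAr e1 e2.
move=> _ [a ha ->]; exists ((lam a b)^-1 *: mon a).
  by apply: (subZ _ (lspan_subspace _)); apply: lspan_in; exists a.
by rewrite -scalerAl (monC ht a b) scalerA mulVf ?scale1r // (lam_neq0 ht).
Qed.

Lemma alg_conj2 H b f : alg H f -> exists g, alg H g /\ f * mon b = mon b * g.
Proof. by move/(alg_conj b) => [g]; exists g. Qed.

Lemma orb_act H f v x : (forall a b, H a -> H b -> H (a + b)) -> alg H f ->
  orb H v x -> orb H v (act f x).
Proof.
move=> hH hf hx; apply: (lspan_le (S := fun f => orb H v (act f x)) _ _ hf).
  exact: (preiml_subspace hact x (lspanm_subspace _ _)).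
by move=> _ [a ha ->]; apply: orb_op => // c; apply: hH.
Qed.

End Spans.

(** * Growth of simple modules over a torus with large commuting part *)

Section PrimeAnnihilator.
Variables (k : fieldType) (A : algType k) (G : zmodType).
Variables (mon : G -> A) (lam : G -> G -> k).
Hypothesis ht : torus_mon mon lam.
Variables (V : lmodType k) (act : A -> V -> V).
Hypothesis hact : is_left_module act.
Local Notation op a := (act (mon a)).
Variables (N : V -> Prop) (hN : stable mon act N).
Variables (p : nat) (E : exps p -> G) (H : G -> Prop).
Hypothesis hE : forall a b, E (eadd a b) = E a + E b.
Hypothesis EH : forall a, H (E a).
Hypothesis Eonto : forall g, H g -> exists a, E a = g.
Hypothesis HC : forall a b, H a -> H b -> lam a b = 1.

Local Notation ann v := (fun f => alg mon H f /\ N (act f v)).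
Let m v (a : exps p) := op (E a) v.
Let low R := lspan (fun f => exists b, (rank b < R)%N /\ f = mon (E b)).

Let low_alg R f : low R f -> alg mon H f.
Proof.
by apply: lspan_mono => _ [b [_ ->]]; exists (E b) => //; apply: EH.
Qed.

(** Relations among the vectors [m v a] are read as elements of the annihilator of [v] with
    prescribed leading monomial. *)
Let lead_low v a : lead N (m v) a <->
  exists2 g, low (rank a) g & N (act (mon (E a) - g) v).
Proof.
split=> [h|[g hg hn]].
  suff [g hg hn] : exists2 g, low (rank a) g & N (m v a - act g v).
    by exists g => //; rewrite (actDl hact) (actNl hact).
  apply: (lspanm_le (S := fun x => exists2 g, low (rank a) g & N (x - act g v)) _ _ _ h).
  - split=> [|c y1 y2 [f1 h1 n1] [f2 h2 n2]].
      exists 0; first exact: (sub0 (lspan_subspace _)).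
      by rewrite (act0l hact) subrr; apply: sub0 hN.1.
    exists (c *: f1 + f2); first exact: (lspan_subspace _).2.
    by rewrite (actPl hact) opprD addrACA -scalerBr; apply: hN.1.2.
  - move=> y hy; exists 0; first exact: (sub0 (lspan_subspace _)).
    by rewrite (act0l hact) subr0.
  - move=> y [b [hb ->]]; exists (mon (E b)); first by apply: lspan_in; exists b.
    by rewrite subrr; apply: sub0 hN.1.
rewrite (actDl hact) (actNl hact) in hn.
pose L := lspanm N (fun y => exists b, (rank b < rank a)%N /\ y = m v b).
apply: (@subDl _ _ L (- act g v)); first exact: lspanm_subspace.
  apply: (subN (lspanm_subspace _ _)).
  apply: (lspan_le (S := fun g => L (act g v)) _ _ hg).
    exact: (preiml_subspace hact v (lspanm_subspace _ _)).
  by move=> _ [b [hb ->]]; apply: lspanmP; exists b.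
by rewrite addrC; apply: lspanmN.
Qed.

Let lead_mono v v' : (forall f, ann v f -> ann v' f) ->
  forall a, lead N (m v) a -> lead N (m v') a.
Proof.
move=> h a /lead_low[g hg hn]; apply/lead_low; exists g => //.
apply: (h _ (conj _ hn)).2; apply: (subB (lspan_subspace _)); last exact: low_alg hg.
by apply: lspan_in; exists (E a); first exact: EH.
Qed.

(** Division with remainder: the leading monomial of an element of the larger annihilator is
    cancelled by an element of the smaller one, until nothing remains. *)
Let ann_lead v v' : (forall f, ann v f -> ann v' f) ->
  (forall a, lead N (m v') a -> lead N (m v) a) -> forall f, ann v' f -> ann v f.
Proof.
move=> hvv hl f [hf hfn]; split=> //.
have [R hR] : exists R, low R f.
  apply: (lspan_le (S := fun f => exists R, low R f) _ _ hf).
    split=> [|c x y [R1 h1] [R2 h2]]; first by exists 0%N; apply: (sub0 (lspan_subspace _)).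
    exists (R1 + R2)%N; apply: (lspan_subspace _).2.
      by apply: lspan_mono h1 => _ [b [hb ->]]; exists b; split=> //; apply: ltn_addr.
    by apply: lspan_mono h2 => _ [b [hb ->]]; exists b; split=> //; apply: ltn_addl.
  move=> _ [a /Eonto[b <-] ->]; exists (rank b).+1; apply: lspan_in; exists b.
  by rewrite ltnS leqnn.
elim: R f hR hfn {hf} => [|R IH] f hR hfn.
  have -> : f = 0; last by rewrite (act0l hact); apply: sub0 hN.1.
  by apply: (lspan_le (S := fun f => f = 0) _ _ hR); [exact: subspace_eq0|move=> y [b []]].
have [[b hb]|nb] := pselect (exists b : exps p, rank b = R); last first.
  apply: IH hfn; apply: lspan_mono hR => _ [b [hb ->]]; exists b; split=> //.
  by move: hb; rewrite ltnS leq_eqVlt => /orP[/eqP e|//]; case: nb; exists b.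
have [c hc] : exists c, low R (f - c *: mon (E b)).
  apply: (lspan_le (S := fun f => exists c, low R (f - c *: mon (E b))) _ _ hR).
    split=> [|c x y [c1 h1] [c2 h2]].
      by exists 0; rewrite scale0r subrr; apply: (sub0 (lspan_subspace _)).
    exists (c * c1 + c2); rewrite scalerDl opprD addrACA -scalerA -scalerBr.
    exact: (lspan_subspace _).2.
  move=> _ [d [hd ->]]; move: hd; rewrite ltnS leq_eqVlt => /orP[/eqP e|hd].
    exists 1; have -> : d = b by apply: rank_inj; rewrite e.
    by rewrite scale1r subrr; apply: (sub0 (lspan_subspace _)).
  by exists 0; rewrite scale0r subr0; apply: lspan_in; exists d.
have [c0|c0] := eqVneq c 0; first by apply: IH hfn; move: hc; rewrite c0 scale0r subr0.
have lb' : lead N (m v') b.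
  apply/lead_low; exists (- c^-1 *: (f - c *: mon (E b))).
    by rewrite hb; apply: (subZ _ (lspan_subspace _)).
  have -> : mon (E b) - - c^-1 *: (f - c *: mon (E b)) = c^-1 *: f.
    by rewrite scaleNr opprK scalerBr scalerA mulVf // scale1r addrC subrK.
  by rewrite (actZl hact); apply: subZ hN.1 hfn.
have /lead_low[g hg hn] := hl _ lb'.
have hgb : alg mon H (mon (E b) - g).
  apply: (subB (lspan_subspace _)); last exact: low_alg hg.
  by apply: lspan_in; exists (E b); first exact: EH.
have -> : f = (f - c *: (mon (E b) - g)) + c *: (mon (E b) - g) by rewrite subrK.
rewrite (actDl hact); apply: (subD hN.1); last by rewrite (actZl hact); apply: subZ hN.1 hn.
apply: IH.
  have -> : f - c *: (mon (E b) - g) = (f - c *: mon (E b)) + c *: g.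
    by rewrite scalerBr opprB [c *: g - _]addrC addrA.
  by apply: (subD (lspan_subspace _)) => //; apply: (subZ _ (lspan_subspace _)); rewrite -hb.
rewrite (actDl hact) (actNl hact) (actZl hact); apply: (subB hN.1) => //.
by apply: (subZ _ hN.1); apply: (hvv _ (conj hgb hn)).2.
Qed.

(** An annihilator maximal among those of vectors outside [N] exists, as a strict chain would yield
    a strict chain of upsets. The annihilator of g v contains that of v; if g v is outside [N] they
    agree by maximality, and f lies in it. *)
Lemma prime_annihilator : (exists v, ~ N v) -> exists2 v, ~ N v &
  forall f g, alg mon H f -> alg mon H g -> N (act f (act g v)) ->
    N (act f v) \/ N (act g v).
Proof.
move=> [v0 nv0].
have [v nv hmax] : exists2 v, ~ N v & forall v', ~ N v' ->
    (forall f, ann v f -> ann v' f) -> forall f, ann v' f -> ann v f.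
  apply: contrapT => hno.
  have step (x : {v | ~ N v}) : {y : {v | ~ N v} |
      (forall f, ann (sval x) f -> ann (sval y) f) /\
      ~ (forall f, ann (sval y) f -> ann (sval x) f)}.
    apply: cid; case: x => v nv /=; apply: contrapT => h; apply: hno; exists v => // v' nv' h1.
    apply: contrapT => h2; apply: h; by exists (exist _ v' nv').
  have [s [_ hs]] := dependent_choice step (exist _ v0 nv0).
  have [] := @upset_acc _ (fun i => lead N (m (sval (s i)))).
  - by move=> i; apply: (lead_upset ht hact hE hN).
  - by move=> i; apply: lead_mono; case: (hs i).
  - move=> i hi; have [h1 h2] := hs i; apply: h2; exact: ann_lead hi.
exists v => // f g hf hg hfg.
have [ng|ng] := pselect (N (act g v)); [by right|left].
apply: (hmax _ ng _ f (conj hf hfg)).2 => h [hh hhv]; split=> //.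
rewrite -(actM hact) (alg_comm ht HC hh hg) (actM hact).
exact: (alg_N hact hN hg).
Qed.

End PrimeAnnihilator.

Section Growth.
Variables (k : fieldType) (A : algType k) (n : nat) (mon : lattice n -> A).
Variables (V : lmodType k) (act : A -> V -> V) (N : V -> Prop).

(** Only nonnegative exponents are tested: an invertible monomial moves any box of exponents into
    such a cube. *)
Definition growth_le d C v := forall M, exists (J : finType) (w : J -> V),
  (#|J| <= C * (M.+1) ^ d)%N /\ forall a : exps n, (forall i, a i <= M)%N ->
    lspanm N (fun y => exists j, y = w j) (act (mon (epos predT a)) v).

Definition growth_ge d v := forall M, exists (J : finType) (f : J -> exps n),
  [/\ (M.+1 ^ d <= #|J|)%N, (forall j i, f j i <= M)%N &
   indep N (fun j => act (mon (epos predT (f j))) v)].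

End Growth.

Lemma big_ext_seq (I : eqType) (V : zmodType) (s t : seq I) (y : I -> V) :
  uniq s -> uniq t -> {subset s <= t} ->
  \sum_(i <- s) y i = \sum_(i <- t) (if i \in s then y i else 0).
Proof.
move=> us ut st; rewrite -big_mkcond /= -[RHS]big_filter; apply: perm_big.
apply: uniq_perm => //; first exact: filter_uniq.
by move=> i; rewrite mem_filter; apply/idP/andP => [h|[]//]; split=> //; apply: st.
Qed.

(** * The two possible growth rates over a torus with a commutative part of corank one *)

Section SimpleTorus.
Variables (k : fieldType) (A : algType k) (n : nat).
Variables (mon : lattice n -> A) (lam : lattice n -> lattice n -> k).
Hypothesis ht : torus_mon mon lam.
Variables (V : lmodType k) (act : A -> V -> V).
Hypothesis hact : is_left_module act.
Local Notation op a := (act (mon a)).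
Variables (N : V -> Prop) (hN : stable mon act N).
Hypothesis hmax : forall N', stable mon act N' -> (forall x, N x -> N' x) ->
  (forall x, N' x -> N x) \/ (forall x, N' x).
Variables (i0 : 'I_n) (I : {set 'I_n}).
Hypothesis i0I : i0 \notin I.
(** [PB] spans the commutative part. Within it, [YY] gives the directions on which conjugation by
    [T] is faithful and [ZZ] those whose monomials are central in the whole torus. *)
Let T := lbasis i0.
Let PB (a : lattice n) := a i0 = 0.
Let YY (a : lattice n) := forall i, i \notin I -> a i = 0.
Let ZZ (a : lattice n) := forall i, i \in i0 |: I -> a i = 0.
Hypothesis hcomm : forall a b, PB a -> PB b -> lam a b = 1.
Hypothesis hY : forall b, YY b -> lam T b = 1 -> b = 0.
Hypothesis hZ : forall b, ZZ b -> lam T b = 1.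

Let Tz (j : int) i : (T *~ j) i = if i == i0 then j else 0.
Proof.
by rewrite latMzE ffunE; case: eqP; rewrite ?mul1r ?mul0r.
Qed.

Let PBD a b : PB a -> PB b -> PB (a + b).
Proof. by rewrite /PB ffunE => -> ->. Qed.

Let Tsplit (a : lattice n) : exists2 b, PB b & a = T *~ (a i0) + b.
Proof.
exists (a - T *~ (a i0)); first by rewrite /PB !ffunE Tz eqxx subrr.
by rewrite addrC subrK.
Qed.

Let cyclic w x : ~ N w -> orb mon act N (fun=> True) w x.
Proof.
move=> nw; have [||h|] := hmax (N' := orb mon act N (fun=> True) w) => //.
- split; first exact: lspanm_subspace.
  by move=> a v; apply: (orb_op ht hact hN).
- by move=> y; apply: lspanmN.
case: nw; apply: h; apply: lspanmP; exists 0 => //; by rewrite (op0 ht hact).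
Qed.

Variable v : V.
Hypothesis nv : ~ N v.
Hypothesis prime : forall f g, alg mon PB f -> alg mon PB g -> N (act f (act g v)) ->
  N (act f v) \/ N (act g v).

Let direct := forall (s : seq int) (w : int -> V), uniq s ->
  (forall j, j \in s -> orb mon act N PB v (w j)) ->
  N (\sum_(j <- s) op (T *~ j) (w j)) -> forall j, j \in s -> N (w j).

Let S1 := fun i => i != i0.
Let E1 := @epm n S1.
Let E1PB a : PB (E1 a). Proof. by rewrite /PB /E1 epm_supp // /S1 eqxx. Qed.
Let E1onto b : PB b -> exists a, E1 a = b.
Proof. by move=> hb; apply: epm_onto => i; rewrite negbK => /eqP ->. Qed.

Let orbE1 w x : orb mon act N PB w x <->
  lspanm N (fun y => exists a, y = op (E1 a) w) x.
Proof.
split; apply: lspanm_mono => y.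
  by move=> [b /E1onto[a <-] ->]; apply: lspanmP; exists a.
by move=> [a ->]; apply: lspanmP; exists (E1 a).
Qed.

Let sumT_N (s : seq int) (w : int -> V) : (forall j, j \in s -> N (w j)) ->
  N (\sum_(j <- s) op (T *~ j) (w j)).
Proof.
move=> h; rewrite big_seq; apply: (sub_sum _ hN.1) => j hj; apply: hN.2; exact: h.
Qed.

(** As V / N is simple over the torus, v is a sum of T^j w_j with w_j in P w. By directness only the
    component j = 0 survives, so v lies in P w modulo [N]. *)
Let direct_simple : direct -> forall w, orb mon act N PB v w -> ~ N w ->
  orb mon act N PB w v.
Proof.
move=> hdir w hw nw.
pose Y (j : int) y := exists2 y', orb mon act N PB w y' & y = op (T *~ j) y'.
have hYs j : lsubspace (Y j).
  split=> [|c x y [x' hx ->] [y' hy ->]].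
    by exists 0; rewrite ?(act0 hact) //; apply: (sub0 (lspanm_subspace _ _)).
  by exists (c *: x' + y'); rewrite ?(actP hact) //; apply: (lspanm_subspace _ _).2.
have hv : lspanm N (fun y => exists j, True /\ Y j y) v.
  apply: lspanm_mono (cyclic v nw) => y [a _ ->].
  have [b hb ->] := Tsplit a.
  have [c c0 e] := opM ht hact (T *~ a i0) b.
  apply: (subZ_inv (lspanm_subspace _ _) c0); rewrite -e; apply: lspanmP.
  by exists (a i0); split=> //; exists (op b w) => //; apply: lspanmP; exists b.
have [s [y [us _ hy hvs]]] := lspanm_seq hN.1 hYs hv.
have /choice[w' hw'] (j : int) : exists w', j \in s ->
    orb mon act N PB w w' /\ y j = op (T *~ j) w'.
  by have [/hy [w' h1 h2]|] := boolP (j \in s); [exists w'|exists 0].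
(* The index 0 may be missing from [s]; it is added so that [v] itself can be subtracted there. *)
pose s' := undup (0 :: s).
have us' : uniq s' by exact: undup_uniq.
have ss' : {subset s <= s'} by move=> j hj; rewrite mem_undup inE hj orbT.
have s'0 : 0 \in s' by rewrite mem_undup inE eqxx.
pose x j := (if j \in s then w' j else 0) - (if j == 0 then v else 0).
have orbvw u : orb mon act N PB w u -> orb mon act N PB v u.
  apply: lspanm_mono => _ [a ha ->]; apply: (orb_op ht hact hN) hw.
  by move=> c hc; apply: PBD.
have orbv : orb mon act N PB v v.
  by apply: lspanmP; exists 0; rewrite ?(op0 ht hact) // /PB ffunE.
have := hdir s' x us' _ _ 0 s'0; rewrite /x eqxx => hN0.
suff : N ((if 0 \in s then w' 0 else 0) - v).
  have hS := lspanm_subspace N (fun y => exists2 a, PB a & y = op a w).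
  move/(@lspanmN _ _ _ (fun y => exists2 a, PB a & y = op a w)) => /(subN hS).
  rewrite opprB => h; rewrite -[v](subrK (if 0 \in s then w' 0 else 0)).
  apply: (subD hS) => //; case: ifP => [/hw' []//|_]; exact: sub0.
apply: hN0 => [j _|].
  apply: (subB (lspanm_subspace _ _)).
    by case: ifP => [/hw' [/orbvw]//|_]; apply: (sub0 (lspanm_subspace _ _)).
  by case: ifP => // _; apply: (sub0 (lspanm_subspace _ _)).
have -> : \sum_(j <- s') op (T *~ j) (x j) = - (v - \sum_(i <- s) y i).
  under eq_bigr => j _ do rewrite /x (actD hact) (actN hact).
  rewrite big_split /= opprB; congr (_ + _).
    rewrite (big_ext_seq y us us' ss'); apply: eq_bigr => j _.
    by case: ifP => [/hw'[_ ->]//|_]; rewrite (act0 hact).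
  rewrite sumrN (bigD1_seq 0) //= mulr0z (op0 ht hact) big1 ?addr0 // => j /negPf ->.
  by rewrite (act0 hact).
exact: subN hN.1 hvs.
Qed.

Let growth1 : direct -> exists C, growth_le mon act N 1 C v /\ growth_ge mon act N 1 v.
Proof.
move=> hdir.
have halg j : exists2 f, f != 0 & N (pact act (mon (E1 (edelta j 1))) f v).
  apply: (central_algebraic ht hact (epmD S1) hN).
  - by exists (edelta j 1).
  - by move=> a; apply: hcomm; apply: E1PB.
  - by move=> w /orbE1 hw nw; apply/orbE1; apply: direct_simple.
have [D hD] := algebraic_fin ht hact (epmD S1) hN halg.
(* The constant is the size of a spanning set of P v modulo [N]; only the exponent of [T] still
   varies. *)
exists #|{ffun 'I_(n + n) -> 'I_D.+1}|; split=> M.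
  exists ('I_M.+1 * {ffun 'I_(n + n) -> 'I_D.+1})%type.
  exists (fun jb : 'I_M.+1 * {ffun 'I_(n + n) -> 'I_D.+1} =>
    op (T *~ Posz (nat_of_ord jb.1)) (op (E1 (emb jb.2)) v)).
  split; first by rewrite card_prod card_ord expn1 mulnC.
  move=> a ha; have [b hb eb] := Tsplit (epos predT a).
  have [d ed] := E1onto hb.
  have [c c0 e] := opM ht hact (T *~ (epos predT a) i0) b.
  rewrite eb; apply: (subZ_inv (lspanm_subspace _ _) c0); rewrite -e -ed.
  apply: (act_lspanm hact _ _ (hD d)); first by move=> y; apply: hN.2.
  move=> y [f ->]; apply: lspanmP; have hj : (a i0 < M.+1)%N by rewrite ltnS.
  by exists (Ordinal hj, f); rewrite /= ffunE.
exists 'I_M.+1, (fun j : 'I_M.+1 => edelta i0 j); split.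
- by rewrite card_ord expn1.
- by move=> j i; rewrite ffunE; case: eqP => // _; rewrite -ltnS.
move=> c hc j.
have eT (l : nat) : epos predT (edelta i0 l) = T *~ Posz l.
  by apply/ffunP => i; rewrite Tz !ffunE /=; case: eqP.
pose s := [seq Posz (nat_of_ord l) | l <- index_enum 'I_M.+1].
pose w (l : int) := (if insub `|l|%N is Some l then c l else 0) *: v.
have wE (l : 'I_M.+1) : w (Posz l) = c l *: v by rewrite /w /= valK.
have us : uniq s by rewrite map_inj_uniq ?index_enum_uniq // => x y [] /val_inj.
have : N (w (Posz j)).
  apply: (hdir s) => //; first last.
  - by apply: map_f; apply: mem_index_enum.
  - rewrite big_map /=; under eq_bigr => l _ do rewrite wE (actZ hact) -eT; exact: hc.
  - move=> l _; apply: (subZ _ (lspanm_subspace _ _)); apply: lspanmP.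
    by exists 0; rewrite ?(op0 ht hact) // /PB ffunE.
rewrite wE => h; apply/eqP; apply: contrapT => /negP cj.
exact: nv (subZ_inv hN.1 cj h).
Qed.

Let op_N a x : N (op a x) <-> N x.
Proof. by split; [apply: (opV_stable ht hact hN)|apply: hN.2]. Qed.

(** An element g v outside [N] has the same annihilator as [v], by primeness in one direction and
    commutativity in the other; conjugation transports this to the translates by T^j. *)
Let ann_orb j w f : orb mon act N PB v w -> ~ N w -> alg mon PB f ->
  N (act f (op (T *~ j) w)) <-> N (act f (op (T *~ j) v)).
Proof.
move=> hw nw hf; have [f' hf' e] := alg_conj ht (T *~ j) hf.
rewrite -!(actM hact) e !(actM hact) !op_N.
have [g hg hgw] := orb_alg hact hN hw.
have ngv : ~ N (act g v).
  by move=> h; apply: nw; rewrite -(subrK (act g v) w); apply: subD hN.1 _ h.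
have -> : act f' w = act f' (w - act g v) + act f' (act g v).
  by rewrite -(actD hact) subrK.
have h0 : N (act f' (w - act g v)) by apply: (alg_N hact hN hf').
split=> [/(subDl hN.1 h0)/(prime hf' hg)[]//|h]; apply: subD hN.1 h0 _.
rewrite -(actM hact) (alg_comm ht hcomm hf' hg) (actM hact).
exact: (alg_N hact hN hg).
Qed.

(* Distinct translates of a prime annihilator yield independent submodules. *)
Let not_direct_period : ~ direct -> exists2 l : int, l != 0 &
  forall f, alg mon PB f -> N (act f (op (T *~ l) v)) <-> N (act f v).
Proof.
move=> ndir; apply: contrapT => hno; apply: ndir.
have differ i j : i != j -> ~ (forall f, alg mon PB f ->
    N (act f (op (T *~ j) v)) <-> N (act f (op (T *~ i) v))).
  move=> ij h; apply: hno; exists (j - i); first by rewrite subr_eq0 eq_sym.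
  move=> f hf; have [g hg e] := alg_conjV ht (T *~ i) hf.
  have [c c0 ec] := opM ht hact (T *~ i) (T *~ (j - i)).
  rewrite -(op_N (T *~ i)) -[X in _ <-> X](op_N (T *~ i)).
  rewrite -!(actM hact) -!e -mulrA !(actM hact) ec -mulrzDr addrC subrK.
  rewrite (actZ hact) -h //; split; [apply: subZ_inv hN.1 c0|apply: subZ hN.1].
move=> s w; move: {2}(size s) (leqnn (size s)) => r.
elim: r s w => [|r IH] s w hr us hw hs j1 hj1.
  by move: hr; rewrite leqn0 size_eq0 => /eqP e; rewrite e in hj1.
(* An [f] killing one term of the relation leaves a shorter relation, so by induction it kills all
   terms. Hence two terms outside [N] would have equal annihilators. *)
have drop f a : alg mon PB f -> a \in s -> N (act f (op (T *~ a) (w a))) ->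
    forall j, j \in s -> N (act f (op (T *~ j) (w j))).
  move=> hf ha hfa.
  have /choice[F hF] j := alg_conj2 ht (T *~ j) hf.
  have eF j : act f (op (T *~ j) (w j)) = op (T *~ j) (act (F j) (w j)).
    by rewrite -!(actM hact) (hF j).2.
  have orbF j : j \in s -> orb mon act N PB v (act (F j) (w j)).
    move=> hj; apply: (orb_act ht hact hN _ (hF j).1 (hw j hj)) => b c; exact: PBD.
  move=> j hj; have [->//|ja] := eqVneq j a.
  rewrite eF op_N; apply: (IH (rem a s) (fun j => act (F j) (w j))).
  - by rewrite size_rem // -ltnS prednK //; case: (s) ha.
  - exact: rem_uniq.
  - by move=> i /mem_rem; apply: orbF.
  - under eq_bigr => i _ do rewrite -eF.
    have := alg_N hact hN hf hs; rewrite (act_sum hact) (big_rem a) //=.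
    exact: (subDl hN.1 hfa).
  - by rewrite mem_rem_uniq // inE ja.
apply: contrapT => n1.
have [[j2 hj2 [n2 j21]]|hall] := pselect (exists2 j, j \in s & ~ N (w j) /\ j != j1).
  apply: (differ _ _ j21) => f hf.
  rewrite -(ann_orb j1 (hw _ hj1) n1 hf) -(ann_orb j2 (hw _ hj2) n2 hf).
  by split=> h; [apply: (drop f j1)|apply: (drop f j2)].
apply: n1; rewrite -(op_N (T *~ j1)).
move: hs; rewrite (big_rem j1) //=; apply: subDr hN.1 _.
apply: sumT_N => j; rewrite mem_rem_uniq // inE => /andP[ne hj].
by apply: contrapT => nj; apply: hall; exists j.
Qed.

Let ZZ_PB a : ZZ a -> PB a. Proof. by apply; rewrite !inE eqxx. Qed.
Let YY_PB a : YY a -> PB a. Proof. by apply. Qed.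
Let ZZD a b : ZZ a -> ZZ b -> ZZ (a + b).
Proof. by move=> ha hb i hi; rewrite ffunE ha // hb. Qed.

Let lamZr z b : ZZ z -> lam b z = 1.
Proof.
move=> hz; have [b' hb' ->] := Tsplit b; rewrite (lamDl ht) (hcomm hb' (ZZ_PB hz)) mulr1.
by rewrite (lamMzlr ht) hZ // => i hi; rewrite latMzE hz // mul0r.
Qed.
Let lamZl z b : ZZ z -> lam z b = 1.
Proof. by move=> hz; have := lamV ht z b; rewrite (lamZr b hz) mulr1. Qed.

Let algZ_op g a x : alg mon ZZ g -> act g (op a x) = op a (act g x).
Proof.
move=> hg; rewrite -!(actM hact) (alg_mon_comm ht (H := ZZ)) // => b hb; exact: lamZl.
Qed.

Let algZ_PB g : alg mon ZZ g -> alg mon PB g.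
Proof. by apply: lspan_mono => _ [a ha ->]; exists a => //; apply: ZZ_PB. Qed.

Section Periodic.
Variable l : int.
Hypothesis l0 : l != 0.
Hypothesis hl : forall f, alg mon PB f -> N (act f (op (T *~ l) v)) <-> N (act f v).

(** The value at T^l of the character of a - b is, up to inversion, the value at l (a - b) of the
    character of T, and the lattice has no torsion. *)
Let lamT_inj a b : YY a -> YY b -> lam a (T *~ l) = lam b (T *~ l) -> a = b.
Proof.
move=> ha hb e; apply/eqP; rewrite -subr_eq0; apply/eqP.
have e1 : lam (a - b) (T *~ l) = 1.
  by rewrite (lamDl ht) (lamNl ht) e mulfV // (lam_neq0 ht).
have e2 : lam T ((a - b) *~ l) = 1.
  by rewrite -(lamMzlr ht); have := lamV ht (a - b) (T *~ l); rewrite e1 mul1r.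
have e3 : (a - b) *~ l = 0.
  by apply: hY e2 => i hi; rewrite latMzE !ffunE ha // hb // subrr mul0r.
apply/ffunP => i; move/ffunP: e3 => /(_ i); rewrite latMzE [X in _ = X -> _]ffunE.
by move/eqP; rewrite mulf_eq0 (negPf l0) orbF [X in _ = X]ffunE => /eqP.
Qed.

(* Comparing a shortest relation with its translate by [T *~ l] shortens it. *)
Let indepU (s : seq (lattice n)) (u : lattice n -> V) : uniq s ->
  (forall a, a \in s -> YY a) -> (forall a, a \in s -> orb mon act N ZZ v (u a)) ->
  N (\sum_(a <- s) op a (u a)) -> forall a, a \in s -> N (u a).
Proof.
move: {2}(size s) (leqnn (size s)) => r.
elim: r s u => [|r IH] s u hr us hsY hu hs a0 ha0.
  by move: hr; rewrite leqn0 size_eq0 => /eqP e; rewrite e in ha0.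
have /choice[g hg] a : exists g, a \in s -> alg mon ZZ g /\ N (u a - act g v).
  have [/hu/(orb_alg hact hN)[g h1 h2]|] := boolP (a \in s); [by exists g|by exists 0].
(* [F] is the relation lifted to the commutative algebra, so that periodicity applies to it as a
   whole. *)
pose F := \sum_(a <- s) (if a \in s then mon a * g a else 0).
have hF : alg mon PB F.
  apply: (sub_sum _ (lspan_subspace _)) => a _; case: ifP => ha; last exact: (sub0 (lspan_subspace _)).
  apply: (algM ht); first exact: PBD; last by apply: algZ_PB; case: (hg a ha).
  by apply: lspan_in; exists a => //; apply/YY_PB/hsY.
have FE x : act F x = \sum_(a <- s) op a (act (g a) x).
  rewrite /F (act_suml hact); apply: eq_big_seq => a ha; by rewrite ha (actM hact).
have diffN (c : lattice n -> k) : N (\sum_(a <- s) c a *: op a (u a)) <->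
    N (\sum_(a <- s) c a *: op a (act (g a) v)).
  have e : N (\sum_(a <- s) c a *: op a (u a) - \sum_(a <- s) c a *: op a (act (g a) v)).
    rewrite -sumrB big_seq; apply: (sub_sum _ hN.1) => a ha.
    rewrite -scalerBr -(actN hact) -(actD hact); apply: subZ hN.1 _; apply: hN.2.
    by case: (hg a ha).
  split=> h; last by have := subD hN.1 e h; rewrite subrK.
  by have := subB hN.1 h e; rewrite opprB addrC subrK.
have h1 : N (\sum_(a <- s) lam a (T *~ l) *: op a (u a)).
  apply/diffN; rewrite -(op_N (T *~ l)).
  have -> : op (T *~ l) (\sum_(a <- s) lam a (T *~ l) *: op a (act (g a) v)) =
      act F (op (T *~ l) v).
    rewrite FE (act_sum hact); apply: eq_big_seq => a ha.
    rewrite algZ_op; last by case: (hg a ha).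
    by rewrite (actZ hact) [RHS](opC ht hact).
  apply/(hl hF); rewrite FE.
  have e1 (B : lattice n -> V) : \sum_(a <- s) (1 : k) *: B a = \sum_(a <- s) B a.
    by apply: eq_bigr => a _; rewrite scale1r.
  by rewrite -e1; apply/(diffN (fun=> 1)); rewrite e1.
have hrem : N (\sum_(a <- rem a0 s) op a ((lam a (T *~ l) - lam a0 (T *~ l)) *: u a)).
  have := subB hN.1 h1 (subZ (lam a0 (T *~ l)) hN.1 hs).
  rewrite scaler_sumr -sumrB (big_rem a0) //= subrr add0r.
  by under eq_bigr do rewrite -scalerBl -(actZ hact).
have hother a : a \in s -> a != a0 -> N (u a).
  move=> ha ne; apply: (subZ_inv (c := lam a (T *~ l) - lam a0 (T *~ l)) hN.1).
    rewrite subr_eq0; apply: contra ne => /eqP e; apply/eqP.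
    by apply: lamT_inj e; apply: hsY.
  apply: (IH _ (fun a => (lam a (T *~ l) - lam a0 (T *~ l)) *: u a) _ _ _ _ hrem).
  - by rewrite size_rem // -ltnS prednK //; case: (s) ha.
  - exact: rem_uniq.
  - by move=> b /mem_rem; apply: hsY.
  - by move=> b /mem_rem hb; apply: (subZ _ (lspanm_subspace _ _)); apply: hu.
  - by rewrite mem_rem_uniq // inE ne.
rewrite -(op_N a0); move: hs; rewrite (big_rem a0) //=; apply: subDr hN.1 _.
rewrite big_seq; apply: (sub_sum _ hN.1) => a; rewrite mem_rem_uniq // inE => /andP[ne ha].
by apply: hN.2; apply: hother.
Qed.

Lemma periodic_growth_ge : growth_ge mon act N #|I| v.
Proof.
move=> M; pose J := {ffun {x : 'I_n | x \in I} -> 'I_M.+1}.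
pose f (j : J) : exps n := [ffun i => if insub i is Some x then nat_of_ord (j x) else 0%N].
have finj : injective f.
  move=> j j' /ffunP e; apply/ffunP => x; apply: val_inj.
  by have := e (val x); rewrite !ffunE valK.
have einj : injective (fun j => epos predT (f j)).
  move=> j j' /ffunP e; apply: finj; apply/ffunP => i.
  by have := e i; rewrite [LHS]ffunE [RHS]ffunE => -[].
exists J, f; split.
- by rewrite card_ffun card_ord card_sig.
- by move=> j i; rewrite ffunE; case: insub => // x; rewrite -ltnS.
move=> c hc j.
pose u a := (if [pick j | epos predT (f j) == a] is Some j then c j else 0) *: v.
have uE i : u (epos predT (f i)) = c i *: v.
  by rewrite /u; case: pickP => [i' /eqP/einj->//|/(_ i)]; rewrite eqxx.
have : N (u (epos predT (f j))).
  apply: (indepU (s := [seq epos predT (f j) | j <- index_enum J])).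
  - by rewrite map_inj_uniq // index_enum_uniq.
  - move=> _ /mapP[i _ ->] x hx; rewrite !ffunE /=.
    by case: insubP => // y hy; rewrite hy in hx.
  - move=> _ /mapP[i _ ->]; rewrite uE; apply: (subZ _ (lspanm_subspace _ _)); apply: lspanmP.
    by exists 0; rewrite ?(op0 ht hact) // => x _; rewrite ffunE.
  - rewrite big_map; under eq_bigr => i _ do rewrite uE (actZ hact); exact: hc.
  - by apply: map_f; apply: mem_index_enum.
rewrite uE => h; apply/eqP; apply: contrapT => /negP cj.
exact: nv (subZ_inv hN.1 cj h).
Qed.

End Periodic.

Let SC i := i \in i0 |: I.
Let Ec := @epos n SC.
Let Wl (a : exps n) := lspanm N (fun y => exists b u,
  [/\ (rank b < rank a)%N, orb mon act N ZZ v u & y = op (Ec b) u]).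

Let Ec_op a b u : exists2 c, c != 0 & op (Ec a) (op (Ec b) u) = c *: op (Ec (eadd b a)) u.
Proof.
have [c c0 e] := opM ht hact (Ec a) (Ec b); exists c => //.
by rewrite e /Ec eposD addrC.
Qed.

Let orb_v : orb mon act N ZZ v v.
Proof. by apply: lspanmP; exists 0; rewrite ?(op0 ht hact) // => i _; rewrite ffunE. Qed.

Let orbZ_alg f x : alg mon ZZ f -> orb mon act N ZZ v x -> orb mon act N ZZ v (act f x).
Proof. by move=> hf; apply: (orb_act ht hact hN) => // a b; exact: ZZD. Qed.

(** A failing sum is split along the faithful directions with coefficients in the central orbit of
    [v]; its leading term, taken after all exponents are made nonnegative, is the sought
    relation. *)
Let relation : ~ direct -> exists (a : exps n) u, [/\ forall i, ~~ SC i -> a i = 0%N,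
  orb mon act N ZZ v u, ~ N u & Wl a (op (Ec a) u)].
Proof.
move=> ndir.
have [s [w [us hw hs [j0 hj0 nj0]]]] : exists s w, [/\ uniq s,
    forall j, j \in s -> orb mon act N PB v (w j),
    N (\sum_(j <- s) op (T *~ j) (w j)) & exists2 j, j \in s & ~ N (w j)].
  apply: contrapT => hno; apply: ndir => s w us hw hs j hj.
  by apply: contrapT => nj; apply: hno; exists s, w; split=> //; exists j.
pose Y (y : lattice n) x := exists2 u, orb mon act N ZZ v u & x = op y u.
have hYs y : lsubspace (Y y).
  split=> [|c x1 x2 [u1 h1 ->] [u2 h2 ->]].
    by exists 0; rewrite ?(act0 hact) //; apply: (sub0 (lspanm_subspace _ _)).
  by exists (c *: u1 + u2); rewrite ?(actP hact) //; apply: (lspanm_subspace _ _).2.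
have wdec j : exists tu : seq (lattice n) * (lattice n -> V), j \in s ->
    [/\ uniq tu.1, forall y, y \in tu.1 -> YY y,
      forall y, y \in tu.1 -> orb mon act N ZZ v (tu.2 y)
      & N (w j - \sum_(y <- tu.1) op y (tu.2 y))].
  have [hj|] := boolP (j \in s); last by exists ([::], fun=> 0).
  have : lspanm N (fun x => exists y, YY y /\ Y y x) (w j).
    apply: lspanm_mono (hw j hj) => _ [a ha ->].
    pose y : lattice n := restr (mem I) a; pose z : lattice n := a - y.
    have hy : YY y by move=> i; rewrite ffunE /= => /negPf ->.
    have hz : ZZ z.
      move=> i; rewrite !inE !ffunE /= => /orP[/eqP->|->]; last by rewrite subrr.
      by rewrite (negPf i0I) subr0.
    have [c c0 e] := opM ht hact y z.
    apply: (subZ_inv (lspanm_subspace _ _) c0).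
    have -> : a = y + z by rewrite addrC subrK.
    rewrite -e; apply: lspanmP; exists y; split=> //; exists (op z v) => //.
    by apply: lspanmP; exists z.
  case/(lspanm_seq hN.1 hYs) => t [x [ut ht1 ht2 ht3]].
  have /choice[u hu] y : exists u, y \in t -> orb mon act N ZZ v u /\ x y = op y u.
    by have [/ht2[u h1 h2]|] := boolP (y \in t); [exists u|exists 0].
  exists (t, u) => _; split=> //= [y /hu[]//|].
  suff <- : \sum_(y <- t) x y = \sum_(y <- t) op y (u y) by [].
  by apply: eq_big_seq => y /hu[].
have {wdec} /choice[tu htu] := wdec.
pose Pq := [seq (j, y) | j <- s, y <- (tu j).1].
have uP : uniq Pq.
  apply: allpairs_uniq_dep => //; first by move=> j /htu[].
  by move=> [j y] [j' y'] _ _ [-> ->].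
pose U (q : int * lattice n) := (tu q.1).2 q.2.
pose xs q := op (T *~ q.1) (op q.2 (U q)).
have PqP q : q \in Pq -> [/\ q.1 \in s, YY q.2 & orb mon act N ZZ v (U q)].
  case/allpairsPdep => j [y [hj hy ->]] /=.
  by case: (htu j hj) => _ h1 h2 _; split=> //; [apply: h1|apply: h2].
have hxs : N (\sum_(q <- Pq) xs q).
  rewrite big_allpairs_dep /=.
  have e : N (\sum_(j <- s) op (T *~ j) (w j) -
      \sum_(j <- s) \sum_(y <- (tu j).1) xs (j, y)).
    rewrite -sumrB big_seq; apply: (sub_sum _ hN.1) => j hj.
    rewrite /xs /= -(act_sum hact) -(actN hact) -(actD hact); apply: hN.2.
    by case: (htu j hj).
  by have := subB hN.1 hs e; rewrite opprB addrC subrK.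
have [q0 hq0 nq0] : exists2 q, q \in Pq & ~ N (xs q).
  apply: contrapT => hno; apply: nj0; case: (htu j0 hj0) => _ _ _.
  move/(subD hN.1) => /(_ (\sum_(y <- (tu j0).1) op y ((tu j0).2 y))); rewrite subrK; apply.
  rewrite big_seq; apply: (sub_sum _ hN.1) => y hy; apply: contrapT => ny.
  apply: hno; exists (j0, y); first exact: allpairs_f_dep.
  by rewrite /xs op_N.
pose crd (q : int * lattice n) : lattice n := T *~ q.1 + q.2.
pose B := (\max_(q <- Pq) \max_i `|crd q i|)%N.
have hB q i : q \in Pq -> (`|crd q i| <= B)%N.
  move=> hq; rewrite /B (big_rem q) //=; apply: leq_trans (leq_maxl _ _).
  exact: (leq_bigmax (F := fun i => `|crd q i|%N)).
(* [B] bounds all coordinates that occur, so multiplying by the unit of exponent [gam] makes them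
   nonnegative. *)
pose gam : exps n := [ffun=> B].
pose al (q : int * lattice n) : exps n :=
  [ffun i => if SC i then absz (B%:Z + crd q i) else 0%N].
have Eal q : q \in Pq -> Ec (al q) = Ec gam + crd q.
  move=> hq; apply/ffunP => i; rewrite /Ec !ffunE; case: ifP => hi.
    rewrite hi; have := hB q i hq; rewrite [crd q i]ffunE.
    by move: (_ + _)%R => t; lia.
  have [_ hy _] := PqP q hq; rewrite Tz hy; last first.
    by apply: contraFN hi; rewrite /SC inE => ->; rewrite orbT.
  by case: eqP hi => // ->; rewrite /SC !inE eqxx.
have ali : {in Pq &, injective al}.
  move=> q q' hq hq' e; have : crd q = crd q'.
    by apply: (addrI (Ec gam)); rewrite -!Eal // e.
  case: q q' hq hq' {e} => [j y] [j' y'] hq hq'; rewrite /crd /= => e.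
  have [_ /= hy _] := PqP _ hq; have [_ /= hy' _] := PqP _ hq'.
  have ej : j = j'.
    move/ffunP: (e) => /(_ i0); rewrite !ffunE !Tz eqxx hy // hy' // !addr0 //.
  by move: e; rewrite ej => /addrI ->.
have ri : {in Pq &, injective (fun q => rank (al q))}.
  by move=> q q' hq hq' /rank_inj; apply: ali.
have := leading_term (x := fun q => op (Ec gam) (xs q)) hN.1 uP ri.
rewrite -(act_sum hact) => /(_ (hN.2 _ _ hxs)).
case; first by exists q0 => //; move/op_N.
move=> q [hq nq hlead]; exists (al q), (U q).
have [_ _ hU] := PqP q hq.
have form q' : q' \in Pq -> exists2 c, c != 0 &
    op (Ec gam) (xs q') = c *: op (Ec (al q')) (U q').
  move=> hq'; have [c c0 e] := opM ht hact (T *~ q'.1) q'.2.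
  have [c' c'0 e'] := opM ht hact (Ec gam) (crd q').
  exists (c * c'); first by rewrite mulf_neq0.
  by rewrite /xs e (actZ hact) e' scalerA -Eal.
split=> //.
- by move=> i hi; rewrite ffunE (negPf hi).
- move=> hUN; apply: nq; apply: hN.2; apply: hN.2; exact: hN.2.
have [c c0 e] := form q hq.
apply: (subZ_inv (lspanm_subspace _ _) c0); rewrite -e.
apply: lspanm_mono hlead => _ [q' [hq' hr ->]].
apply: (subN (lspanm_subspace _ _)); have [c' c'0 ->] := form q' hq'.
apply: (subZ _ (lspanm_subspace _ _)); apply: lspanmP; exists (al q'), (U q').
by have [_ _ hU'] := PqP q' hq'.
Qed.

(** Central monomials commute with the whole torus, over which V / N is simple, so they act
    algebraically on [v]. *)
Let finU : exists (J : finType) (w : J -> V), forall u, orb mon act N ZZ v u ->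
  lspanm N (fun y => exists j, y = w j) u.
Proof.
pose S2 i := i \notin i0 |: I; pose E2 := @epm n S2.
have E2ZZ a : ZZ (E2 a) by move=> i hi; rewrite /E2 epm_supp // /S2 hi.
have halg j : exists2 f, f != 0 & N (pact act (mon (E2 (edelta j 1))) f v).
  apply: (central_algebraic ht hact (@epmD _ predT) hN).
  - by apply: epm_onto.
  - by move=> a; apply: lamZl.
  - move=> w _ nw; apply: lspanm_mono (cyclic v nw) => _ [a _ ->].
    by apply: lspanmP; have [b <-] := @epm_onto _ predT a (fun i hi => False_ind _ (notF hi)); exists b.
have [D hD] := algebraic_fin ht hact (epmD S2) hN halg.
exists {ffun 'I_(n + n) -> 'I_D.+1}, (fun b => op (E2 (emb b)) v) => u.
apply: lspanm_mono => _ [a ha ->].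
have [b <-] : exists b, E2 b = a by apply: epm_onto => i; rewrite negbK; apply: ha.
exact: hD.
Qed.

(** The leading coefficient is u = g v modulo [N] with g central. The kernel of g modulo [N] is
    stable, so g is injective by maximality of [N], hence surjective on the finite dimensional
    orbit, and multiples of the given relation have every leading coefficient. *)
Let relation_all a u : orb mon act N ZZ v u -> ~ N u -> Wl a (op (Ec a) u) ->
  forall u', orb mon act N ZZ v u' -> Wl a (op (Ec a) u').
Proof.
move=> hu nu hau.
have [g hg hgu] := orb_alg hact hN hu.
have ngv : ~ N (act g v).
  by move=> h; apply: nu; rewrite -(subrK (act g v) u); apply: subD hN.1 _ h.
have ginj x : N (act g x) -> N x.
  have [||h|h] := hmax (N' := fun x => N (act g x)); last by case: ngv; apply: h.
  - split; first exact: preim_subspace hN.1.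
    by move=> b y; rewrite algZ_op //; apply: hN.2.
  - by move=> y; apply: (alg_N hact hN hg).
  - exact: h.
have hSN y : N y -> Wl a (op (Ec a) y) by move=> hy; apply: lspanmN; apply: hN.2.
have Wsub := preim_subspace hact (mon (Ec a)) (lspanm_subspace N (fun y => exists b u,
  [/\ (rank b < rank a)%N, orb mon act N ZZ v u & y = op (Ec b) u])).
have Wact h y : alg mon ZZ h -> Wl a (op (Ec a) y) -> Wl a (op (Ec a) (act h y)).
  move=> hh; rewrite -algZ_op //; apply: (act_lspanm hact).
    by move=> z; apply: (alg_N hact hN hh).
  move=> _ [b [w [hb hw ->]]]; apply: lspanmP; exists b, (act h w).
  by rewrite algZ_op //; split=> //; apply: orbZ_alg.
have hgv : Wl a (op (Ec a) (act g v)).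
  by have -> : act g v = u - (u - act g v); [rewrite opprB addrC subrK|apply: (subB Wsub) => //; apply: hSN].
pose R := lspanm N (fun y => exists2 w, orb mon act N ZZ v w & y = act g w).
have Rsub : lsubspace R by exact: lspanm_subspace.
have Rv : R v.
  apply: contrapT => nR.
  (* If [v] were not in the image of g, the iterates g^i v would be independent modulo [N], against
     [finU]. *)
  pose pw i := iter i (act g) v.
  have pwU i : orb mon act N ZZ v (pw i).
    by elim: i => [|i IH]; [exact: orb_v|apply: orbZ_alg].
  have pw_ind m : forall c : nat -> k, N (\sum_(i < m) c i *: pw i) ->
      forall i, (i < m)%N -> c i = 0.
    elim: m => // m IH c; rewrite big_ord_recl => hc.
    have e : \sum_(i < m) c (bump 0 i) *: pw (bump 0 i) =
        act g (\sum_(i < m) c i.+1 *: pw i).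
      by rewrite (act_sum hact); apply: eq_bigr => i _; rewrite (actZ hact).
    rewrite e in hc.
    have c00 : c 0%N = 0.
      apply/eqP; apply: contrapT => /negP c0; apply: nR.
      apply: (subZ_inv Rsub c0).
      apply: (@subDr _ _ R _ (act g (\sum_(i < m) c i.+1 *: pw i))) => //.
        apply: lspanmP; exists (\sum_(i < m) c i.+1 *: pw i) => //.
        apply: (sub_sum _ (lspanm_subspace _ _)) => i _.
        exact: (subZ _ (lspanm_subspace _ _) (pwU i)).
      exact: lspanmN.
    rewrite c00 scale0r add0r in hc.
    by case=> [//|i]; rewrite ltnS; apply: (IH (fun i => c i.+1)); apply: ginj.
  have [J [w hw]] := finU.
  have := @steinitz _ _ 'I_(#|J|.+1) J N (fun i => pw i) w hN.1.
  rewrite card_ord ltnn => h; suff : false by [].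
  apply: h => [c hc i|i]; last exact: hw.
  have := pw_ind _ (fun i => c (inord i)) _ i (ltn_ord i); rewrite inord_val; apply.
  by under eq_bigr do rewrite inord_val.
have Sv : Wl a (op (Ec a) v).
  apply: (lspanm_le Wsub hSN _ Rv) => _ [w hw ->].
  have [h hh hhw] := orb_alg hact hN hw.
  have -> : act g w = act g (w - act h v) + act g (act h v) by rewrite -(actD hact) subrK.
  apply: (subD Wsub); first by apply: hSN; apply: (alg_N hact hN hg).
  rewrite -(actM hact g h) (alg_comm ht _ hg hh) ?(actM hact h g); first exact: Wact.
  by move=> b1 b2 hb1 _; apply: lamZl.
move=> u' hu'; have [h hh hhu] := orb_alg hact hN hu'.
have -> : u' = (u' - act h v) + act h v by rewrite subrK.
by apply: (subD Wsub); [apply: hSN|apply: Wact].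
Qed.

(** Division by the relation at [a0]: an exponent above [a0] is replaced by exponents of smaller
    rank, with coefficients still in the central orbit. *)
Let reduce a0 : (forall u, orb mon act N ZZ v u -> Wl a0 (op (Ec a0) u)) ->
  forall a u, orb mon act N ZZ v u -> lspanm N (fun y => exists b w,
    [/\ orb mon act N ZZ v w, (rank b <= rank a)%N, ~ ele a0 b & y = op (Ec b) w]) (op (Ec a) u).
Proof.
move=> h0 a; move: {2}(rank a).+1 (ltnSn (rank a)) => r.
elim: r a => // r IH a; rewrite ltnS => ha u hu.
have [hle|hle] := pselect (ele a0 a); last by apply: lspanmP; exists a, u.
have [c c0 e] := Ec_op (esub a a0) a0 u.
have ea : eadd a0 (esub a a0) = a by rewrite eaddC esubK.
rewrite ea in e; apply: (subZ_inv (lspanm_subspace _ _) c0); rewrite -e.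
apply: (act_lspanm hact _ _ (h0 u hu)); first by move=> y; apply: hN.2.
move=> _ [b [w [hb hw ->]]]; have [c' c'0 ->] := Ec_op (esub a a0) b w.
apply: (subZ _ (lspanm_subspace _ _)).
have hr : (rank (eadd b (esub a a0)) < rank a)%N by rewrite -{2}ea; apply: rankD.
apply: lspanm_mono (IH _ (leq_trans hr ha) w hw) => _ [d [x [hx hd nd ->]]].
by apply: lspanmP; exists d, x; split=> //; apply: leq_trans hd (ltnW hr).
Qed.

Let growth_leI : ~ direct -> exists C, growth_le mon act N #|I| C v.
Proof.
move=> ndir; have [a0 [u0 [ha0 hu0 nu0 hW]]] := relation ndir.
have hred := reduce (relation_all hu0 nu0 hW).
have [J [wJ hwJ]] := finU.
exists (n * (deg a0).+1 * (n.+1) ^ #|I| * #|J|)%N => M.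
(* Reduction does not raise the degree, so coordinates stay at most n M; the factor (n + 1)^#|I| of
   the constant pays for it. *)
pose F := {ffun {x : 'I_n | x \in I} -> 'I_(n * M).+1}.
(* An exponent not above [a0] has a coordinate i below a0 i. The index stores i, that coordinate and
   the others; the slot of i, which is free when i <> i0, holds the coordinate at i0. *)
pose be (q : 'I_n * 'I_(deg a0).+1 * F) : exps n := [ffun x =>
  if x == q.1.1 then nat_of_ord q.1.2
  else if insub (if x == i0 then q.1.1 else x) is Some y then nat_of_ord (q.2 y) else 0%N].
exists ('I_n * 'I_(deg a0).+1 * F * J)%type, (fun qj => op (Ec (be qj.1)) (wJ qj.2)); split.
  rewrite !card_prod !card_ord card_ffun card_ord card_sig.
  rewrite -!mulnA leq_mul2l; apply/orP; right; rewrite leq_mul2l; apply/orP; right.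
  rewrite mulnC [X in (_ <= X)%N]mulnCA leq_mul2l -expnMn; apply/orP; right.
  have hnM : ((n * M).+1 <= n.+1 * M.+1)%N by nia.
  by case: #|I| => [|d]; rewrite ?expn0 ?leq_exp2r.
move=> a ha.
pose z : lattice n := epos predT a - Ec a.
have hz : ZZ z by move=> i hi; rewrite !ffunE /= /SC hi subrr.
have [c c0 e] := opM ht hact (Ec a) z.
apply: (subZ_inv (lspanm_subspace _ _) c0).
have -> : epos predT a = Ec a + z by rewrite addrC subrK.
rewrite -e.
have ozv : orb mon act N ZZ v (op z v) by apply: lspanmP; exists z.
apply: lspanm_mono (hred a _ ozv) => _ [b [w [hw hb nb ->]]].
apply: (act_lspanm hact _ _ (hwJ w hw)); first by move=> y; apply: hN.2.
move=> _ [j ->].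
have bM x : (b x <= n * M)%N.
  apply: leq_trans (leq_deg b x) _; apply: leq_trans (rank_deg_le hb) _.
  have -> : (n * M = \sum_(i < n) M)%N by rewrite sum_nat_const card_ord.
  exact: leq_sum.
have [i hi] : exists i, (b i < a0 i)%N.
  apply: contrapT => hno; apply: nb => i; rewrite leqNgt; apply/negP => hi.
  by apply: hno; exists i.
have SCi : SC i by apply: contraT => /ha0 ai0; rewrite ai0 in hi.
have bi : (b i < (deg a0).+1)%N by rewrite ltnS; apply: leq_trans (ltnW hi) (leq_deg _ _).
pose q : 'I_n * 'I_(deg a0).+1 * F :=
  (i, Ordinal bi, [ffun y => inord (b (if val y == i then i0 else val y))]).
suff -> : Ec b = Ec (be q) by apply: lspanmP; exists (q, j).
apply/ffunP => x; rewrite /Ec !ffunE /=; case: ifP => // hx.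
case: eqP => [->//|/eqP xi]; congr Posz.
have hxI : (if x == i0 then i else x) \in I.
  move: SCi hx; rewrite /SC !inE; case: (eqVneq x i0) => [ex|_] //=.
  by rewrite -ex eq_sym (negPf xi).
rewrite insubT /= ffunE /= inordK; last by case: ifP; rewrite ltnS.
by case: (eqVneq x i0) => [->|_]; rewrite ?eqxx ?(negPf xi).
Qed.

Lemma prime_growth : exists C,
  (growth_le mon act N 1 C v /\ growth_ge mon act N 1 v) \/
  (growth_le mon act N #|I| C v /\ growth_ge mon act N #|I| v).
Proof.
have [hdir|ndir] := pselect direct; first by have [C hC] := growth1 hdir; exists C; left.
have [l l0 hl] := not_direct_period ndir.
have [C hC] := growth_leI ndir; exists C; right; split=> //.
exact: periodic_growth_ge l0 hl.
Qed.

End SimpleTorus.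

Lemma simple_torus_growth (k : fieldType) (A : algType k) (n : nat)
    (mon : lattice n -> A) (lam : lattice n -> lattice n -> k)
    (V : lmodType k) (act : A -> V -> V) (N : V -> Prop)
    (i0 : 'I_n) (I : {set 'I_n}) :
  torus_mon mon lam -> is_left_module act -> stable mon act N -> (exists v, ~ N v) ->
  (forall N', stable mon act N' -> (forall x, N x -> N' x) ->
    (forall x, N' x -> N x) \/ (forall x, N' x)) ->
  i0 \notin I ->
  (forall a b : lattice n, a i0 = 0 -> b i0 = 0 -> lam a b = 1) ->
  (forall b : lattice n, (forall i, i \notin I -> b i = 0) ->
    lam (lbasis i0) b = 1 -> b = 0) ->
  (forall b : lattice n, (forall i, i \in i0 |: I -> b i = 0) -> lam (lbasis i0) b = 1) ->
  exists2 v, ~ N v & exists C, exists2 d, d = 1%N \/ d = #|I| &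
    growth_le mon act N d C v /\ growth_ge mon act N d v.
Proof.
move=> ht hact hN hne hmax i0I hcomm hY hZ.
pose S1 i := i != i0.
have [|||v nv hprime] := prime_annihilator ht hact hN (H := fun a => a i0 = 0) (epmD S1) _ _ _ hne.
- by move=> a; rewrite epm_supp // /S1 eqxx.
- by move=> b hb; apply: epm_onto => i; rewrite negbK => /eqP ->.
- exact: hcomm.
have [C hC] := prime_growth ht hact hN hmax i0I hcomm hY hZ nv hprime.
by exists v => //; exists C; case: hC; [exists 1%N|exists #|I|] => //; [left|right].
Qed.

(** * Intervals of right ideals of small dimension *)

Section ConeDimension.
Variable n : nat.
Implicit Types (D : exps n -> Prop) (S : {set 'I_n}).

Definition supp_in S (b : exps n) := forall i, i \notin S -> b i = 0%N.
(** Measures [D] by the coordinate cones it contains; for truncation-invariant sets this controls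
    the number of elements of bounded degree, see [card_dim1]. *)
Definition dim_lt e D := forall (a : exps n) S, #|S| = e ->
  ~ (forall b, supp_in S b -> D (eadd a b)).

(* A difference of up-sets is a finite union of cells, indexed by the truncations. *)
Definition trunc_inv K D := forall a b, trunc K a = trunc K b -> D a -> D b.

Lemma trunc_eadd K (a b : exps n) S : (forall i, i \in S -> K <= a i)%N -> supp_in S b ->
  trunc K (eadd a b) = trunc K a.
Proof.
move=> ha hb; apply/ffunP => i; rewrite !ffunE; have [hi|hi] := boolP (i \in S).
  have := ha i hi; lia.
by rewrite hb // addn0.
Qed.

(** Coordinates that have reached [K] may grow without changing the truncation, so together they
    span a cone inside [D]. *)
Lemma cell_card K D e a : trunc_inv K D -> dim_lt e.+1 D -> D a ->
  (#|[set i | K <= a i]%N| <= e)%N.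
Proof.
move=> hK hd ha; rewrite leqNgt; apply/negP => /card_geqP[s [us ss hs]].
apply: (hd a [set i in s]); first by rewrite cardsE (card_uniqP us).
move=> b hb; apply: (hK a) => //; rewrite (trunc_eadd (S := [set i in s])) // => i.
by rewrite inE => /hs; rewrite inE.
Qed.

Lemma cell_off K (a b : exps n) i : trunc K a = trunc K b -> (a i < K)%N -> a i = b i.
Proof. by move/ffunP/(_ i); rewrite !ffunE; lia. Qed.

(* Two translates of cones of maximal dimension lying in one cell intersect, so
   at most finitely many disjoint subsets of D have dimension e. *)
Lemma finitely_many_large K D e (Ds : nat -> exps n -> Prop) :
  trunc_inv K D -> dim_lt e.+1 D -> (forall i a, Ds i a -> D a) ->
  (forall i j a, (i < j)%N -> Ds i a -> ~ Ds j a) ->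
  exists N, forall i, (N <= i)%N -> dim_lt e (Ds i).
Proof.
move=> hK hd hDs hdisj; apply: contrapT => hno.
(* Moving the apex by [K] along the cone puts all free coordinates past the truncation bound. *)
have bad N : exists i (a : exps n) S, [/\ (N <= i)%N, #|S| = e, (forall l, l \in S -> K <= a l)%N
    & forall b, supp_in S b -> Ds i (eadd a b)].
  apply: contrapT => h; apply: hno; exists N => i hi a S hS hab; apply: h.
  pose t : exps n := [ffun l => if l \in S then K else 0%N].
  have ht b : supp_in S b -> supp_in S (eadd t b).
    by move=> hb l hl; rewrite !ffunE (negPf hl) hb.
  exists i, (eadd a t), S; split=> // [l hl|b hb].
    by rewrite !ffunE hl leq_addl.
  have -> : eadd (eadd a t) b = eadd a (eadd t b).
    by apply/ffunP => l; rewrite !ffunE addnA.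
  by apply: hab; apply: ht.
(* There are finitely many cells, so one of them receives cones from arbitrarily late members of the
   sequence. *)
have [kap hkap] : exists kap : {ffun 'I_n -> 'I_K.+1}, forall N,
    exists i (a : exps n) S, [/\ (N <= i)%N, #|S| = e, (forall l, l \in S -> K <= a l)%N,
    cut K (trunc K a) = kap & forall b, supp_in S b -> Ds i (eadd a b)].
  apply: contrapT => h.
  have /choice[f hf] (kap : {ffun 'I_n -> 'I_K.+1}) : exists N, ~ exists i (a : exps n) S,
    [/\ (N <= i)%N, #|S| = e, (forall l, l \in S -> K <= a l)%N,
    cut K (trunc K a) = kap & forall b, supp_in S b -> Ds i (eadd a b)].
    by apply: contrapT => h'; apply: h; exists kap => N; apply: contrapT => h''; apply: h'; exists N.
  have [i [a [S [hi h1 h2 h3]]]] := bad (\max_kap f kap)%N.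
  apply: (hf (cut K (trunc K a))); exists i, a, S; split=> //.
  by apply: leq_trans hi; apply: leq_bigmax.
have [i [a [S [_ cS hS ha hab]]]] := hkap 0%N.
have [j [b [S' [hij cS' hS' hb hbb]]]] := hkap i.+1.
have cutK' (x : exps n) : emb (cut K (trunc K x)) = trunc K x.
  by rewrite cutK // => l; rewrite ffunE geq_minr.
have eab : trunc K a = trunc K b by rewrite -(cutK' a) -(cutK' b) ha hb.
have e0in (x : exps n) : eadd x (@e0 n) = x := eadd0 x.
have s0 U : supp_in U (@e0 n) by move=> l _; rewrite ffunE.
have SE (x : exps n) (U : {set 'I_n}) m : Ds m x -> #|U| = e -> (forall l, l \in U -> K <= x l)%N ->
    U = [set l | K <= x l]%N.
  move=> hx cU hU; apply/eqP; rewrite eqEcard cU (cell_card hK hd (hDs _ _ hx)) andbT.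
  by apply/subsetP => l /hU; rewrite inE.
have hSa := SE a S i (ltac:(by rewrite -(e0in a); apply: hab)) cS hS.
have hSb := SE b S' j (ltac:(by rewrite -(e0in b); apply: hbb)) cS' hS'.
have eS : S = S'.
  rewrite hSa hSb; apply/setP => l; rewrite !inE.
  by move/ffunP: eab => /(_ l); rewrite !ffunE; lia.
pose r (x : exps n) : exps n := [ffun l => if l \in S then x l else 0%N].
have hr x : supp_in S (r x) by move=> l hl; rewrite ffunE (negPf hl).
(* Two cones in one cell have the same directions and agree outside them, so adding the apexes along
   [S] gives a common point. *)
have ep : eadd a (r b) = eadd b (r a).
  apply/ffunP => l; rewrite !ffunE; have [hl|hl] := boolP (l \in S); first by rewrite addnC.
  rewrite !addn0; apply: (cell_off eab); rewrite ltnNge; apply: contra hl.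
  by rewrite [in X in _ -> X]hSa inE.
apply: (hdisj i j (eadd a (r b)) hij); first exact: hab.
by rewrite ep; apply: hbb; rewrite -eS.
Qed.

(** A cell of dimension at most one has at most one free coordinate, which the degree recovers; K.+1
    ^ n counts the cells. *)
Lemma card_dim1 K D M : trunc_inv K D -> dim_lt 2 D ->
  (#|[set b : {ffun 'I_n -> 'I_M.+1} | `[< D (emb b) >] && (deg (emb b) <= M)%N]|
     <= K.+1 ^ n * M.+1)%N.
Proof.
move=> hK hd; set X := [set _ | _].
pose f (b : {ffun 'I_n -> 'I_M.+1}) : {ffun 'I_n -> 'I_K.+1} * 'I_M.+1 :=
  (cut K (trunc K (emb b)), inord (deg (emb b))).
have cutK' (x : exps n) : emb (cut K (trunc K x)) = trunc K x.
  by rewrite cutK // => l; rewrite ffunE geq_minr.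
have finj : {in X &, injective f}.
  move=> b c; rewrite !inE => /andP[/asboolP hb db] /andP[/asboolP hc dc] [e1 /(congr1 val)].
  rewrite /= !inordK ?ltnS // => ed.
  have et : trunc K (emb b) = trunc K (emb c) by rewrite -(cutK' (emb b)) -(cutK' (emb c)) e1.
  apply: emb_inj; apply/ffunP => i.
  case: (ltnP (emb b i) K) => hi; first exact: cell_off et hi.
  have hS := cell_card hK hd hb.
  have off j : j != i -> emb b j = emb c j.
    move=> ji; apply: (cell_off et); rewrite ltnNge; apply/negP => hj.
    have : (1 < #|[set i | K <= emb b i]%N|)%N.
      by apply/card_gt1P; exists i, j; rewrite !inE eq_sym.
    by rewrite ltnNge hS.
  move: ed; rewrite /deg (bigD1 i) //= [RHS](bigD1 i) //=.
  by rewrite (eq_bigr _ off) => /addIn.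
rewrite -(card_in_imset finj); apply: leq_trans (max_card _) _.
by rewrite card_prod card_ffun !card_ord.
Qed.

End ConeDimension.

(** * Leading exponents and deviation of right ideals *)

Section RightIdeals.
Variables (k : fieldType) (A : algType k) (n : nat).
Variables (mon : lattice n -> A) (lam : lattice n -> lattice n -> k).
Hypothesis ht : torus_mon mon lam.
Hypothesis hspan : forall x, lspan (fun y => exists a, y = mon a) x.
Implicit Types (I J : A -> Prop).

Let m (a : exps n) := mon (epos predT a).

Lemma right_ideal_sub I : right_ideal I -> lsubspace I.
Proof.
move=> [h0 hD hM]; split=> // c x y hx hy; apply: hD => //.
by rewrite -[c *: x](mulr_algr); apply: hM.
Qed.
Lemma right_idealM I x a : right_ideal I -> I x -> I (x * a).
Proof. by case=> _ _; apply. Qed.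

Lemma right_ideal_monV I x a : right_ideal I -> I (x * mon a) -> I x.
Proof.
move=> hI h; have [c c0 e] := monM ht a (- a).
apply: (subZ_inv (right_ideal_sub hI) c0).
have -> : c *: x = x * mon a * mon (- a).
  by rewrite -mulrA e subrr (mon0 ht) mulr_algr.
exact: right_idealM.
Qed.

Let mulmon_lspanm I P Q a x : right_ideal I -> (forall y, P y -> lspanm I Q (y * mon a)) ->
  lspanm I P x -> lspanm I Q (x * mon a).
Proof.
move=> hI hP; apply: (lspanm_le (S := fun x => lspanm I Q (x * mon a))) => //.
  exact: (preim_mulr_subspace _ (lspanm_subspace _ _)).
by move=> y hy; apply: lspanmN; apply: right_idealM.
Qed.

Let mM a b : exists2 c, c != 0 & m a * m b = c *: m (eadd a b).
Proof. by have [c c0 e] := monM ht (epos predT a) (epos predT b); exists c; rewrite // e -eposD. Qed.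

Lemma rlead_upset I : right_ideal I -> upset (lead I m).
Proof.
move=> hI a b ha; have [c c0 e] := mM a b.
apply: (subZ_inv (lspanm_subspace _ _) c0); rewrite -e.
apply: (mulmon_lspanm hI _ ha) => _ [d [hd ->]].
have [c' c'0 ->] := mM d b; apply: (subZ _ (lspanm_subspace _ _)).
by apply: lspanmP; exists (eadd d b); split=> //; apply: rankD.
Qed.

Lemma rlead_mono I J a : (forall x, J x -> I x) -> lead J m a -> lead I m a.
Proof.
move=> h; apply: lspan_mono => y [/h|]; [by left|by right].
Qed.

Definition ldiff J I a := lead I m a /\ ~ lead J m a.

Lemma ldiff_trunc J I : right_ideal I -> right_ideal J -> exists K, trunc_inv K (ldiff J I).
Proof.
move=> hI hJ; have [K1 h1] := dickson_iff (rlead_upset hI).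
have [K2 h2] := dickson_iff (rlead_upset hJ).
exists (maxn K1 K2) => a b e [ha hb]; split.
  by apply/(h1 _ b (leq_maxl K1 K2)); rewrite -e; apply: (h1 _ a (leq_maxl K1 K2)).1.
move=> h; apply: hb; apply/(h2 _ a (leq_maxr K1 K2)); rewrite e.
exact: (h2 _ b (leq_maxr K1 K2)).1.
Qed.

(* Deviation of an interval of right ideals, provided that no nonzero interval
   has dimension at most one. *)
Lemma dev_bound :
  (forall J I, right_ideal J -> right_ideal I -> (forall x, J x -> I x) ->
    dim_lt 2 (ldiff J I) -> forall x, I x -> J x) ->
  forall e J I, right_ideal J -> right_ideal I -> (forall x, J x -> I x) ->
    dim_lt e.+2 (ldiff J I) -> dev_lt e J I.
Proof.
move=> hbase; elim=> [|e IH] J I hJ hI hJI hd.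
  by move=> x /=; apply: hbase.
move=> c hc hc0 hcm hcJ.
have [K hK] := ldiff_trunc hI hJ.
have cm i j x : (i <= j)%N -> c j x -> c i x.
  elim: j => [|j IHj]; rewrite leq_eqVlt => /orP[/eqP -> //|//].
  by rewrite ltnS => hij /hcm; apply: IHj.
(* The differences of consecutive leading sets along the chain are disjoint subsets of that of the
   whole interval, so almost all have smaller dimension. *)
have [N hN] := finitely_many_large (Ds := fun i => ldiff (c i.+1) (c i)) hK hd
  (fun i a '(conj h1 h2) => conj
     (rlead_mono (fun x hx => hc0 x (cm 0%N i x (leq0n i) hx)) h1)
     (fun h => h2 (rlead_mono (hcJ i.+1) h)))
  (fun i j a hij '(conj h1 h2) '(conj h3 h4) =>
     h2 (rlead_mono (fun x hx => cm i.+1 j x hij hx) h3)).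
by exists N => i hi; apply: (IH _ _ (hc _) (hc _) (hcm i) (hN i hi)).
Qed.

Let F M := lspan (fun x => exists2 a : exps n, (deg a <= M)%N & x = m a).

(** The unit with all exponents [M] moves a box into the nonnegative orthant, at the price of degree
    n (2 M). *)
Let shiftF M x : lspan (fun x => exists2 a : lattice n, (forall i, `|a i|%N <= M)%N & x = mon a) x ->
  F (n * (2 * M)) (x * m [ffun=> M]).
Proof.
move=> hx; apply: (lspan_le (S := fun x => F (n * (2 * M)) (x * m [ffun=> M])) _ _ hx).
  exact: (preim_mulr_subspace _ (lspan_subspace _)).
move=> _ [a ha ->]; have [c c0 ->] := monM ht a (epos predT [ffun=> M]).
apply: (subZ _ (lspan_subspace _)); apply: lspan_in.
exists [ffun i => absz (a i + M%:Z)].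
  have -> : (n * (2 * M) = \sum_(i < n) (2 * M))%N by rewrite sum_nat_const card_ord.
  by apply: leq_sum => i _; rewrite ffunE; move: (a i) (ha i) => z; lia.
congr mon; apply/ffunP => i; rewrite !ffunE /=; move: (a i) (ha i) => z; lia.
Qed.

Let FM M M' x y : F M x -> F M' y -> F (M + M') (x * y).
Proof.
apply: lspan_mul; first exact: lspan_subspace.
move=> _ _ [a ha ->] [b hb ->]; have [c c0 ->] := mM a b.
apply: (subZ _ (lspan_subspace _)); apply: lspan_in; exists (eadd a b) => //.
by rewrite degD leq_add.
Qed.

Definition box M := lspan (fun x => exists2 a : lattice n, (forall i, `|a i|%N <= M)%N & x = mon a).

Lemma box_ex x : exists M, box M x.
Proof.
apply: (lspan_le (S := fun x => exists M, box M x) _ _ (hspan x)).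
  split=> [|c u v [M hu] [M' hv]]; first by exists 0%N; apply: (sub0 (lspan_subspace _)).
  exists (M + M')%N; apply: (lspan_subspace _).2.
    apply: lspan_mono hu => _ [a ha ->]; exists a => // i; exact: leq_trans (ha i) (leq_addr _ _).
  apply: lspan_mono hv => _ [a ha ->]; exists a => // i; exact: leq_trans (ha i) (leq_addl _ _).
move=> _ [a ->]; exists (\max_i `|a i|)%N; apply: lspan_in; exists a => // i.
exact: (leq_bigmax (F := fun i => `|a i|%N)).
Qed.

(* The cyclic submodule generated by a class of [I / J] grows at most linearly. *)
Lemma linear_growth J I x0 : right_ideal J -> right_ideal I -> (forall x, J x -> I x) ->
  dim_lt 2 (ldiff J I) -> I x0 -> ~ J x0 ->
  exists2 J', right_ideal J' /\ ~ J' 1 & exists C, forall M (L : finType) (u : L -> A),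
    indep J' u -> (forall l, box M (u l)) -> (#|L| <= C * M.+1)%N.
Proof.
move=> hJ hI hJI hd hx0 nx0.
have [s hs] := box_ex x0; have hx1 := shiftF hs.
set x1 := x0 * _ in hx1; set m0 := (n * _)%N in hx1.
have Ix1 : I x1 by apply: right_idealM.
have nx1 : ~ J x1 by move/(right_ideal_monV hJ).
(* [J'] is the annihilator of the class of [x1] modulo [J]. *)
pose J' g := J (x1 * g).
have hJ' : right_ideal J'.
  case: (hJ) => h0 hD hM; split; rewrite /J'; first by rewrite mulr0.
    by move=> x y hx hy; rewrite mulrDr; apply: hD.
  by move=> x a hx; rewrite mulrA; apply: hM.
exists J'; first by split; rewrite // /J' mulr1.
have [K hK] := ldiff_trunc hI hJ.
have hFM M (L : finType) (u : L -> A) : indep J' u -> (forall l, F M (u l)) ->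
    (#|L| <= K.+1 ^ n * (m0 + M).+1)%N.
  move=> hu hF; set M' := (m0 + M)%N.
  pose B := {ffun 'I_n -> 'I_M'.+1}.
  pose Q P (b : B) := `[< ~ lead P m (emb b) >] && (deg (emb b) <= M')%N.
  pose TI := {b : B | Q I b}; pose TJ := {b : B | Q J b}.
  (* Up to degree [M'], the products x1 u_l together with the standard monomials of [I] are
     independent modulo [J], hence not more numerous than the standard monomials of [J]. The surplus
     of the latter is counted by the exponents leading for [I] but not for [J]. *)
  pose w (x : L + TI) := match x with inl l => x1 * u l | inr b => m (emb (val b)) end.
  have subI := right_ideal_sub hI; have subJ := right_ideal_sub hJ.
  have indTI : indep I (fun b : TI => m (emb (val b))).
    apply: (indep_nlead subI (f := fun b : TI => emb (val b))).
      by move=> b c /emb_inj /val_inj.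
    by move=> b; have /andP[/asboolP] := valP b.
  have h1 : (#|{: L + TI}| <= #|{: TJ}|)%N.
    apply: (@steinitz _ _ _ _ J w (fun b : TJ => m (emb (val b))) subJ).
      move=> c; rewrite big_sumType /= => hc.
      have eL : \sum_i c (inl i) *: (x1 * u i) = x1 * \sum_i c (inl i) *: u i.
        by rewrite mulr_sumr; apply: eq_bigr => i _; rewrite scalerAr.
      rewrite eL in hc.
      have cR b : c (inr b) = 0.
        apply: (indTI (fun b => c (inr b))).
        by apply: (subDl subI _ (hJI _ hc)); apply: right_idealM.
      case=> [l|b]; last exact: cR.
      apply: (hu (fun l => c (inl l))).
      have eR : \sum_b c (inr b) *: m (emb (val b)) = 0.
        by rewrite big1 // => b _; rewrite cR scale0r.
      by rewrite eR addr0 in hc.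
    have red a : (deg a <= M')%N -> lspanm J (fun y => exists b : TJ, y = m (emb (val b))) (m a).
      move=> ha; apply: (lspanm_mono _ (@span_nlead _ _ J _ m a)) => _ [b [hb nb ->]].
      have db : (deg b <= M')%N by apply: leq_trans (rank_deg_le hb) ha.
      have eb : emb (cut M' b) = b by rewrite cutK // => i; apply: leq_trans (leq_deg _ _) db.
      have hQ : Q J (cut M' b) by rewrite /Q eb db andbT; apply/asboolP.
      by apply: lspanmP; exists (Sub _ hQ); rewrite /= eb.
    have redF x : F M' x -> lspanm J (fun y => exists b : TJ, y = m (emb (val b))) x.
      by apply: lspan_le; [exact: lspanm_subspace|move=> _ [a ha ->]; apply: red].
    case=> [l|b]; first by apply: redF; apply: FM.
    by apply: red; have /andP[] := valP b.
  have h2 : (#|{: TJ}| <= #|{: TI}| + K.+1 ^ n * M'.+1)%N.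
    apply: leq_trans (leq_add (leqnn _) (card_dim1 M' hK hd)).
    rewrite !card_sig -(cardsE (Q I)); apply: leq_trans (leq_card_setU _ _).1.
    apply: subset_leq_card; apply/subsetP => b; rewrite !inE => /andP[/asboolP nJ dM].
    rewrite dM andbT; apply/orP; have [h|h] := pselect (lead I m (emb b)).
      by right; apply/asboolP; split.
    by left; apply/andP; split=> //; apply/asboolP.
  by move: h1; rewrite card_sum addnC => h1; rewrite -(leq_add2l #|{: TI}|) (leq_trans h1).
exists (K.+1 ^ n * (m0 + n * 2).+1)%N => M L u hu hb.
have := hFM (n * (2 * M))%N L (fun l => u l * m [ffun=> M]).
move/(_ _ (fun l => shiftF (hb l))) => h; apply: leq_trans (h _) _.
  move=> c; under eq_bigr => l _ do rewrite scalerAl.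
  by rewrite -mulr_suml => /(right_ideal_monV hJ'); apply: hu.
rewrite -mulnA leq_mul2l; apply/orP; right; nia.
Qed.

End RightIdeals.

(** * Commutation relations forced by cyclic modules of linear growth *)

Section LinearGrowthModule.
Variables (k : fieldType) (A : algType k) (n : nat).
Variables (mon : lattice n -> A) (lam : lattice n -> lattice n -> k).
Hypothesis ht : torus_mon mon lam.
Hypothesis hspan : forall x, lspan (fun y => exists a, y = mon a) x.
Variable J : A -> Prop.
Hypothesis hJ : right_ideal J.
Hypothesis J1 : ~ J 1.
Let m (a : exps n) := mon (epos predT a).
Let subJ := right_ideal_sub hJ.
Let mM a b : exists2 c, c != 0 & m a * m b = c *: m (eadd a b).
Proof. by have [c c0 e] := monM ht (epos predT a) (epos predT b); exists c; rewrite // e -eposD. Qed.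
Let m0 : m (@e0 n) = 1.
Proof.
rewrite /m; have -> : epos predT (@e0 n) = 0 by apply/ffunP => i; rewrite !ffunE.
exact: mon0 ht.
Qed.
Let mdelta i : m (edelta i 1) = mon (lbasis i).
Proof. by rewrite /m; congr mon; apply/ffunP => j; rewrite !ffunE /=; case: eqP. Qed.

Section FiniteDimensional.
Hypothesis hfin : forall i, exists D, lead J m (edelta i D).

(** The number c is the dimension of A / J. Right multiplications by the variables are invertible
    matrices that commute up to [lam], and determinants turn this scalar into its c-th power. *)
Lemma torsion_commutation : exists2 c : nat, (0 < c)%N &
  forall i j, lam (lbasis i) (lbasis j) ^+ c = 1.
Proof.
have /choice[D hD] := hfin; set K := (\max_i D i)%N.
pose Q (b : {ffun 'I_n -> 'I_K.+1}) := `[< ~ lead J m (emb b) >].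
pose T := {b | Q b}; pose c := #|{: T}|.
pose u (l : 'I_c) := m (emb (val (enum_val l : T))).
have uind : indep J u.
  apply: (indep_nlead subJ (f := fun l => emb (val (enum_val l : T)))).
    by move=> l l' /emb_inj /val_inj /enum_val_inj.
  by move=> l; have /asboolP := valP (enum_val l : T).
have uspan a : lspanm J (fun y => exists l, y = u l) (m a).
  apply: (lspanm_mono _ (@span_nlead _ _ J _ m a)) => _ [b [_ nb ->]].
  have eb : emb (cut K b) = b.
    rewrite cutK // => i; apply/ltnW; rewrite ltnNge; apply/negP => hi; apply: nb.
    apply: (upset_ele (rlead_upset ht hJ) _ (hD i)) => l; rewrite ffunE.
    by case: eqP => // ->; apply: leq_trans hi; apply: (leq_bigmax (F := D)).
  have hQ : Q (cut K b) by rewrite /Q eb; apply/asboolP.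
  apply: lspanmP; exists (enum_rank (Sub _ hQ : T)).
  by rewrite /u enum_rankK /= eb.
have c0 : (0 < c)%N.
  rewrite lt0n; apply/negP => /eqP c0; apply: J1; rewrite -m0.
  by apply: (lspanm_le subJ _ _ (uspan _)) => // y [l]; have := ltn_ord l; rewrite {2}c0.
exists c => //.
have /choice[M0 hM0] (il : 'I_n * 'I_c) : exists d : 'I_c -> k,
    J (u il.2 * mon (lbasis il.1) - \sum_l' d l' *: u l').
  apply: inspanP => //; rewrite -mdelta; have [d d0 ->] := mM (emb (val (enum_val il.2 : T))) (edelta il.1 1).
  exact: (subZ _ (lspanm_subspace _ _)).
pose M i : 'M[k]_c := \matrix_(l, l') M0 (i, l) l'.
have hM i (y : 'rV[k]_c) : J ((\sum_l y 0 l *: u l) * mon (lbasis i) - \sum_l (y *m M i) 0 l *: u l).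
  have -> : (\sum_l y 0 l *: u l) * mon (lbasis i) - \sum_l (y *m M i) 0 l *: u l =
     \sum_l y 0 l *: (u l * mon (lbasis i) - \sum_l' M0 (i, l) l' *: u l').
    under [RHS]eq_bigr do rewrite scalerBr scaler_sumr.
    rewrite sumrB mulr_suml; congr (_ - _); first by apply: eq_bigr => l _; rewrite scalerAl.
    rewrite exchange_big /=; apply: eq_bigr => l _; rewrite mxE scaler_suml.
    by apply: eq_bigr => l' _; rewrite mxE scalerA.
  by apply: (sub_sum _ subJ) => l _; apply: (subZ _ subJ); apply: (hM0 (i, l)).
have det0 i : \det (M i) != 0.
  apply/negP => /det0P[y y0 yM]; case/negP: y0; apply/eqP/rowP => l; rewrite [RHS]mxE.
  apply: (uind (fun l => y 0 l)); apply: (right_ideal_monV (a := lbasis i) ht hJ).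
  have := hM i y; rewrite yM [X in J (_ - X)]big1 ?subr0 // => l' _.
  by rewrite mxE scale0r.
move=> i j; set la := lam _ _.
have hprod i' j' (y : 'rV[k]_c) : J ((\sum_l y 0 l *: u l) * (mon (lbasis i') * mon (lbasis j')) -
    \sum_l (y *m M i' *m M j') 0 l *: u l).
  have h1 := right_idealM (mon (lbasis j')) hJ (hM i' y).
  have := subD subJ h1 (hM j' (y *m M i')).
  by rewrite mulrBl addrA subrK mulrA.
have eM : M i *m M j = la *: (M j *m M i).
  apply/matrixP => l l'; apply/eqP; rewrite -subr_eq0; apply/eqP.
  pose y : 'rV[k]_c := delta_mx 0 l.
  have row_y (B : 'M[k]_c) l1 : (y *m B) 0 l1 = B l l1 by rewrite -rowE mxE.
  apply: (uind (fun l' => (M i *m M j) l l' - (la *: (M j *m M i)) l l')).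
  under eq_bigr => l1 _ do rewrite -!row_y.
  have h1 := hprod i j y; have h2 := subZ la subJ (hprod j i y).
  rewrite (monC ht) -scalerAr in h1.
  have := subB subJ h2 h1; rewrite scalerBr opprB addrC addrA subrK.
  rewrite scaler_sumr -sumrB -!mulmxA.
  suff -> : \sum_(i2 < c) ((y *m (M i *m M j)) 0 i2 *: u i2 - la *: ((y *m (M j *m M i)) 0 i2 *: u i2))
    = \sum_(i2 < c) ((y *m (M i *m M j)) 0 i2 - (y *m (la *: (M j *m M i))) 0 i2) *: u i2 by [].
  apply: eq_bigr => l1 _.
  have -> : (y *m (la *: (M j *m M i))) 0 l1 = la * (y *m (M j *m M i)) 0 l1.
    by rewrite -scalemxAr [LHS]mxE.
  by rewrite scalerBl scalerA.
have := congr1 determinant eM; rewrite det_mulmx detZ det_mulmx mulrC.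
rewrite -[LHS]mul1r => /mulIf ->//; by rewrite mulf_neq0.
Qed.

End FiniteDimensional.

Section Torsionfree.
Variable i1 : 'I_n.
Let z := mon (lbasis i1).
Let rp (f : {poly k}) : A := horner_alg z f.
Let mu a := lam (lbasis i1) a.

(** The automorphism of k[z] that a polynomial undergoes when it passes the monomial of [a]; it
    multiplies the leading coefficient by [mu a] to the power of the degree. *)
Let tw a (f : {poly k}) := f \Po (mu a *: 'X).

Let rp_mon f a : rp f * mon a = mon a * rp (tw a f).
Proof.
elim/poly_ind: f => [|f c IH].
  by rewrite /tw comp_poly0 /rp rmorph0 mul0r mulr0.
have -> : rp (f * 'X + c%:P) = rp f * z + c *: 1.
  by rewrite /rp rmorphD rmorphM /= horner_algX horner_algC.
have -> : rp (tw a (f * 'X + c%:P)) = mu a *: (rp (tw a f) * z) + c *: 1.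
  rewrite /tw comp_poly_MXaddC /rp rmorphD rmorphM /= horner_algC.
  by rewrite -mul_polyC rmorphM /= horner_algC horner_algX mulr_algl -scalerAr.
rewrite mulrDl mulrDr -mulrA (monC ht) -/(mu a) -!scalerAr mulrA IH -scalerAl.
by rewrite mul1r mulr1 mulrA.
Qed.

Let rpZ c f : rp (c *: f) = c *: rp f.
Proof. by rewrite /rp -mul_polyC rmorphM /= horner_algC mulr_algl. Qed.
Let rp_sum (I : finType) (F : I -> {poly k}) : rp (\sum_i F i) = \sum_i rp (F i).
Proof. exact: raddf_sum. Qed.

Let size_muX a : size (mu a *: 'X : {poly k}) = 2.
Proof. by rewrite size_scale ?size_polyX // (lam_neq0 ht). Qed.
Let size_tw a f : size (tw a f) = size f.
Proof. by rewrite size_comp_poly2 // size_muX. Qed.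
Let lead_tw a f : lead_coef (tw a f) = lead_coef f * mu a ^+ (size f).-1.
Proof.
rewrite lead_coef_comp ?size_muX // lead_coefZ lead_coefX mulr1 //.
Qed.
Let tw_eq0 a f : (tw a f == 0) = (f == 0).
Proof. by rewrite -!size_poly_eq0 size_tw. Qed.

Definition rindep c (u : 'I_c -> A) := forall F : 'I_c -> {poly k},
  J (\sum_l u l * rp (F l)) -> forall l, F l = 0.

Hypothesis htf : forall D, ~ lead J m (edelta i1 D).
Variable C : nat.
Hypothesis hgrow : forall M (L : finType) (u : L -> A), indep J u ->
  (forall l, box mon M (u l)) -> (#|L| <= C * M.+1)%N.

Let zX i : exists2 c, c != 0 & m (edelta i1 i) = c *: rp 'X^i.
Proof.
elim: i => [|i [c c0 e]].
  exists 1; rewrite ?oner_neq0 // expr0 /rp rmorph1 scale1r -m0; congr m.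
  by apply/ffunP => l; rewrite !ffunE; case: eqP.
have [d d0 e'] := mM (edelta i1 1) (edelta i1 i).
have ej : eadd (edelta i1 1) (edelta i1 i) = edelta i1 i.+1.
  by apply/ffunP => l; rewrite !ffunE; case: eqP.
exists (d^-1 * c); first by rewrite mulf_neq0 // invr_eq0.
apply: (scalerI d0); rewrite -ej -e' mdelta -/z e scalerA mulrA mulfV // mul1r.
by rewrite exprS /rp rmorphM /= horner_algX scalerAr.
Qed.

Let rindep1 : rindep (fun _ : 'I_1 => 1).
Proof.
move=> F; rewrite big_ord1 mul1r => hF l; rewrite (ord1 l).
set f := F ord0 in hF *; apply/polyP => i; rewrite coef0.
have [hi|hi] := leqP (size f) i; first by rewrite nth_default.
have /choice[c hc] j : exists c, c != 0 /\ m (edelta i1 j) = c *: rp 'X^j.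
  by have [c] := zX j; exists c.
have hind : indep J (fun j : 'I_(size f) => m (edelta i1 j)).
  apply: (indep_nlead subJ (f := fun j : 'I_(size f) => edelta i1 j)) => [j j'|j]; last exact: htf.
  by move/ffunP/(_ i1); rewrite !ffunE eqxx => /val_inj.
have := hind (fun j => f`_j / c j) _ (Ordinal hi) => /=.
move=> h; have : f`_i / c i = 0.
  apply: h; suff -> : \sum_(j < size f) f`_j / c j *: m (edelta i1 j) = rp f by [].
  have ef : f = \sum_(j < size f) f`_j *: 'X^j by rewrite -{1}(coefK f) poly_def.
  transitivity (rp (\sum_(j < size f) f`_j *: 'X^j)); last by rewrite -ef.
  rewrite rp_sum; apply: eq_bigr => j _.
  by rewrite (hc j).2 scalerA mulfVK ?(hc j).1.
by move/eqP; rewrite mulf_eq0 invr_eq0 (negPf (hc i).1) orbF => /eqP.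
Qed.

(** The elements u_l z^j with j <= M are c (M + 1) independent elements of a box of radius s + M, so
    linear growth bounds c by [C]. *)
Let rindep_bound c (u : 'I_c -> A) : rindep u -> (c <= C)%N.
Proof.
move=> hu; have [s hs] : exists s, forall l, box mon s (u l).
  have /choice[s hs] l := box_ex hspan (u l).
  exists (\max_l s l)%N => l; apply: lspan_mono (hs l) => _ [a ha ->]; exists a => // i.
  by apply: leq_trans (ha i) _; apply: leq_bigmax.
have key M : (c * M.+1 <= C * (s + M).+1)%N.
  have /choice[d hd] (j : nat) : exists d, d != 0 /\ m (edelta i1 j) = d *: rp 'X^j.
    by have [d] := zX j; exists d.
  pose w (lj : 'I_c * 'I_M.+1) := u lj.1 * m (edelta i1 lj.2).
  have := hgrow (M := s + M) (u := w); rewrite card_prod !card_ord; apply.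
    move=> b hb.
    have h := hu (fun l => \sum_(j < M.+1) (b (l, j) * d j) *: 'X^j).
    have {}h l : \sum_(j < M.+1) (b (l, j) * d j) *: 'X^j = 0 :> {poly k}.
      apply: h; suff -> : \sum_l u l * rp (\sum_(j < M.+1) (b (l, j) * d j) *: 'X^j) =
          \sum_lj b lj *: w lj by [].
      transitivity (\sum_l \sum_j b (l, j) *: w (l, j)); last first.
        by rewrite pair_bigA; apply: eq_bigr => -[].
      apply: eq_bigr => l' _.
      rewrite rp_sum mulr_sumr; apply: eq_bigr => j _.
      by rewrite /w /= (hd j).2 rpZ -!scalerAr scalerA.
    case=> l j; have /polyP/(_ j) := h l.
    have <- : \poly_(j0 < M.+1) (b (l, inord j0) * d j0) =
        \sum_(j < M.+1) (b (l, j) * d j) *: 'X^j :> {poly k}.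
      by rewrite poly_def; apply: eq_bigr => j' _; rewrite inord_val.
    rewrite coef_poly ltn_ord coef0 inord_val => /eqP; rewrite mulf_eq0 (negPf (hd j).1) orbF.
    by move/eqP.
  case=> l j; apply: (lspan_le (S := fun x => box mon (s + M) (x * m (edelta i1 j))) _ _ (hs l)).
    exact: (preim_mulr_subspace _ (lspan_subspace _)).
  move=> _ [a ha ->]; have [e e0 ->] := monM ht a (epos predT (edelta i1 j)).
  apply: (subZ _ (lspan_subspace _)); apply: lspan_in; exists (a + epos predT (edelta i1 j)) => // i.
  have -> : (a + epos predT (edelta i1 j)) i = (a i + (edelta i1 j i)%:Z)%R :> int.
    by rewrite !ffunE.
  have hj : (edelta i1 j i <= M)%N by rewrite ffunE; case: eqP => // _; rewrite -ltnS.
  by move: (a i) (ha i) hj => x; lia.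
(* M = C s is large enough for c >= C + 1 to contradict the inequality. *)
rewrite leqNgt; apply/negP => hc; have := key (C * s)%N; nia.
Qed.

(** On a maximal k[z]-independent family, right multiplication by X_h becomes semilinear with matrix
    B_h / d_h. The two orders of multiplying by X_h and X_j are compared through leading
    coefficients of determinants. *)
Lemma torsionfree_commutation : exists2 c : nat, (0 < c)%N &
  exists w : 'I_n -> int, forall h j, lam (lbasis h) (lbasis j) ^+ c =
    lam (lbasis i1) (lbasis j) ^ (w h) * lam (lbasis i1) (lbasis h) ^ (- w j).
Proof.
pose Q c := exists u : 'I_c -> A, rindep u.
have exQ : exists c, `[< Q c >] by exists 1%N; apply/asboolP; eexists; exact: rindep1.
have bQ c : `[< Q c >] -> (c <= C)%N by move/asboolP => [u]; apply: rindep_bound.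
case: (ex_maxnP exQ bQ) => c /asboolP[u hu] hmax.
have c0 : (0 < c)%N by apply: hmax; apply/asboolP; eexists; exact: rindep1.
exists c => //.
(* By maximality of c, every g becomes dependent on the [u l] after right multiplication by a
   nonzero polynomial. *)
have dep g : exists dF : {poly k} * ('I_c -> {poly k}), dF.1 != 0 /\
    J (g * rp dF.1 - \sum_l u l * rp (dF.2 l)).
  apply: contrapT => hno; suff /hmax : `[< Q c.+1 >] by rewrite ltnn.
  apply/asboolP; exists (fun i => if unlift ord0 i is Some l then u l else g).
  move=> F; rewrite big_ord_recl unlift_none => hF.
  have hF' : J (g * rp (F ord0) + \sum_l u l * rp (F (lift ord0 l))).
    suff <- : \sum_(i < c) (if unlift ord0 (lift ord0 i) is Some l then u l else g) * rp (F (lift ord0 i))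
      = \sum_l u l * rp (F (lift ord0 l)) by [].
    by apply: eq_bigr => i _; rewrite liftK.
  have F0 : F ord0 = 0.
    apply/eqP; apply: contrapT => /negP F0; apply: hno.
    exists (F ord0, fun l => - F (lift ord0 l)); split=> //=.
    suff -> : \sum_l u l * rp (- F (lift ord0 l)) = - \sum_l u l * rp (F (lift ord0 l)).
      by rewrite opprK.
    by rewrite -sumrN; apply: eq_bigr => l _; rewrite /rp rmorphN mulrN.
  move=> i; case: (unliftP ord0 i) => [l ->|-> //].
  apply: (hu (fun l => F (lift ord0 l))).
  by move: hF'; rewrite F0 /rp rmorph0 mulr0 add0r.
have /choice[dF hdF] (hl : 'I_n * 'I_c) := dep (u hl.2 * mon (lbasis hl.1)).
(* [d h] is a common denominator of the rows for X_h, and [B h] carries the missing factors. *)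
pose d h := \prod_l (dF (h, l)).1.
have d0 h : d h != 0 by apply/prodf_neq0 => l _; case: (hdF (h, l)).
pose B h : 'M[{poly k}]_c :=
  \matrix_(l, l') ((dF (h, l)).2 l' * \prod_(l1 | l1 != l) (dF (h, l1)).1).
pose comb (y : 'rV[{poly k}]_c) := \sum_l u l * rp (y 0 l).
have rpM f g : rp (f * g) = rp f * rp g by rewrite /rp rmorphM.
have combD y y' : comb (y + y') = comb y + comb y'.
  by rewrite -big_split; apply: eq_bigr => l _; rewrite mxE /rp rmorphD mulrDr.
have combN y : comb (- y) = - comb y.
  by rewrite -sumrN; apply: eq_bigr => l _; rewrite mxE /rp rmorphN mulrN.
have combZ f y : comb (f *: y) = comb y * rp f.
  by rewrite mulr_suml; apply: eq_bigr => l _; rewrite mxE mulrC rpM mulrA.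
have combJ y : J (comb y) -> y = 0.
  by move=> hy; apply/rowP => l; rewrite [RHS]mxE; apply: (hu (fun l => y 0 l)).
have hB h (y : 'rV[{poly k}]_c) :
    J (comb y * mon (lbasis h) * rp (d h) - comb (map_mx (tw (lbasis h)) y *m B h)).
  have -> : comb y * mon (lbasis h) * rp (d h) - comb (map_mx (tw (lbasis h)) y *m B h) =
     \sum_l (u l * mon (lbasis h) * rp (dF (h, l)).1 - \sum_l' u l' * rp ((dF (h, l)).2 l')) *
        rp (\prod_(l1 | l1 != l) (dF (h, l1)).1 * tw (lbasis h) (y 0 l)).
    under [RHS]eq_bigr do rewrite mulrBl mulr_suml.
    rewrite sumrB /comb; congr (_ - _).
      rewrite !mulr_suml; apply: eq_bigr => l _.
      rewrite -!mulrA (mulrA (rp (y 0 l))) rp_mon -!mulrA; congr (_ * (_ * _)).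
      by rewrite -!rpM /d (bigD1 l) //=; congr rp; rewrite mulrC mulrA.
    rewrite exchange_big /=; apply: eq_bigr => l' _.
    rewrite mxE rp_sum mulr_sumr; apply: eq_bigr => l _.
    by rewrite !mxE -mulrA -rpM; congr (_ * rp _); rewrite mulrC mulrA.
  apply: (sub_sum _ subJ) => l _; apply: right_idealM => //; by case: (hdF (h, l)).
have det0 h : \det (B h) != 0.
  apply/negP => /det0P[y y0 yB]; case/negP: y0; apply/eqP.
  (* A kernel vector and [d h] are both untwisted, so that they can be moved to the left of X_h,
     which is a unit. *)
  pose y' := map_mx (fun f => f \Po ((mu (lbasis h))^-1 *: 'X)) y : 'rV[{poly k}]_c.
  have ey : map_mx (tw (lbasis h)) y' = y.
    apply/rowP => l; rewrite !mxE /tw -comp_polyA comp_polyZ comp_polyX scalerA mulVf ?(lam_neq0 ht) //.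
    by rewrite scale1r comp_polyXr.
  have := hB h y'; rewrite ey yB.
  have -> : comb 0 = 0 by rewrite /comb big1 // => l _; rewrite mxE /rp rmorph0 mulr0.
  rewrite subr0.
  pose dd := d h \Po ((mu (lbasis h))^-1 *: 'X).
  have edd : tw (lbasis h) dd = d h.
    by rewrite /tw -comp_polyA comp_polyZ comp_polyX scalerA mulVf ?(lam_neq0 ht) // scale1r comp_polyXr.
  rewrite -edd -mulrA -rp_mon mulrA -combZ => /(right_ideal_monV ht hJ)/combJ e.
  have dd0 : dd != 0 by rewrite -(tw_eq0 (lbasis h)) edd.
  rewrite -ey; apply/rowP => l; move/rowP/(_ l): e; rewrite !mxE => /eqP.
  by rewrite mulf_eq0 (negPf dd0) /= => /eqP ->; rewrite /tw comp_poly0.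
(* [w h] is the degree of the rational function det (B_h / d_h). *)
pose w h : int := (size (\det (B h))).-1%:Z - (c * (size (d h)).-1)%:Z.
exists w => h j; set la := lam (lbasis h) _.
pose S h' j' := map_mx (tw (lbasis j')) (B h') *m B j'.
pose e h' j' := tw (lbasis j') (d h') * d j'.
have hprod h' j' (y : 'rV[{poly k}]_c) : J (comb y * (mon (lbasis h') * mon (lbasis j')) * rp (e h' j') -
    comb (map_mx (tw (lbasis j')) (map_mx (tw (lbasis h')) y) *m S h' j')).
  have h1 := right_idealM (mon (lbasis j') * rp (d j')) hJ (hB h' y).
  have h2 := hB j' (map_mx (tw (lbasis h')) y *m B h').
  have := subD subJ h1 h2.
  rewrite mulrBl !mulrA addrA subrK -[comb y * _ * rp (d h') * _]mulrA rp_mon mulrA.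
  rewrite -[_ * rp (tw _ _) * rp _]mulrA -rpM -/(e h' j') -[comb y * _ * _]mulrA.
  have -> : map_mx (tw (lbasis j')) (map_mx (tw (lbasis h')) y *m B h') =
      map_mx (tw (lbasis j')) (map_mx (tw (lbasis h')) y) *m map_mx (tw (lbasis j')) (B h').
    exact: (map_mxM (comp_poly (mu (lbasis j') *: 'X))).
  by rewrite -mulmxA.
(* Cross multiplication by the two denominators avoids fractions when the products are compared. *)
have eS : e j h *: S h j = (la%:P * e h j) *: S j h.
  apply/row_matrixP => l.
  apply/eqP; rewrite -subr_eq0; apply/eqP; apply: combJ.
  pose y : 'rV[{poly k}]_c := delta_mx 0 l.
  have twy h' j' : map_mx (tw (lbasis j')) (map_mx (tw (lbasis h')) y) = y.
    have t1 i : map_mx (tw (lbasis i)) y = y.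
      by apply/rowP => l'; rewrite !mxE; case: eqP => _ //=; rewrite /tw ?mulr1n ?mulr0n ?comp_polyC //; case: eqP => _; rewrite ?comp_polyC ?comp_poly0.
    by rewrite !t1.
  have h1 := right_idealM (rp (e j h)) hJ (hprod h j y).
  have h2 := right_idealM (rp (la%:P * e h j)) hJ (hprod j h y).
  rewrite !twy in h1 h2.
  have := subB subJ h2 h1.
  rewrite !mulrBl -!combZ opprB.
  have -> : comb y * (mon (lbasis j) * mon (lbasis h)) * rp (e j h) * rp (la%:P * e h j) =
      comb y * (mon (lbasis h) * mon (lbasis j)) * rp (e h j) * rp (e j h).
    rewrite (monC ht (lbasis h)) -/la mul_polyC rpZ -!scalerAr -!scalerAl.
    by congr (la *: _); rewrite -!mulrA -!rpM [e j h * _]mulrC.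
  rewrite addrC addrA subrK -combN -combD.
  suff -> : row l (e j h *: S h j) - row l ((la%:P * e h j) *: S j h) =
     e j h *: (y *m S h j) - (la%:P * e h j) *: (y *m S j h) by [].
  by rewrite !rowE -!scalemxAr.
have /= := congr1 (fun M => lead_coef (\det M)) eS.
have detS h' j' : \det (S h' j') = tw (lbasis j') (\det (B h')) * \det (B j').
  by rewrite det_mulmx (det_map_mx (comp_poly (mu (lbasis j') *: 'X))).
rewrite !detZ !detS !exprMn !lead_coefM !lead_coef_exp lead_coefC !lead_tw.
set ldj := lead_coef (d j); set ldh := lead_coef (d h).
set lbj := lead_coef (\det (B j)); set lbh := lead_coef (\det (B h)).
have n1 : ldj != 0 by rewrite lead_coef_eq0.
have n2 : ldh != 0 by rewrite lead_coef_eq0.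
have n3 : lbj != 0 by rewrite lead_coef_eq0.
have n4 : lbh != 0 by rewrite lead_coef_eq0.
rewrite -/(mu (lbasis j)) -/(mu (lbasis h)).
set muj := mu (lbasis j); set muh := mu (lbasis h).
have m1 : muj != 0 by apply: lam_neq0 ht _ _.
have m2 : muh != 0 by apply: lam_neq0 ht _ _.
rewrite !exprMn -!exprM /w opprB !expfzDr // -!invr_expz -!exprnP.
set a := (size (d j)).-1; set b := (size (d h)).-1.
set r := (size (\det (B j))).-1; set p := (size (\det (B h))).-1 => e0.
have e1 : muh ^+ (a * c) * muj ^+ p = la ^+ c * (muj ^+ (b * c) * muh ^+ r).
  apply: (@mulIf _ (ldj ^+ c * ldh ^+ c * lbh * lbj)).
    by rewrite !mulf_neq0 // expf_neq0.
  move: e0; move: (ldj ^+ c) (ldh ^+ c) (muh ^+ (a * c)) (muj ^+ p) (muj ^+ (b * c))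
    (muh ^+ r) (la ^+ c) (lbj) (lbh) => x1 x2 x3 x4 x5 x6 x7 x8 x9 e0.
  transitivity (x1 * x3 * x2 * (x9 * x4 * x8)); first ring.
  by rewrite e0; ring.
apply: (@mulIf _ (muj ^+ (b * c) * muh ^+ r)); first by rewrite mulf_neq0 // expf_neq0.
rewrite -e1 [(c * b)%N]mulnC [(c * a)%N]mulnC.
have h1 : muh ^+ r != 0 by rewrite expf_neq0.
have h2 : muj ^+ (b * c) != 0 by rewrite expf_neq0.
clear e1.
move: h1 h2; move: (muh ^+ r) (muj ^+ (b * c)) (muh ^+ (a * c)) (muj ^+ p) => y1 y2 y3 y4 h1 h2.
by field; rewrite h1 h2.
Qed.

End Torsionfree.
End LinearGrowthModule.

Section LargeDeviation.
Variables (k : fieldType) (A : algType k) (n : nat).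
Variables (mon : lattice n -> A) (lam : lattice n -> lattice n -> k).
Hypothesis ht : torus_mon mon lam.
Hypothesis hspan : forall x, lspan (fun y => exists a, y = mon a) x.

Lemma lamMzl a b z : lam (a *~ z) b = lam a b ^ z.
Proof.
case: z => i; first by rewrite -pmulrn (lamMnl ht).
by rewrite NegzE mulrNz -pmulrn (lamNl ht) (lamMnl ht) -exprnN.
Qed.
Lemma lamMzr a b z : lam b (a *~ z) = lam b a ^ z.
Proof. by rewrite -(lamMzlr ht) lamMzl. Qed.

Lemma large_deviation_commutation : (0 < n)%N ->
  ~ dev_lt n.-1 (fun x : A => x = 0) (fun _ => True) ->
  exists i1 : 'I_n, exists2 c : nat, (0 < c)%N & exists w : 'I_n -> int, forall h j,
    lam (lbasis h *~ c%:Z - lbasis i1 *~ w h) (lbasis j *~ c%:Z - lbasis i1 *~ w j) = 1.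
Proof.
move=> n0 hdev.
have r0 : right_ideal (fun x : A => x = 0).
  by split=> // [x y -> ->|x a ->]; rewrite ?addr0 ?mul0r.
have r1 : right_ideal (fun _ : A => True) by split.
have [J [I [x0 [hJ hI hJI hd [Ix Jx]]]]] : exists J I x0, [/\ right_ideal J, right_ideal I,
    (forall x : A, J x -> I x), dim_lt 2 (ldiff mon J I) & I x0 /\ ~ J x0].
  apply: contrapT => hno; apply: hdev; apply: (dev_bound ht) => //.
    move=> J I hJ hI hJI hd x hx; apply: contrapT => nx; apply: hno.
    by exists J, I, x.
  (* The dimension condition is vacuous here: it speaks of n + 1 distinct variables. *)
  rewrite prednK // => a S hS; have := max_card (mem S).
  by rewrite hS card_ord ltnn.
have [J' [hJ' J'1] [C hC]] := linear_growth ht hspan hJ hI hJI hd Ix Jx.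
have lamE i1 (c : nat) (w : 'I_n -> int) h j :
    lam (lbasis h *~ c%:Z - lbasis i1 *~ w h) (lbasis j *~ c%:Z - lbasis i1 *~ w j) =
    (lam (lbasis h) (lbasis j) ^+ c * lam (lbasis i1) (lbasis h) ^ w j *
      lam (lbasis i1) (lbasis j) ^ (- w h)) ^+ c.
  rewrite (lamDl ht) (lamNl ht) !(lamDr ht) !(lamNr ht) !lamMzl !lamMzr.
  have -> : lam (lbasis h) (lbasis i1) = (lam (lbasis i1) (lbasis h))^-1.
    by apply: (mulfI (lam_neq0 ht (lbasis i1) (lbasis h))); rewrite (lamV ht) mulfV // (lam_neq0 ht).
  rewrite (lamaa ht) !exp1rz invr1 mulr1 !exprMn -!exprnP .
  set y := lam (lbasis i1) (lbasis h); set z := lam (lbasis i1) (lbasis j).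
  have -> : y^-1 ^ w j = (y ^ w j)^-1 by rewrite exprz_inv invr_expz.
  rewrite exprVn invrK; congr (_ * _).
  by rewrite !exprnP exprzAC -invr_expz exprz_inv invr_expz.
have [htor|hntf] := pselect (forall i, exists D, lead J' (fun a => mon (epos predT a)) (edelta i D)).
  have [c c0 hc'] := torsion_commutation ht hJ' J'1 htor.
  exists (Ordinal n0), c => //; exists (fun=> 0) => h j.
  by rewrite lamE hc' oppr0 !expr0z !mulr1 expr1n.
have [i1 hi1] : exists i1, forall D, ~ lead J' (fun a => mon (epos predT a)) (edelta i1 D).
  apply: contrapT => h; apply: hntf => i; apply: contrapT => hi; apply: h.
  by exists i => D hD; apply: hi; exists D.
have [c c0 [w hw]] := torsionfree_commutation ht hspan hJ' hi1 hC.
exists i1, c => //; exists w => h j; rewrite lamE hw.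
set y := lam (lbasis i1) (lbasis h); set z := lam (lbasis i1) (lbasis j).
have y0 : y ^ w j != 0 by rewrite expfz_neq0 // (lam_neq0 ht).
have z0 : z ^ w h != 0 by rewrite expfz_neq0 // (lam_neq0 ht).
have -> : z ^ w h * y ^ (- w j) * y ^ w j * z ^ (- w h) = 1; last by rewrite expr1n.
by rewrite -!invr_expz; field; rewrite y0 z0.
Qed.
End LargeDeviation.

From mathcomp Require Import functions.

(** * The monomial basis of the quantum torus *)

Section Subalgebra.
Variables (k : fieldType) (A : algType k).

(** A subalgebra has to become an algebra type, because the universal property quantifies over such
    types; it is used for the span of the monomials. *)
Record subalg_pred := SubalgPred {
  sa_pred : A -> Prop;
  sa_sub : lsubspace sa_pred;
  sa_1 : sa_pred 1;
  sa_M : forall x y, sa_pred x -> sa_pred y -> sa_pred (x * y) }.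

Variable S : subalg_pred.
Definition sa_bool : pred A := fun x => `[< sa_pred S x >].
Record subalg := SubalgElt { sa_val : A; sa_valP : sa_bool sa_val }.
HB.instance Definition _ := [isSub for sa_val].
HB.instance Definition _ := [Choice of subalg by <:].

Lemma sa_closed : GRing.subsemialg_closed sa_bool.
Proof.
split.
- by apply/asboolP; exact: sa_1.
- split; first by apply/asboolP; exact: (sub0 (sa_sub S)).
  by move=> x y /asboolP hx /asboolP hy; apply/asboolP; exact: (subD (sa_sub S)).
- by move=> c x /asboolP hx; apply/asboolP; exact: (subZ _ (sa_sub S)).
- by move=> x y /asboolP hx /asboolP hy; apply/asboolP; exact: sa_M.
Qed.
HB.instance Definition _ := GRing.SubChoice_isSubAlgebra.Build k A sa_bool subalg sa_closed.

Lemma sa_val_hom : is_alg_hom (sa_val : (subalg : algType k) -> A).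
Proof. by split=> [c x y|]; [exact: (@linearP _ _ _ _ (val : subalg -> A))|split]. Qed.
End Subalgebra.

Section Endomorphisms.
Variables (k : fieldType) (n : nat).
Local Notation W := (lattice n -> k^o).

(** Linear endomorphisms of all functions on the lattice, the target of a representation that
    separates the monomials. *)
Record endo := Endo { ef : W -> W; ef_lin : forall c x y, ef (c *: x + y) = c *: ef x + ef y }.
HB.instance Definition _ := gen_eqMixin endo.
HB.instance Definition _ := gen_choiceMixin endo.

Lemma endoP (f g : endo) : (forall x b, ef f x b = ef g x b) -> f = g.
Proof.
case: f g => [f hf] [g hg] /= h.
have e : f = g by apply/funext => x; apply/funext => b.
by subst g; congr Endo; exact: Prop_irrelevance.
Qed.

Let zero_lin c (x y : W) : (0 : W) = c *: 0 + 0. Proof. by rewrite scaler0 addr0. Qed.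
Definition endo0 := @Endo (fun=> 0) zero_lin.
Let one_lin c (x y : W) : c *: x + y = c *: x + y. Proof. by []. Qed.
Definition endo1 := @Endo id one_lin.
Lemma endo_add_lin (f g : endo) c x y :
  ef f (c *: x + y) + ef g (c *: x + y) = c *: (ef f x + ef g x) + (ef f y + ef g y).
Proof. by rewrite !ef_lin scalerDr addrACA. Qed.
Definition endo_add f g := Endo (endo_add_lin f g).
Lemma endo_scale_lin d (f : endo) c x y :
  d *: ef f (c *: x + y) = c *: (d *: ef f x) + d *: ef f y.
Proof. by rewrite !ef_lin scalerDr !scalerA mulrC. Qed.
Definition endo_scale d f := Endo (endo_scale_lin d f).
Definition endo_opp := endo_scale (-1).
Lemma endo_mul_lin (f g : endo) c x y :
  ef f (ef g (c *: x + y)) = c *: ef f (ef g x) + ef f (ef g y).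
Proof. by rewrite !ef_lin. Qed.
Definition endo_mul f g := Endo (endo_mul_lin f g).

Lemma ef0 (f : endo) : ef f 0 = 0.
Proof. by have := ef_lin f (-1) 0 0; rewrite scaler0 addr0 scaleN1r addNr. Qed.
Lemma efD (f : endo) x y : ef f (x + y) = ef f x + ef f y.
Proof. by have := ef_lin f 1 x y; rewrite !scale1r. Qed.
Lemma efZ (f : endo) c x : ef f (c *: x) = c *: ef f x.
Proof. by have := ef_lin f c x 0; rewrite !addr0 ef0 addr0. Qed.

Lemma endo_addA : associative endo_add. Proof. by move=> f g h; apply: endoP => x b; rewrite /= addrA. Qed.
Lemma endo_addC : commutative endo_add. Proof. by move=> f g; apply: endoP => x b; rewrite /= addrC. Qed.
Lemma endo_add0 : left_id endo0 endo_add. Proof. by move=> f; apply: endoP => x b; rewrite /= add0r. Qed.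
Lemma endo_addN : left_inverse endo0 endo_opp endo_add.
Proof. by move=> f; apply: endoP => x b; rewrite /= scaleN1r addNr. Qed.
HB.instance Definition _ := GRing.isZmodule.Build endo endo_addA endo_addC endo_add0 endo_addN.

Lemma endo_mulA : associative endo_mul. Proof. by move=> f g h; apply: endoP. Qed.
Lemma endo_mul1l : left_id endo1 endo_mul. Proof. by move=> f; apply: endoP. Qed.
Lemma endo_mul1r : right_id endo1 endo_mul. Proof. by move=> f; apply: endoP. Qed.
Lemma endo_mulDl : left_distributive endo_mul endo_add. Proof. by move=> f g h; apply: endoP. Qed.
Lemma endo_mulDr : right_distributive endo_mul endo_add.
Proof. by move=> f g h; apply: endoP => x b; rewrite /= efD. Qed.
Lemma endo_1neq0 : endo1 != endo0.
Proof.
apply/eqP => /(congr1 (fun f => ef f (fun=> 1) 0)) /= e.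
by move: (oner_neq0 k); rewrite [X in X != _]e eqxx.
Qed.
HB.instance Definition _ := GRing.Zmodule_isNzRing.Build endo endo_mulA endo_mul1l
  endo_mul1r endo_mulDl endo_mulDr endo_1neq0.

Lemma endo_scaleA c d f : endo_scale c (endo_scale d f) = endo_scale (c * d) f.
Proof. by apply: endoP => x b; rewrite /= scalerA. Qed.
Lemma endo_scale1 : left_id 1 endo_scale. Proof. by move=> f; apply: endoP => x b; rewrite /= scale1r. Qed.
Lemma endo_scaleDr : right_distributive endo_scale +%R.
Proof. by move=> c f g; apply: endoP => x b; rewrite /= scalerDr. Qed.
Lemma endo_scaleDl f : {morph endo_scale^~ f : c d / c + d}.
Proof. by move=> c d; apply: endoP => x b; rewrite /= scalerDl. Qed.
HB.instance Definition _ := GRing.Zmodule_isLmodule.Build k endo endo_scaleA endo_scale1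
  endo_scaleDr endo_scaleDl.
Lemma endo_scaleAl c (f g : endo) : c *: (f * g) = (c *: f) * g.
Proof. by apply: endoP. Qed.
HB.instance Definition _ := GRing.Lmodule_isLalgebra.Build k endo endo_scaleAl.
Lemma endo_scaleAr c (f g : endo) : c *: (f * g) = f * (c *: g).
Proof. by apply: endoP => x b; rewrite /= efZ. Qed.
HB.instance Definition _ := GRing.Lalgebra_isAlgebra.Build k endo endo_scaleAr.
End Endomorphisms.

(** * Commutation up to scalars and ordered monomials *)

Section QuasiCommutation.
Variables (k : fieldType) (B : algType k).
Implicit Types (x y : B) (c : k).

Definition qcomm c x y := x * y = c *: (y * x).

Lemma qcommMl c d x y z : qcomm c x z -> qcomm d y z -> qcomm (c * d) (x * y) z.
Proof.
rewrite /qcomm => h1 h2.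
by rewrite -mulrA h2 -scalerAr (mulrA x) h1 -scalerAl scalerA mulrC mulrA.
Qed.
Lemma qcomm_sym c x y : c != 0 -> qcomm c x y -> qcomm c^-1 y x.
Proof. by rewrite /qcomm => c0 ->; rewrite scalerA mulVf // scale1r. Qed.
Lemma qcommMr c d x y z : c != 0 -> d != 0 -> qcomm c x y -> qcomm d x z ->
  qcomm (c * d) x (y * z).
Proof.
move=> c0 d0 /(qcomm_sym c0) h1 /(qcomm_sym d0) h2.
rewrite -[c * d]invrK; apply: qcomm_sym; first by rewrite invr_eq0 mulf_neq0.
by rewrite invfM; apply: qcommMl.
Qed.
Lemma qcomm1l x : qcomm 1 1 x.
Proof. by rewrite /qcomm scale1r mul1r mulr1. Qed.
Lemma qcommVl c x xi y : c != 0 -> x * xi = 1 -> xi * x = 1 -> qcomm c x y ->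
  qcomm c^-1 xi y.
Proof.
rewrite /qcomm => c0 h1 h2 h.
have : xi * (x * y) * xi = c *: (xi * (y * x) * xi) by rewrite h -scalerAr -scalerAl.
rewrite !mulrA h2 mul1r -(mulrA _ x xi) h1 mulr1 => ->.
by rewrite scalerA mulVf // scale1r.
Qed.

Lemma qcomm_prodl (I : Type) (r : seq I) (c : I -> k) (F : I -> B) z :
  (forall i, qcomm (c i) (F i) z) -> qcomm (\prod_(i <- r) c i) (\prod_(i <- r) F i) z.
Proof.
move=> h; elim: r => [|i r IH]; first by rewrite !big_nil; apply: qcomm1l.
by rewrite !big_cons; apply: qcommMl.
Qed.

End QuasiCommutation.

Section TorusMonomials.
Variables (k : fieldType) (n : nat) (q : 'M[k]_n) (B : algType k) (Y Yi : 'I_n -> B).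
Hypothesis hq : mult_antisym q.
Hypothesis hY : qtorus_rel q Y Yi.

Definition xpow (i : 'I_n) (z : int) : B :=
  match z with Posz m => Y i ^+ m | Negz m => Yi i ^+ m.+1 end.
Definition qmon (a : lattice n) : B := \prod_i xpow i (a i).
Definition qlam (a b : lattice n) : k := \prod_i \prod_j q i j ^ (a i * b j).

Let YYi i : Y i * Yi i = 1. Proof. by case: hY => h _; case: (h i). Qed.
Let YiY i : Yi i * Y i = 1. Proof. by case: hY => h _; case: (h i). Qed.
Let q0 i j : q i j != 0. Proof. by case: hq. Qed.

Lemma xpowS i z : xpow i (z + 1) = xpow i z * Y i.
Proof.
case: z => m; first by rewrite -PoszD addn1 /= exprSr.
have -> : Negz m + 1 = - m%:Z by rewrite NegzE -addn1 PoszD opprD addrNK.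
case: m => [|m]; first by rewrite oppr0 /= expr0 expr1 YiY.
by rewrite -NegzE /= [X in _ = X * _]exprSr -mulrA YiY mulr1.
Qed.
Lemma xpowP i z : xpow i (z - 1) = xpow i z * Yi i.
Proof. by rewrite -[z in RHS](subrK 1) xpowS -mulrA YYi mulr1. Qed.
Lemma xpowD i z w : xpow i (z + w) = xpow i z * xpow i w.
Proof.
elim: w => [|m IH|m IH]; first by rewrite addr0 /= expr0 mulr1.
  by rewrite -addn1 PoszD addrA !xpowS IH mulrA.
by rewrite -addn1 PoszD opprD addrA !xpowP IH mulrA.
Qed.

Lemma qcommYx i j w : qcomm (q i j ^ w) (Y i) (xpow j w).
Proof.
have h1 : qcomm (q i j) (Y i) (Y j) by case: hY => _; apply.
have h2 : qcomm (q i j)^-1 (Y i) (Yi j).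
  have := qcommVl (c := q j i) (q0 _ _) (YYi j) (YiY j).
  case: hq => _ [_ hs]; rewrite hs => /(_ (Y i)) h.
  apply: qcomm_sym => //; have := h (qcomm_sym (q0 i j) h1); by rewrite invrK.
elim: w => [|m IH|m IH].
- by rewrite expr0z /= expr0 /qcomm mulr1 mul1r scale1r.
- rewrite -addn1 PoszD expfzDr // expr1z xpowS; apply: qcommMr => //.
  by rewrite expfz_neq0.
- rewrite -addn1 PoszD opprD expfzDr // exprN1 xpowP; apply: qcommMr => //.
    by rewrite expfz_neq0.
  by rewrite invr_eq0.
Qed.

Lemma qcomm_xpow i j z w : qcomm (q i j ^ (z * w)) (xpow i z) (xpow j w).
Proof.
have h := qcommYx i j w.
elim: z => [|m IH|m IH].
- by rewrite mul0r expr0z /= expr0; exact: qcomm1l.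
- rewrite -addn1 PoszD mulrDl mul1r expfzDr // xpowS; exact: qcommMl.
- rewrite -addn1 PoszD opprD mulrDl mulN1r expfzDr // xpowP; apply: qcommMl => //.
  rewrite -invr_expz; apply: qcommVl h => //; by rewrite expfz_neq0.
Qed.

Lemma qtorus_mon : torus_mon qmon qlam.
Proof.
split.
- by rewrite /qmon big1 // => i _; rewrite ffunE /= expr0.
- move=> a b; rewrite /qmon.
  suff h (r : seq 'I_n) : exists2 c, c != 0 &
     (\prod_(i <- r) xpow i (a i)) * (\prod_(i <- r) xpow i (b i)) =
     c *: \prod_(i <- r) xpow i ((a + b) i) by exact: h.
  elim: r => [|i r [c c0 IH]].
    by exists 1; rewrite ?oner_neq0 // !big_nil mulr1 scale1r.
  rewrite !big_cons; set P := \prod_(j <- r) xpow j (a j) in IH *.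
  have h : qcomm (\prod_(j <- r) q j i ^ (a j * b i)) P (xpow i (b i)).
    by apply: qcomm_prodl => j; apply: qcomm_xpow.
  exists ((\prod_(j <- r) q j i ^ (a j * b i)) * c).
    by rewrite mulf_neq0 // prodf_seq_neq0; apply/allP => j _ /=; exact: expfz_neq0.
  rewrite mulrA -(mulrA (xpow i (a i))) h -scalerAr -!scalerAl mulrA -xpowD.
  by rewrite -mulrA IH -scalerAr scalerA ffunE.
- move=> a b; rewrite /qlam.
  apply: qcomm_prodl => i.
  have h (r : seq 'I_n) : qcomm (\prod_(j <- r) q i j ^ (a i * b j)) (xpow i (a i))
      (\prod_(j <- r) xpow j (b j)).
    elim: r => [|j r IH]; first by rewrite !big_nil /qcomm mulr1 mul1r scale1r.
    rewrite !big_cons; apply: qcommMr => //; first exact: expfz_neq0.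
    + by rewrite prodf_seq_neq0; apply/allP => l _ /=; exact: expfz_neq0.
    + exact: qcomm_xpow.
  exact: h.
- by move=> a b; apply/prodf_neq0 => i _; apply/prodf_neq0 => j _; exact: expfz_neq0.
- move=> a b c; rewrite -big_split; apply: eq_bigr => i _; rewrite -big_split.
  by apply: eq_bigr => j _; rewrite ffunE mulrDl expfzDr.
- move=> a b c; rewrite -big_split; apply: eq_bigr => i _; rewrite -big_split.
  by apply: eq_bigr => j _; rewrite ffunE mulrDr expfzDr.
Qed.

End TorusMonomials.

Section ShiftRepresentation.
Variables (k : fieldType) (n : nat) (q : 'M[k]_n).
Hypothesis hq : mult_antisym q.
Local Notation W := (lattice n -> k^o).
Let q0 i j : q i j != 0. Proof. by case: hq. Qed.

(** The scalar from moving X_i past the variables of smaller index in an ordered monomial of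
    exponent [b]; the shifts below are left multiplication on coefficient functions. *)
Definition twist (i : 'I_n) (b : lattice n) : k := \prod_(l < n | (l < i)%N) q i l ^ b l.
Lemma twist_neq0 i b : twist i b != 0.
Proof. by apply/prodf_neq0 => l _; exact: expfz_neq0. Qed.
Lemma twistD i a b : twist i (a + b) = twist i a * twist i b.
Proof.
by rewrite -big_split; apply: eq_bigr => l _; rewrite ffunE expfzDr.
Qed.
Lemma twist_basis i j : twist i (lbasis j) = if (j < i)%N then q i j else 1.
Proof.
case: ifP => hj.
  rewrite /twist (bigD1 j) //= ffunE eqxx expr1z big1 ?mulr1 // => l /andP[_ /negPf h].
  by rewrite ffunE h expr0z.
rewrite /twist big1 // => l hl; rewrite ffunE; case: eqP => // e.
by move: hl; rewrite e hj.
Qed.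

Lemma shift_lin (t : lattice n -> k) (e : lattice n) (c : k) (x y : W) :
  (fun b => t b * (c *: x + y) (b + e)) =
  c *: (fun b => t b * x (b + e) : k^o) + (fun b => t b * y (b + e)) :> W.
Proof. by apply/funext => b; rewrite /= mulrDr [RHS]/=; congr (_ + _); rewrite /= mulrCA. Qed.
Definition shift t e : endo k n := Endo (shift_lin t e).

Let Y i := shift (twist i) (- lbasis i).
Let Yi i := shift (fun b => (twist i (b + lbasis i))^-1) (lbasis i).

Lemma shift_rel : qtorus_rel q Y Yi.
Proof.
split=> [i|i j].
  split; apply: endoP => x b /=.
    by rewrite subrK mulrA mulfV ?mul1r // twist_neq0.
  by rewrite addrK mulrA mulVf ?mul1r // twist_neq0.
apply: endoP => x b /=.
have hN u v : twist u (b - lbasis v) = twist u b / twist u (lbasis v).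
  by apply: (mulIf (twist_neq0 u (lbasis v))); rewrite -twistD subrK mulfVK // twist_neq0.
have -> (f : W) : (q i j *: f) b = q i j * f b by [].
rewrite [b - lbasis j - lbasis i]addrAC !hN !twist_basis !mulrA.
congr (_ * _).
case: hq => _ [h1 hs].
case: (ltngtP i j) => [ij|ji|/val_inj ->].
- by rewrite hs invrK !divr1; ring.
- by rewrite divr1; field; exact: q0.
- by rewrite h1 !divr1 mul1r.
Qed.

Definition is_shift (a : lattice n) (f : endo k n) :=
  exists2 c : lattice n -> k, (forall b, c b != 0) &
    forall (x : W) b, ef f x b = c b * x (b - a).

Lemma is_shiftM a b f g : is_shift a f -> is_shift b g -> is_shift (a + b) (f * g).
Proof.
move=> [c c0 hc] [d d0 hd]; exists (fun e => c e * d (e - a)).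
  by move=> e; rewrite mulf_neq0.
by move=> x e; rewrite /= hc hd mulrA opprD addrA.
Qed.

Lemma is_shift1 : is_shift 0 1.
Proof. by exists (fun=> 1) => [b|x b]; rewrite ?oner_neq0 //= subr0 mul1r. Qed.

(** Up to nonvanishing weights a monomial acts as translation by its exponent, so distinct monomials
    move a point mass to distinct places. *)
Lemma qmon_shift a : is_shift a (qmon Y Yi a).
Proof.
have hp i z : is_shift (lbasis i *~ z) (xpow Y Yi i z).
  have hn f e m : is_shift e f -> is_shift (e *+ m) (f ^+ m).
    move=> he; elim: m => [|m IH]; first by rewrite mulr0n expr0; apply: is_shift1.
    by rewrite mulrS exprS; apply: is_shiftM.
  case: z => m /=; first by rewrite -pmulrn; apply: hn; exists (twist i) => // b; exact: twist_neq0.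
  rewrite NegzE mulrNz -pmulrn -mulNrn; apply: hn.
  exists (fun b => (twist i (b + lbasis i))^-1) => [b|x b]; first by rewrite invr_eq0 twist_neq0.
  by rewrite /= opprK.
have e : a = \sum_i lbasis i *~ a i.
  apply/ffunP => i; rewrite sum_ffunE (bigD1 i) //= big1 ?addr0 => [|j /negPf ne].
    by rewrite latMzE ffunE eqxx mul1r.
  by rewrite latMzE ffunE eq_sym ne mul0r.
rewrite {1}e /qmon; elim: (index_enum _) => [|i r IH]; first by rewrite !big_nil; apply: is_shift1.
by rewrite !big_cons; apply: is_shiftM.
Qed.

End ShiftRepresentation.

Section QuantumTorusBasis.
Variables (k : fieldType) (n : nat) (q : 'M[k]_n) (A : algType k) (X Xi : 'I_n -> A).
Hypothesis hq : mult_antisym q.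
Hypothesis hA : is_quantum_torus q X Xi.
Local Notation mon := (qmon X Xi).

Lemma hom_qmon (B : algType k) (f : A -> B) (Y Yi : 'I_n -> B) : is_alg_hom f ->
  (forall i, f (X i) = Y i /\ f (Xi i) = Yi i) -> forall a, f (mon a) = qmon Y Yi a.
Proof.
move=> [_ [fM f1]] fX a.
have fE x m : f (x ^+ m) = f x ^+ m.
  by elim: m => [|m IH]; rewrite ?expr0 // !exprS fM IH.
rewrite /qmon (big_morph f fM f1); apply: eq_bigr => i _.
by case: (fX i) => h1 h2; case: (a i) => m /=; rewrite fE ?h1 ?h2.
Qed.

Lemma qmon_basis i : mon (lbasis i) = X i.
Proof.
rewrite /qmon (big_only1 i) // => [|j /negPf ne _]; first by rewrite ffunE eqxx /= expr1.
by rewrite ffunE ne /= expr0.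
Qed.

Lemma qmon_basisN i : mon (- lbasis i) = Xi i.
Proof.
rewrite /qmon (big_only1 i) // => [|j /negPf ne _]; first by rewrite !ffunE eqxx /= expr1.
by rewrite !ffunE ne oppr0 /= expr0.
Qed.

(** The universal property maps the algebra into the span of the monomials; followed by the
    inclusion this map fixes the generators, so by uniqueness it is the identity. *)
Lemma qmon_span x : lspan (fun y => exists a, y = mon a) x.
Proof.
pose P := lspan (fun y => exists a, y = mon a).
have hP : lsubspace P := lspan_subspace _.
have ht := qtorus_mon hq hA.1.
have P1 : P 1 by apply: lspan_in; exists 0; rewrite (mon0 ht).
have PM u v : P u -> P v -> P (u * v).
  apply: lspan_mul => // _ _ [a ->] [b ->]; have [c c0 ->] := monM ht a b.
  by apply: (subZ _ hP); apply: lspan_in; exists (a + b).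
pose S := SubalgPred hP P1 PM.
pose Y i : (subalg S : algType k) := SubalgElt (S := S)
  (introT (asboolP _) (lspan_in (ex_intro _ _ (esym (qmon_basis i))) : P (X i))).
pose Yi i : (subalg S : algType k) := SubalgElt (S := S)
  (introT (asboolP _) (lspan_in (ex_intro _ _ (esym (qmon_basisN i))) : P (Xi i))).
have hY : qtorus_rel q Y Yi.
  have [[h1 h2] _] := hA; split=> [i|i j].
    by case: (h1 i) => e1 e2; split; apply: val_inj.
  by apply: val_inj; apply: h2.
have [f [fh fX _]] := hA.2 _ _ _ hY.
have [g [_ _ gu]] := hA.2 _ _ _ hA.1.
have idE : forall x : A, x = g x.
  by apply: (gu id) => //; split=> //; split.
have [l1 [l2 l3]] := fh; have [s1 [s2 s3]] := sa_val_hom S.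
have sfE : forall x : A, sa_val (f x) = g x.
  apply: (gu (fun x => sa_val (f x))).
    by split; [|split] => *; rewrite ?l1 ?l2 ?l3 ?s1 ?s2 ?s3.
  by move=> i; case: (fX i) => -> ->.
rewrite (idE x) -sfE; case: (f x) => y hy /=; exact/asboolP.
Qed.

(** The relation is applied to the point mass at 0 and read off at [a0], where only the monomial of
    [a0] contributes. *)
Lemma qmon_indep (s : seq (lattice n)) (c : lattice n -> k) : uniq s ->
  \sum_(a <- s) c a *: mon a = 0 -> forall a, a \in s -> c a = 0.
Proof.
move=> us hs a0 ha0.
have [f [fh fX _]] := hA.2 _ _ _ (shift_rel hq).
have fm := hom_qmon fh fX; have [l1 _] := fh.
have f0 : f 0 = 0.
  by have := l1 (-1) 0 0; rewrite scaler0 addr0 scaleN1r addNr.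
have fs : f (\sum_(a <- s) c a *: mon a) = \sum_(a <- s) c a *: f (mon a).
  elim: (s) => [|a r IH]; first by rewrite !big_nil.
  by rewrite !big_cons l1 IH.
have := congr1 (fun g => ef g (fun b => (b == 0)%:R) a0) fs; rewrite hs f0 /=.
have efs (r : seq (lattice n)) : ef (\sum_(a <- r) c a *: f (mon a)) (fun b => (b == 0)%:R) a0 =
    \sum_(a <- r) c a * ef (f (mon a)) (fun b => (b == 0)%:R) a0.
  by elim: r => [|a r IH]; rewrite ?big_nil // !big_cons /= -IH.
rewrite efs (bigD1_seq a0) //= big1_seq ?addr0; last first.
  move=> a /andP[ne ha]; rewrite fm; have [d d0 ->] := qmon_shift hq a.
  by rewrite subr_eq0 eq_sym (negPf ne) !mulr0.
rewrite fm; have [d d0 ->] := qmon_shift hq a0; rewrite subrr eqxx mulr1.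
by move/esym/eqP; rewrite mulf_eq0 (negPf (d0 _)) orbF => /eqP.
Qed.

End QuantumTorusBasis.

(** * Roots of unity and Krull dimension *)

Lemma dev_lt_mono (R : pzRingType) m (a b a' b' : R -> Prop) :
  (forall x, a x -> a' x) -> (forall x, b' x -> b x) -> dev_lt m a b -> dev_lt m a' b'.
Proof.
case: m => [|m] ha hb /= h; first by move=> x /hb/h/ha.
move=> c hc hc0 hcS hca; apply: h => // [x /hc0/hb //|i x /ha]; exact: hca.
Qed.

(** One coordinate is fixed at a time. In an interval containing the slab with the first t
    coordinates prescribed, the upsets cut off at height i in coordinate t form a descending chain,
    and each of its factors contains a slab with one more coordinate prescribed. *)
Lemma upset_dev_lower (R : pzRingType) n (F : (exps n -> Prop) -> R -> Prop) :
  (forall U, right_ideal (F U)) ->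
  (forall U U', (forall a, U a -> U' a) -> forall x, F U x -> F U' x) ->
  (forall U U' a, upset U' -> U a -> ~ U' a -> exists2 x, F U x & ~ F U' x) ->
  ~ dev_lt n (F (fun _ => False)) (F (fun _ => True)).
Proof.
move=> hF hmono hstrict.
suff h r t (s : exps n) U U' : (t + r = n)%N -> upset U -> upset U' ->
    (forall a, U' a -> U a) ->
    (forall a : exps n, (forall i : 'I_n, (i < t)%N -> a i = s i) -> U a /\ ~ U' a) ->
    ~ dev_lt r (F U') (F U).
  by apply: (h n 0%N (@e0 n)) => // a _; split.
elim: r t s U U' => [|r IH] t s U U' htr hU hU' hUU hc.
  have [Us Us'] := hc s (fun _ _ => erefl).
  by have [x hx nx] := hstrict U U' s hU' Us Us' => /(_ x hx).
have tn : (t < n)%N by lia.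
pose it := Ordinal tn.
pose W i a := U' a \/ U a /\ (i <= a it)%N.
move=> /(_ (fun i => F (W i))) [||i x|i x|N].
- by move=> i; apply: hF.
- by move=> x; apply: hmono => a [/hUU|[]].
- by apply: hmono => a [h|[h1 h2]]; [left|right; split=> //; exact: ltnW].
- by apply: hmono => a h; left.
move=> /(_ N (leqnn N)).
have hW i : upset (W i).
  move=> a b [h|[h1 h2]]; first by left; apply: hU'.
  by right; split; [apply: hU|rewrite ffunE (leq_trans h2) ?leq_addr].
apply: (IH t.+1 [ffun i => if i == it then N else s i]) => //.
- by lia.
- by move=> a [h|[h1 h2]]; [left|right; split=> //; exact: ltnW].
- move=> a ha; have et : a it = N by rewrite ha // ffunE eqxx.
  have [h1 h2] : U a /\ ~ U' a.
    apply: hc => i hi; rewrite ha ?ffunE; last exact: leq_trans hi _.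
    by case: eqP => // e; move: hi; rewrite e ltnn.
  split; first by right; rewrite et.
  by case=> // -[_]; rewrite et ltnn.
Qed.

Section AntiDifferences.
Variable R : zmodType.

(** Summation is a right inverse of the difference operator without any division, so the functions
    built from it exist in every characteristic. *)
Definition antidiff (f : int -> R) (z : int) : R :=
  match z with
  | Posz m => \sum_(i < m) f i%:Z
  | Negz m => - \sum_(i < m.+1) f (Negz i)
  end.

Lemma antidiffE f z : antidiff f (z + 1) - antidiff f z = f z.
Proof.
case: z => m; first by rewrite -PoszD addn1 /= big_ord_recr /= addrAC subrr add0r.
have -> : Negz m + 1 = - m%:Z by rewrite NegzE -addn1 PoszD opprD addrNK.
case: m => [|m]; first by rewrite oppr0 /= big_ord0 big_ord1 sub0r opprK.
by rewrite -NegzE /= opprK [\sum_(_ < m.+2) _]big_ord_recr /= addKr.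
Qed.

End AntiDifferences.

Section TorsionTorus.
Variables (k : fieldType) (n : nat) (q : 'M[k]_n) (A : algType k) (X Xi : 'I_n -> A).
Hypothesis hq : mult_antisym q.
Hypothesis hA : is_quantum_torus q X Xi.
Variable N : nat.
Hypothesis N0 : (0 < N)%N.
Hypothesis qN : forall i j, q i j ^+ N = 1.
Local Notation W := (lattice n -> k^o).

Definition diff1 (g : int -> k) z := g (z - N%:Z) - g z.

(* The step-[N] analogue of the binomial coefficients. *)
Definition sbin j (z : int) : k := iter j (@antidiff k) (fun=> 1) (- (z %/ N)%Z).

Lemma diff1_sbin j c : iter c diff1 (sbin j) = if (c <= j)%N then sbin (j - c) else fun=> 0.
Proof.
have d0 : diff1 (fun=> 0) = fun=> 0 by apply/funext => z; rewrite /diff1 subrr.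
have Nz : N%:Z != 0 by lia.
have dS m : diff1 (sbin m.+1) = sbin m.
  apply/funext => z; rewrite /diff1 /sbin.
  have -> : ((z - N%:Z) %/ N)%Z = (z %/ N)%Z - 1.
    by rewrite -[- N%:Z]mulN1r [z + _]addrC divzMDl // addrC.
  by rewrite opprD opprK iterS antidiffE.
elim: c => [|c IH]; first by rewrite subn0.
rewrite iterS IH; case: (ltngtP c j) => [cj|//|->].
  by rewrite -subnSK // dS.
by rewrite subnn; apply/funext => z; rewrite /diff1 /sbin /= subrr.
Qed.

Let f_ex : exists2 f : A -> endo k n, is_alg_hom f & forall i, f (X i) = shift (twist q i) (- lbasis i).
Proof. by have [f [h1 h2 _]] := hA.2 _ _ _ (shift_rel hq); exists f => // i; case: (h2 i). Qed.

Definition wprod (a : exps n) : A := \prod_i (X i ^+ N - 1) ^+ a i.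

Let qzN i j (z : int) : (q i j ^ z) ^+ N = 1.
Proof. by rewrite exprnP exprzAC -exprnP qN exp1rz. Qed.

Let central i x : (X i ^+ N - 1) * x = x * (X i ^+ N - 1).
Proof.
rewrite mulrBl mulrBr mul1r mulr1; congr (_ - _).
have ht := qtorus_mon hq hA.1.
have lN a b : qlam q a b ^+ N = 1.
  by rewrite /qlam -prodrXl big1 // => i' _; rewrite -prodrXl big1.
apply/esym; apply: (lspan_commute _ (qmon_span hq hA x)) => _ [b ->]; apply/esym.
suff -> m : X i ^+ m * qmon X Xi b = qlam q (lbasis i) b ^+ m *: (qmon X Xi b * X i ^+ m).
  by rewrite lN scale1r.
elim: m => [|m IH]; first by rewrite !expr0 scale1r mul1r mulr1.
have e : X i * qmon X Xi b = qlam q (lbasis i) b *: (qmon X Xi b * X i).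
  by have := monC ht (lbasis i) b; rewrite qmon_basis.
by rewrite exprS -mulrA IH -scalerAr !mulrA e -scalerAl scalerA -exprSr.
Qed.

Lemma wprod_central a x : wprod a * x = x * wprod a.
Proof.
rewrite /wprod; elim: (index_enum _) => [|i r IH]; first by rewrite !big_nil mul1r mulr1.
rewrite !big_cons -mulrA IH !mulrA; congr (_ * _).
elim: (a i) => [|m IHm]; first by rewrite !expr0 mul1r mulr1.
by rewrite exprS -mulrA IHm mulrA central -mulrA.
Qed.

Definition pfun (g : 'I_n -> int -> k) : W := fun x => \prod_l g l (x l).

(** The twist disappears in N-th powers, so X_i^N - 1 acts on a product of functions of one
    coordinate as the difference [diff1] in the i-th factor. *)
Let ef_wprod f a g : is_alg_hom f -> (forall i, f (X i) = shift (twist q i) (- lbasis i)) ->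
  ef (f (wprod a)) (pfun g) = pfun (fun l => iter (a l) diff1 (g l)).
Proof.
move=> [fl [fM f1]] fX.
have fXm i m : f (X i ^+ m) = f (X i) ^+ m.
  by elim: m => [|m IH]; rewrite ?expr0 // !exprS fM IH.
have fP i m : f ((X i ^+ N - 1) ^+ m) = f (X i ^+ N - 1) ^+ m.
  by elim: m => [|m IH]; rewrite ?expr0 // !exprS fM IH.
have fB x : f (x - 1) = f x - 1.
  by rewrite -[x - 1]addrC -scaleN1r fl f1 scaleN1r addrC.
have fY i m (v : W) b : ef (f (X i) ^+ m) v b = twist q i b ^+ m * v (b - lbasis i *+ m).
  elim: m b => [|m IH] b; first by rewrite !expr0 mulr0n subr0 mul1r.
  have tw : twist q i (b - lbasis i) = twist q i b.
    by rewrite -[in RHS](subrK (lbasis i) b) [RHS]twistD ?twist_basis ?ltnn ?mulr1.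
  by rewrite exprS /= fX /= -fX IH tw mulrA -exprS mulrS opprD addrA.
have fW i g' : ef (f (X i ^+ N - 1)) (pfun g') =
    pfun (fun l => if l == i then diff1 (g' l) else g' l).
  apply/funext => b; rewrite fB fXm.
  have -> : ef (f (X i) ^+ N - 1) (pfun g') b = ef (f (X i) ^+ N) (pfun g') b - pfun g' b.
    by rewrite /= scaleN1r.
  rewrite fY; have -> : twist q i b ^+ N = 1.
    by rewrite /twist -prodrXl big1.
  rewrite mul1r /pfun !(bigD1 i (P := predT)) //= eqxx.
  have e : \prod_(l | l != i) g' l ((b - lbasis i *+ N) l) = \prod_(l | l != i) g' l (b l).
    apply: eq_bigr => l /negPf ne; congr (g' l _).
    by rewrite pmulrn !ffunE latMzE ffunE ne mul0r subr0.
  rewrite e -mulrBl; congr (_ * _).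
    by rewrite /diff1 pmulrn !ffunE latMzE ffunE eqxx mul1r.
  by apply: eq_bigr => l /negPf ->.
have fWm i m g' : ef (f ((X i ^+ N - 1) ^+ m)) (pfun g') =
    pfun (fun l => if l == i then iter m diff1 (g' l) else g' l).
  elim: m => [|m IH].
    by rewrite expr0 f1; congr pfun; apply/funext => l; case: ifP.
  rewrite exprS fM /= IH fW; congr pfun; apply/funext => l.
  by case: ifP => // h; rewrite h.
have fr (r : seq 'I_n) : uniq r -> ef (f (\prod_(i <- r) (X i ^+ N - 1) ^+ a i)) (pfun g) =
    pfun (fun l => if l \in r then iter (a l) diff1 (g l) else g l).
  elim: r => [_|i r IH /= /andP[ir ur]]; first by rewrite big_nil f1.
  rewrite big_cons fM /= IH // fWm; congr pfun; apply/funext => l.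
  rewrite inE; case: eqP => [->|_] //=; by rewrite (negPf ir).
rewrite /wprod fr ?index_enum_uniq //; congr pfun; apply/funext => l.
by rewrite mem_index_enum.
Qed.

(** The ideal of an upset contains [wprod a] only if the upset contains a: the product of the
    functions sbin (a_l) is killed by [wprod b] as soon as b exceeds a somewhere, whereas [wprod a]
    sends it to 1. *)
Lemma torsion_deviation : ~ dev_lt n (fun x : A => x = 0) (fun _ => True).
Proof.
have [f fh fX] := f_ex; have [fl [fM f1]] := fh.
have f0 : f 0 = 0.
  by have := fl (-1) 0 0; rewrite scaler0 addr0 scaleN1r addNr.
pose F (U : exps n -> Prop) := lspan (fun y => exists a x, U a /\ y = wprod a * x).
have hF U : right_ideal (F U).
  split=> [|x y|x y hx]; first exact: (sub0 (lspan_subspace _)).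
    exact: (subD (lspan_subspace _)).
  apply: (lspan_le (S := fun x => F U (x * y)) _ _ hx).
    exact: (preim_mulr_subspace _ (lspan_subspace _)).
  by move=> _ [a [z [ha ->]]]; apply: lspan_in; exists a, (z * y); rewrite mulrA.
move=> h; apply: (@upset_dev_lower _ n F hF).
- by move=> U U' hUU x; apply: lspan_mono => _ [a [z [ha ->]]]; exists a, z; split=> //; apply: hUU.
- move=> U U' a hU' ha na; exists (wprod a).
    by apply: lspan_in; exists a, 1; rewrite mulr1.
  pose v := pfun (fun l => sbin (a l)).
  have kill x : F U' x -> ef (f x) v = 0.
    apply: (lspan_le (S := fun x => ef (f x) v = 0)).
      by split=> [|c y z]; rewrite ?f0 // fl /= => -> ->; rewrite scaler0 addr0.
    move=> _ [b [z [hb ->]]]; rewrite wprod_central fM /= ef_wprod //.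
    have [i hi] : exists i, ~~ (b i <= a i)%N.
      apply: contrapT => hno; apply: na; apply: (upset_ele hU' _ hb) => i.
      by apply: contrapT => /negP hi; apply: hno; exists i.
    suff -> : pfun (fun l => iter (b l) diff1 (sbin (a l))) = 0 by rewrite ef0.
    apply/funext => x0; rewrite /pfun (bigD1 i) //= diff1_sbin (negPf hi).
    by rewrite mul0r.
  move/kill; rewrite ef_wprod // => /(congr1 (fun g => g 0)).
  rewrite /pfun big1 => [|i _]; first by move/eqP; rewrite oner_eq0.
  by rewrite diff1_sbin leqnn subnn.
- apply: dev_lt_mono h => //.
  by move=> x ->; apply: (sub0 (lspan_subspace _)).
Qed.

End TorsionTorus.

From mathcomp Require Import classical_sets functions reals ereal topology
  normedtype sequences exp Rstruct lra.
Import Order.TTheory GRing.Theory Num.Theory.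

(** * Gelfand-Kirillov dimension *)

Section GrowthExponent.

Lemma gk_growth_le (d : nat -> nat) (D C : nat) :
  (forall m, (d m <= C * m.+1 ^ D)%N) -> (gk_growth d <= (D%:R : RR)%:E)%E.
Proof.
move=> hd; apply/lee_addgt0Pr => e e0.
(* [K] pays for the constant and for m + 1 <= 2 m; divided by ln m it is at most [e] once m >= exp
   (K / e). [C.+1] keeps the logarithm nonnegative. *)
pose K : RR := ln (C.+1%:R) + D%:R * ln 2.
have K0 : 0 <= K.
  by rewrite addr_ge0 ?mulr_ge0 ?ln_ge0 ?ler1n //.
pose M := maxn 2 (Num.bound (expR (K / e))).
rewrite /gk_growth /limn_esup /limf_esup.
apply: (@le_trans _ _ (ereal_sup ((fun m => ((ln (d m)%:R / ln m%:R : RR)%R)%:E) @`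
   [set m | (M <= m)%N]%classic))).
  by apply: ereal_inf_lbound; exists [set m | (M <= m)%N]%classic => //; exists M.
apply: ge_ereal_sup => _ [m /= hm <-]; rewrite -EFinD lee_fin.
have m2 : (2 <= m)%N by apply: leq_trans hm; rewrite leq_maxl.
have lnm : 0 < ln (m%:R : RR) by rewrite ln_gt0 // ltr1n.
have hK : K <= e * ln m%:R.
  rewrite mulrC -ler_pdivrMr // -[leLHS]expRK ler_ln ?posrE ?expR_gt0 ?ltr0n //; last by lia.
  have : expR (K / e) < (Num.bound (expR (K / e)))%:R by apply: archi_boundP; apply: expR_ge0.
  move/ltW/le_trans; apply; rewrite ler_nat; apply: leq_trans hm; exact: leq_maxr.
rewrite [leLHS]/= ler_pdivrMr // mulrDl.
apply: le_trans (lerD (lexx _) hK); rewrite /K addrCA -mulrDr.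
have [d0|d0] := posnP (d m).
  rewrite d0 ln0 // addr_ge0 ?ln_ge0 ?ler1n // mulr_ge0 // addr_ge0 ?ln_ge0 ?ler1n //; lia.
have -> : ln (C.+1%:R) + D%:R * (ln m%:R + ln 2) = ln ((C.+1 * (2 * m) ^ D)%N%:R : RR).
  have m0 : 0 < (m%:R : RR) by rewrite ltr0n; lia.
  have c0 : 0 < (C.+1%:R : RR) by rewrite ltr0n.
  rewrite natrM natrX natrM lnM ?posrE ?exprn_gt0 ?mulr_gt0 //.
  rewrite lnXn ?mulr_gt0 // lnM ?posrE // [ln m%:R + _]addrC.
  by rewrite -[(_ + _) *+ D]mulr_natl.
rewrite ler_ln ?posrE ?ltr0n //; last by rewrite muln_gt0 expn_gt0 /=; lia.
rewrite ler_nat; apply: leq_trans (hd m) _; apply: leq_mul => //.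
case: D {K K0 M hm hK hd} => [|D]; rewrite ?expn0 // leq_exp2r //; lia.
Qed.

Lemma gk_growth_ge (d : nat -> nat) (D : nat) :
  (forall m, (m.+1 ^ D <= d m)%N) -> ((D%:R : RR)%:E <= gk_growth d)%E.
Proof.
move=> hd; rewrite /gk_growth /limn_esup /limf_esup.
apply: le_ereal_inf_tmp => _ [V [M _ hV] <-].
pose m := maxn M 2.
have m2 : (2 <= m)%N by rewrite leq_maxr.
apply: (@le_trans _ _ ((ln (d m)%:R / ln m%:R : RR)%R)%:E); last first.
  by apply: ereal_sup_ubound; exists m => //; apply: hV; rewrite /= leq_maxl.
have lnm : 0 < ln (m%:R : RR) by rewrite ln_gt0 // ltr1n.
rewrite lee_fin ler_pdivlMr // mulr_natl -lnXn ?ltr0n; last by lia.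
have mD : (0 < m ^ D)%N by rewrite expn_gt0; lia.
have hmd : (m ^ D <= d m)%N.
  apply: leq_trans (hd m); case: D {hd mD} => [|D]; rewrite ?expn0 // leq_exp2r //; lia.
rewrite -natrX ler_ln ?posrE ?ltr0n ?ler_nat //; exact: leq_trans hmd.
Qed.

End GrowthExponent.

Lemma indep_inj (k : fieldType) (V : lmodType k) (I : finType) (u : I -> V) :
  indep (fun x => x = 0) u -> injective u.
Proof.
move=> hu i j e; apply/eqP; apply: contraT => ij.
have := hu (fun l => (l == i)%:R - (l == j)%:R) _ i.
rewrite eqxx (negPf ij) subr0 => h; suff : 1 = 0 :> k by move/eqP; rewrite oner_eq0.
apply: h; under eq_bigr do rewrite scalerBl.
rewrite sumrB (bigD1 i) //= eqxx scale1r big1 ?addr0 => [|l /negPf->]; last by rewrite scale0r.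
rewrite (bigD1 j) //= eqxx scale1r big1 ?addr0 => [|l /negPf->]; last by rewrite scale0r.
by rewrite e subrr.
Qed.

Lemma dimspan_ge_mem (k : fieldType) (V : lmodType k) (I : finType) (u : I -> V) (s : seq V) :
  indep (fun x => x = 0) u -> (forall i, u i \in s) -> (#|I| <= dimspan s)%N.
Proof.
move=> hu us; have hs i : (index (u i) s < size s)%N by rewrite index_mem.
have uE i : s`_(index (u i) s) = u i by rewrite nth_index.
apply: (@dimspan_ge _ _ _ s (fun i => Ordinal (hs i))).
  by move=> i j [] e; apply: (indep_inj hu); rewrite -uE e uE.
by move=> c; under eq_bigr do rewrite /= uE; apply: hu.
Qed.

Lemma indepZ (k : fieldType) (V : lmodType k) (I : finType) N (u u' : I -> V) :
  lsubspace N -> (forall i, exists2 c, c != 0 & u i = c *: u' i) -> indep N u' -> indep N u.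
Proof.
move=> hN h hu c hc i.
have /choice[d hd] j : exists d, d != 0 /\ u j = d *: u' j by case: (h j) => d; exists d.
apply: (mulIf (hd i).1); rewrite mul0r; apply: (hu (fun i => c i * d i)).
by under eq_bigr => j _ do rewrite -scalerA -(hd j).2.
Qed.

Section GelfandKirillov.
Variables (k : fieldType) (A : algType k) (n : nat).
Variables (mon : lattice n -> A) (lam : lattice n -> lattice n -> k).
Hypothesis ht : torus_mon mon lam.
Hypothesis hspan : forall x, lspan (fun y => exists a, y = mon a) x.

Local Notation box := (box mon).

Lemma box_mono M M' x : (M <= M')%N -> box M x -> box M' x.
Proof.
move=> h; apply: lspan_mono => _ [a ha ->]; exists a => // i; exact: leq_trans (ha i) h.
Qed.

Lemma boxM M M' x y : box M x -> box M' y -> box (M + M') (x * y).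
Proof.
apply: lspan_mul; first exact: lspan_subspace.
move=> _ _ [a ha ->] [b hb ->]; have [c c0 ->] := monM ht a b.
apply: (subZ _ (lspan_subspace _)); apply: lspan_in; exists (a + b) => // i.
have -> : (a + b) i = (a i + b i)%R :> int by rewrite ffunE.
by move: (a i) (b i) (ha i) (hb i) => u v; lia.
Qed.

Lemma box1 : box 0 1.
Proof. by apply: lspan_in; exists 0; rewrite ?(mon0 ht) // => i; rewrite ffunE. Qed.

Lemma box_seq (w : seq A) : exists M, forall x, x \in w -> box M x.
Proof.
elim: w => [|y w [M IH]]; first by exists 0%N.
have [M' hM'] := box_ex hspan y; exists (M + M')%N => x; rewrite inE => /orP[/eqP ->|/IH h].
  by apply: box_mono hM'; apply: leq_addl.
by apply: box_mono h; apply: leq_addr.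
Qed.

Lemma words_ind (w : seq A) (P : nat -> A -> Prop) : P 0%N 1 ->
  (forall m x y, P m x -> y \in 1 :: w -> P m.+1 (x * y)) ->
  forall m x, x \in words w m -> P m x.
Proof.
move=> P0 PS m x; rewrite /words => /mapP[t _ ->] {x}.
elim: m t => [|m IH] t; first by rewrite big_ord0.
rewrite big_ord_recr /=; apply: PS; last by apply: mem_nth; rewrite ltn_ord.
have := IH [ffun i => t (widen_ord (leqnSn m) i)].
by congr P; apply: eq_bigr => i _; rewrite ffunE.
Qed.

Lemma words_box (w : seq A) s : (forall x, x \in w -> box s x) ->
  forall m x, x \in words w m -> box (s * m) x.
Proof.
move=> hs m x; apply: (@words_ind w (fun m x => box (s * m) x)); first by rewrite muln0; apply: box1.
move=> {}m {}x y hx; rewrite inE mulnSr => hy; apply: boxM => //.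
case/orP: hy => [/eqP ->|/hs //]; exact: box_mono box1.
Qed.

Definition unit_box (E : exps n -> lattice n) : seq A :=
  [seq mon (E (emb b)) | b : {ffun 'I_n -> 'I_2}].

(** An exponent with entries at most m is a sum of m vectors of zeros and ones, the i-th marking the
    coordinates that exceed i; so the cube of side m is reached in m steps. *)
Lemma unit_box_words (E : exps n -> lattice n) m (a : exps n) :
  (forall a b, E (eadd a b) = E a + E b) -> (forall i, a i <= m)%N ->
  exists2 x, x \in words (unit_box E) m & exists2 c, c != 0 & x = c *: mon (E a).
Proof.
move=> hE ha.
pose b (i : 'I_m) : {ffun 'I_n -> 'I_2} := [ffun l => inord (i < a l)%N].
have hb i : mon (E (emb (b i))) \in unit_box E by apply/mapP; exists (b i); rewrite ?mem_enum.
have hi i : ((index (mon (E (emb (b i)))) (unit_box E)).+1 < (size (unit_box E)).+1)%N.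
  by rewrite ltnS index_mem.
pose t : {ffun 'I_m -> 'I_(size (unit_box E)).+1} := [ffun i => Ordinal (hi i)].
exists (\prod_(i < m) (1 :: unit_box E)`_(t i)).
  by apply/mapP; exists t; rewrite ?mem_enum.
have -> : \prod_(i < m) (1 :: unit_box E)`_(t i) = \prod_(i < m) mon (E (emb (b i))).
  by apply: eq_bigr => i _; rewrite ffunE /= nth_index.
have E0 : E (@e0 n) = 0 by apply: (addrI (E (@e0 n))); rewrite -hE eadd0 addr0.
have ea : a = [ffun l => \sum_(i < m) (i < a l)]%N.
  apply/ffunP => l; rewrite ffunE -[LHS]card_ord -sum1_card.
  rewrite (big_ord_widen m (fun=> 1%N) (ha l)) big_mkcond /=.
  by apply: eq_bigr => i _; case: ifP.
pose cnt (r : seq 'I_m) : exps n := [ffun l => (\sum_(j <- r) (nat_of_ord j < a l))%N].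
suff h (r : seq 'I_m) : exists2 c, c != 0 &
    \prod_(i <- r) mon (E (emb (b i))) = c *: mon (E (cnt r)).
  by have [c c0 e] := h (index_enum _); exists c => //; rewrite {1}ea.
elim: r => [|i r [c c0 IH]].
  exists 1; rewrite ?oner_neq0 // big_nil scale1r.
  have -> : cnt [::] = @e0 n by apply/ffunP => l; rewrite !ffunE big_nil.
  by rewrite E0 (mon0 ht).
rewrite big_cons IH -scalerAr.
have [d d0 ->] := monM ht (E (emb (b i))) (E (cnt r)).
exists (c * d); first by rewrite mulf_neq0.
rewrite scalerA -hE; congr (_ *: mon (E _)); apply/ffunP => l.
by rewrite !ffunE big_cons inordK //; case: (i < a l)%N.
Qed.

Definition box_embed M (b : {ffun 'I_n -> 'I_(2 * M).+1}) : lattice n :=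
  [ffun i => (b i)%:Z - M%:Z].

Lemma box_embed_onto M (a : lattice n) : (forall i, `|a i| <= M)%N ->
  exists b : {ffun 'I_n -> 'I_(2 * M).+1}, box_embed b = a.
Proof.
move=> ha; exists [ffun i => inord (absz (a i + M%:Z))].
apply/ffunP => i; rewrite !ffunE; move: (a i) (ha i) => x hx.
by rewrite inordK; lia.
Qed.

Lemma box_pow s m d : ((2 * (s * m)).+1 ^ d <= (2 * s).+1 ^ d * m.+1 ^ d)%N.
Proof.
rewrite -expnMn; case: d => [|d]; rewrite ?expn0 // leq_exp2r //; nia.
Qed.

Lemma GKdim_sub_ge (P : set A) (E : exps n -> lattice n) d :
  (forall a b, E (eadd a b) = E a + E b) -> (forall a, P (mon (E a))) ->
  (forall M, exists (J : finType) (f : J -> exps n), [/\ (M.+1 ^ d <= #|J|)%N,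
     (forall j i, f j i <= M)%N & indep (fun x => x = 0) (fun j => mon (E (f j)))]) ->
  ((d%:R : RR)%:E <= GKdim_sub P)%E.
Proof.
move=> hE hP hg.
apply: (@le_trans _ _ (gk_growth (fun m => dimspan (words (unit_box E) m)))); last first.
  apply: ereal_sup_ubound; exists (unit_box E); split=> // x; rewrite /unit_box => /mapP[b _ ->]; exact: hP.
apply: gk_growth_ge => m; have [J [f [hJ hf hi]]] := hg m; apply: leq_trans hJ _.
have /choice[u hu] j : exists u, u \in words (unit_box E) m /\
    exists2 c, c != 0 & u = c *: mon (E (f j)).
  by have [x hx1 hx2] := unit_box_words hE (hf j); exists x.
apply: (dimspan_ge_mem (u := u)); last by move=> j; case: (hu j).
by apply: (indepZ (subspace_eq0 _) _ hi) => j; case: (hu j).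
Qed.

Lemma GKdim_alg_le : (GKdim_alg A <= (n%:R : RR)%:E)%E.
Proof.
apply: ge_ereal_sup => _ [w [_ ->]]; have [s hs] := box_seq w.
apply: (@gk_growth_le _ _ ((2 * s).+1 ^ n)) => m; apply: leq_trans _ (box_pow s m n).
have -> : ((2 * (s * m)).+1 ^ n = #|{ffun 'I_n -> 'I_(2 * (s * m)).+1}|)%N.
  by rewrite card_ffun !card_ord.
apply: (@dimspan_le _ _ _ (fun b => mon (box_embed b))) => x /(words_box hs).
by apply: lspan_mono => _ [a /box_embed_onto[b <-] ->]; exists b.
Qed.

Hypothesis hindep : forall (s : seq (lattice n)) (c : lattice n -> k), uniq s ->
  \sum_(a <- s) c a *: mon a = 0 -> forall a, a \in s -> c a = 0.

Lemma mon_indep (J : finType) (f : J -> lattice n) : injective f ->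
  indep (fun x => x = 0) (fun j => mon (f j)).
Proof.
move=> finj c hc j.
pose d a := if [pick j | f j == a] is Some j then c j else 0.
have dE i : d (f i) = c i.
  by rewrite /d; case: pickP => [i' /eqP/finj->//|/(_ i)]; rewrite eqxx.
rewrite -dE; apply: (hindep (s := [seq f j | j <- index_enum J])).
- by rewrite map_inj_uniq // index_enum_uniq.
- by rewrite big_map; under eq_bigr do rewrite dE.
- by apply: map_f; apply: mem_index_enum.
Qed.

Lemma GKdim_algE : GKdim_alg A = (n%:R : RR)%:E.
Proof.
apply/eqP; rewrite eq_le GKdim_alg_le /=.
apply: (@GKdim_sub_ge _ (@epos n predT)); [exact: eposD|by []|].
move=> M; exists {ffun 'I_n -> 'I_M.+1}, (@emb n M); split.
- by rewrite card_ffun !card_ord.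
- exact: emb_le.
apply: mon_indep => b b' /ffunP e; apply: emb_inj; apply/ffunP => i.
by have := e i; rewrite [LHS]ffunE [RHS]ffunE => -[].
Qed.

Lemma center_monomials M z : alg_center A z -> box M z ->
  lspan (fun x => exists a : lattice n, [/\ (forall i, `|a i| <= M)%N, (forall b, lam a b = 1) &
    x = mon a]) z.
Proof.
move=> hz hb.
have hY (a : lattice n) : lsubspace (fun y => exists c, y = c *: mon a).
  split=> [|c x y [d ->] [e ->]]; first by exists 0; rewrite scale0r.
  by exists (c * d + e); rewrite scalerDl scalerA.
pose small (a : lattice n) := forall i, (`|a i| <= M)%N.
have hz' : lspanm (fun x : A => x = 0)
    (fun x => exists a, small a /\ exists c, x = c *: mon a) z.
  apply: lspan_mono hb => _ [a ha ->]; right; exists a; split=> //.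
  by exists 1; rewrite scale1r.
have [s [y [us hs hy hsz]]] := lspanm_seq (subspace_eq0 _) hY hz'.
have /choice[c hc] a : exists c, a \in s -> y a = c *: mon a.
  by have [/hy[c e]|] := boolP (a \in s); [exists c|exists 0].
have ez : z = \sum_(a <- s) c a *: mon a.
  by apply/eqP; rewrite -subr_eq0; apply/eqP; rewrite -[RHS]hsz; congr (_ - _); apply: eq_big_seq => a /hc.
rewrite ez big_seq; apply: (sub_sum _ (lspan_subspace _)) => a ha.
have [->|ca] := eqVneq (c a) 0; first by rewrite scale0r; apply: (sub0 (lspan_subspace _)).
apply: (subZ _ (lspan_subspace _)); apply: lspan_in; exists a; split=> //; first exact: hs.
move=> b.
have /choice[d hd] a' : exists d, d != 0 /\ mon b * mon a' = d *: mon (b + a').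
  by have [d] := monM ht b a'; exists d.
have : \sum_(x <- [seq b + a | a <- s]) (c (x - b) * (lam (x - b) b - 1) * d (x - b)) *: mon x = 0.
  rewrite big_map; have := hz (mon b); move/eqP; rewrite -subr_eq0 ez mulr_suml mulr_sumr -sumrB.
  move/eqP => e; rewrite -[RHS]e; apply: eq_bigr => a' _.
  have -> : b + a' - b = a' by rewrite addrC addKr.
  rewrite -scalerA -(hd a').2 -scalerAl -scalerAr (monC ht a' b) scalerA -scalerBl.
  by rewrite mulrBr mulr1.
move/hindep => /(_ _ (b + a)) h.
have : c a * (lam a b - 1) * d a = 0.
  have -> : a = b + a - b by rewrite addrC addKr.
  apply: h; last exact: map_f.
  by rewrite map_inj_uniq // => x x'; apply: addrI.
by move/eqP; rewrite !mulf_eq0 (negPf ca) (negPf (hd a).1) orbF /= subr_eq0 => /eqP.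
Qed.

(** The coordinates in [S] determine a central monomial, so a box contains at most as many of them
    as there are points in its projection to [S]. *)
Lemma GKdim_center_le (S : {set 'I_n}) :
  (forall a : lattice n, (forall b, lam a b = 1) -> (forall i, i \in S -> a i = 0) -> a = 0) ->
  (GKdim_sub (alg_center A) <= (#|S|%:R : RR)%:E)%E.
Proof.
move=> hS; apply: ge_ereal_sup => _ [w [hw ->]]; have [s hs] := box_seq w.
apply: (@gk_growth_le _ _ ((2 * s).+1 ^ #|S|)) => m; apply: leq_trans _ (box_pow s m #|S|).
set M := (s * m)%N; pose J := {ffun {i : 'I_n | i \in S} -> 'I_(2 * M).+1}.
have -> : ((2 * M).+1 ^ #|S| = #|J|)%N by rewrite card_ffun card_ord card_sig.
have /choice[g hg] (j : J) : exists a : lattice n, (exists a : lattice n, (forall b, lam a b = 1) /\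
     forall i, a (val i) = (j i)%:Z - M%:Z) ->
   (forall b, lam a b = 1) /\ forall i, a (val i) = (j i)%:Z - M%:Z.
  have [[a ha]|h] := pselect (exists a : lattice n, (forall b, lam a b = 1) /\
     forall i : {i : 'I_n | i \in S}, a (val i) = (j i)%:Z - M%:Z); first by exists a.
  by exists 0 => h'; case: h.
apply: (@dimspan_le _ _ _ (fun j => mon (g j))) => x hx.
have hxc : alg_center A x.
  apply: (words_ind (P := fun _ x => alg_center A x) _ _ hx) => [a|m' x' y hx' hy a].
    by rewrite mul1r mulr1.
  rewrite -mulrA; have -> : y * a = a * y.
    by move: hy; rewrite inE => /orP[/eqP ->|/hw/(_ a)//]; rewrite mul1r mulr1.
  by rewrite !mulrA hx'.
have := center_monomials hxc (words_box hs hx).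
apply: lspan_mono => _ [a [ha hl ->]].
have [b eb] := box_embed_onto ha.
pose j : J := [ffun i => b (val i)].
have hj i : a (val i) = (j i)%:Z - M%:Z by rewrite -eb !ffunE.
exists j; congr mon; apply/eqP; rewrite -subr_eq0; apply/eqP.
have [h1 h2] := hg j (ex_intro _ a (conj hl hj)).
apply: hS => [b'|i hi]; first by rewrite (lamDl ht) (lamNl ht) hl h1 mul1r invr1.
have := h2 (Sub i hi); rewrite !ffunE /= => ->.
by have := hj (Sub i hi); rewrite /= => ->; rewrite ffunE subrr.
Qed.

Variables (V : lmodType k) (act : A -> V -> V).
Hypothesis hact : is_left_module act.

Lemma GKdim_mod_ge (E : exps n -> lattice n) v d :
  (forall a b, E (eadd a b) = E a + E b) ->
  (forall M, exists (J : finType) (f : J -> exps n), [/\ (M.+1 ^ d <= #|J|)%N,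
     (forall j i, f j i <= M)%N & indep (fun x => x = 0) (fun j => act (mon (E (f j))) v)]) ->
  ((d%:R : RR)%:E <= GKdim_mod act)%E.
Proof.
move=> hE hg.
apply: (@le_trans _ _ (gk_growth (fun m =>
  dimspan [seq act a u | a <- words (unit_box E) m, u <- [:: v]]))); last first.
  by apply: ereal_sup_ubound; exists (unit_box E), [:: v].
apply: gk_growth_ge => m; have [J [f [hJ hf hi]]] := hg m; apply: leq_trans hJ _.
have /choice[u hu] j : exists u, u \in words (unit_box E) m /\
    exists2 c, c != 0 & u = c *: mon (E (f j)).
  by have [x hx1 hx2] := unit_box_words hE (hf j); exists x.
apply: (dimspan_ge_mem (u := fun j => act (u j) v)).
  apply: (indepZ (subspace_eq0 _) _ hi).
  by move=> j; case: (hu j) => _ [c c0 ->]; exists c => //; rewrite (actZl hact).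
by move=> j; apply: allpairs_f; [case: (hu j)|rewrite mem_head].
Qed.

Lemma GKdim_mod_le v C d : (forall x, exists g, x = act g v) ->
  (forall M, exists (J : finType) (w : J -> V), (#|J| <= C * M.+1 ^ d)%N /\
    forall a : lattice n, (forall i, `|a i| <= M)%N ->
      lspan (fun y => exists j, y = w j) (act (mon a) v)) ->
  (GKdim_mod act <= (d%:R : RR)%:E)%E.
Proof.
move=> hcyc hg; apply: ge_ereal_sup => _ [w [f ->]]; have [s hs] := box_seq w.
have [s0 hs0] : exists s0, forall x, x \in f -> exists2 g, box s0 g & x = act g v.
  elim: f => [|y f [M IH]]; first by exists 0%N.
  have [g hgy] := hcyc y; have [M' hM'] := box_ex hspan g.
  exists (M + M')%N => x; rewrite inE => /orP[/eqP ->|/IH[g' h ->]].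
    by exists g => //; apply: box_mono hM'; apply: leq_addl.
  by exists g' => //; apply: box_mono h; apply: leq_addr.
apply: (@gk_growth_le _ _ (C * (s + s0).+1 ^ d)) => m.
have [J [u [hJ hu]]] := hg (s * m + s0)%N.
apply: (@leq_trans #|J|); last first.
  apply: leq_trans hJ _; rewrite -mulnA leq_mul2l -expnMn; apply/orP; right.
  have h : ((s * m + s0).+1 <= (s + s0).+1 * m.+1)%N by nia.
  by case: (d) => [|e]; rewrite ?expn0 ?leq_exp2r.
apply: (@dimspan_le _ _ _ u) => _ /allpairsP[[a x] /= [ha /hs0[g hgb ->] ->]].
rewrite -(actM hact); have := boxM (words_box hs ha) hgb.
apply: (lspan_le (S := fun f => lspan _ (act f v))).
  exact: (preiml_subspace hact v (lspan_subspace _)).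
by move=> _ [b hb ->]; apply: hu.
Qed.

End GelfandKirillov.

(** * Passing to a sublattice of finite index *)

Lemma basis_exists (k : fieldType) (V : lmodType k) (S : V -> Prop) B :
  lsubspace S ->
  (forall (I : finType) (u : I -> V), indep (fun x => x = 0) u -> (forall i, S (u i)) ->
    (#|I| <= B)%N) ->
  exists (J : finType) (w : J -> V), (#|J| <= B)%N /\
    forall x, S x -> lspan (fun y => exists j, y = w j) x.
Proof.
move=> hS hB.
pose Q m := exists2 u : 'I_m -> V, indep (fun x => x = 0) u & forall i, S (u i).
have exQ : exists m, `[< Q m >].
  by exists 0%N; apply/asboolP; exists (fun=> 0) => [c _|] [].
have bQ m : `[< Q m >] -> (m <= B)%N.
  by move/asboolP => [u hu hS']; have := hB _ u hu hS'; rewrite card_ord.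
case: (ex_maxnP exQ bQ) => m /asboolP[u hu hSu] hmax.
exists 'I_m, u; split; first by rewrite card_ord; apply: bQ; apply/asboolP; exists u.
move=> x hx; apply: contrapT => nx.
pose u' (i : 'I_m.+1) := if unlift ord0 i is Some j then u j else x.
suff /hmax : `[< Q m.+1 >] by rewrite ltnn.
apply/asboolP; exists u'; last by move=> i; rewrite /u'; case: unlift.
move=> c; rewrite big_ord_recl /u' unlift_none => hc.
have hc' : c ord0 *: x + \sum_(i < m) c (lift ord0 i) *: u i = 0.
  by rewrite -[RHS]hc; congr (_ + _); apply: eq_bigr => i _; rewrite liftK.
have c0 : c ord0 = 0.
  apply/eqP; apply: contrapT => /negP c0; apply: nx.
  apply: (subZ_inv (lspan_subspace _) c0).
  have -> : c ord0 *: x = - \sum_(i < m) c (lift ord0 i) *: u i.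
    by apply/eqP; rewrite -addr_eq0 hc'.
  apply: (subN (lspan_subspace _)); apply: (sub_sum _ (lspan_subspace _)) => i _.
  by apply: (subZ _ (lspan_subspace _)); apply: lspan_in; exists i.
move=> i; case: (unliftP ord0 i) => [j ->|-> //].
by apply: (hu (fun j => c (lift ord0 j))); rewrite -[RHS]hc' c0 scale0r add0r.
Qed.

Section FiniteIndex.
Variables (k : fieldType) (A : algType k) (n : nat).
Variables (mon : lattice n -> A) (lam : lattice n -> lattice n -> k).
Hypothesis ht : torus_mon mon lam.
Hypothesis hspan : forall x, lspan (fun y => exists a, y = mon a) x.
Variables (V : lmodType k) (act : A -> V -> V).
Hypothesis hact : is_left_module act.
Hypothesis hsimple : simple_module act.
Local Notation op a := (act (mon a)).

Variable b : 'I_n -> lattice n.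
Definition sublat (be : lattice n) : lattice n := \sum_i b i *~ be i.

Lemma sublatD x y : sublat (x + y) = sublat x + sublat y.
Proof. by rewrite -big_split; apply: eq_bigr => i _; rewrite ffunE mulrzDr. Qed.
Lemma sublat0 : sublat 0 = 0.
Proof. by apply: (addrI (sublat 0)); rewrite -sublatD !addr0. Qed.
Lemma sublatMz x z : sublat (x *~ z) = sublat x *~ z.
Proof.
rewrite /sublat mulrz_suml; apply: eq_bigr => i _.
by rewrite latMzE -mulrzA.
Qed.
Lemma sublat_sum (I : Type) (r : seq I) (F : I -> lattice n) :
  sublat (\sum_(i <- r) F i) = \sum_(i <- r) sublat (F i).
Proof. exact: (big_morph _ sublatD sublat0). Qed.

Let mon' be := mon (sublat be).
Let lam' x y := lam (sublat x) (sublat y).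

Lemma sublat_torus : torus_mon mon' lam'.
Proof.
split.
- by rewrite /mon' sublat0 (mon0 ht).
- by move=> x y; rewrite /mon' sublatD; apply: monM ht _ _.
- by move=> x y; apply: (monC ht).
- by move=> x y; apply: (lam_neq0 ht).
- by move=> x y z; rewrite /lam' sublatD (lamDl ht).
- by move=> x y z; rewrite /lam' sublatD (lamDr ht).
Qed.
Let ht' := sublat_torus.

Variable Ni : nat.
Hypothesis Ni0 : (0 < Ni)%N.
Hypothesis hfin : forall i, exists g, lbasis i *~ Ni%:Z = sublat g.

Lemma lattice_basis (a : lattice n) : a = \sum_i lbasis i *~ a i.
Proof.
apply/ffunP => i; rewrite sum_ffunE (bigD1 i) //= big1 ?addr0 => [|j /negPf ne].
  by rewrite latMzE ffunE eqxx mul1r.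
by rewrite latMzE ffunE eq_sym ne mul0r.
Qed.

(** Representatives modulo Ni times the lattice, which lies in the sublattice; the form of the index
    type makes it visibly nonempty. *)
Let Rep := {ffun 'I_n -> 'I_Ni.-1.+1}.
Let rep (r : Rep) : lattice n := epos predT (emb r).

(** Each coordinate is divided by Ni with remainder, and the quotients are expressed in the
    sublattice with a linear bound by the entries of the [g i]. *)
Let decompose : exists K, forall (a : lattice n) M, (forall i, `|a i| <= M)%N ->
  exists r be, a = sublat be + rep r /\ forall i, (`|be i| <= K * M)%N.
Proof.
have /choice[g hg] := hfin.
exists (\sum_i \sum_l `|g i l|)%N => a M ha.
exists [ffun i => inord (absz (a i %% Ni)%Z)], (\sum_i g i *~ (a i %/ Ni)%Z).
have Nz : Ni%:Z != 0 by lia.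
split.
  rewrite sublat_sum {1}(lattice_basis a).
  have -> : rep [ffun i => inord (absz (a i %% Ni)%Z)] = \sum_i lbasis i *~ (a i %% Ni)%Z.
    rewrite [LHS]lattice_basis; apply: eq_bigr => i _; congr (_ *~ _).
    rewrite !ffunE /= inordK ?gez0_abs ?modz_ge0 //.
    by rewrite prednK // -ltz_nat gez0_abs ?modz_ge0 // ltz_mod.
  rewrite -big_split; apply: eq_bigr => i _ /=.
  by rewrite sublatMz -hg -mulrzA mulrC -mulrzDr -divz_eq.
move=> l; rewrite sum_ffunE.
have hq i : (`|(a i %/ Ni)%Z| <= M)%N.
  apply: leq_trans (ha i); move: (a i) => z; have := divz_eq z Ni.
  have := modz_ge0 z Nz; have := ltz_mod z Nz; nia.
apply: (@leq_trans (\sum_i `|g i l| * M)%N).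
  elim/big_ind2: _ => // [x1 x2 y1 y2 h1 h2|i _].
    by apply: leq_trans (leq_add h1 h2); lia.
  rewrite latMzE abszM; exact: leq_mul.
rewrite -big_distrl /= leq_mul2r; apply/orP; right; apply: leq_sum => i _.
by rewrite (bigD1 l) //= leq_addr.
Qed.

Let v0_ex : exists v0 : V, v0 != 0. Proof. by case: hsimple. Qed.

Let submod_stable S : lsubspace S -> (forall a x, S x -> S (op a x)) -> is_submodule act S.
Proof.
move=> hS h; split; first exact: sub0.
  by move=> x y; apply: subD.
move=> f x hx; apply: (lspan_le (S := fun f => S (act f x)) _ _ (hspan f)).
  exact: (preiml_subspace hact x hS).
by move=> _ [a ->]; apply: h.
Qed.

Let cyclicA v x : v != 0 -> exists g, x = act g v.
Proof.
move=> v0.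
have [] := hsimple.2 (fun x => exists g, x = act g v).
- split; first by exists 0; rewrite (act0l hact).
    by move=> y z [g ->] [h ->]; exists (g + h); rewrite (actDl hact).
  by move=> f y [g ->]; exists (f * g); rewrite (actM hact).
- move=> h; have e : v = 0 by apply: h; exists 1; rewrite (act1 hact).
  by rewrite e eqxx in v0.
- exact.
Qed.

Let span_reps v0 S : v0 != 0 -> stable mon' act S -> (forall r, S (op (rep r) v0)) ->
  forall x, S x.
Proof.
move=> nv0 [hS hs] hr x; have [g ->] := cyclicA x nv0.
apply: (lspan_le (S := fun f => S (act f v0)) _ _ (hspan g)).
  exact: (preiml_subspace hact v0 hS).
move=> _ [a ->]; have [K hK] := decompose.
have [r [be [-> _]]] := hK a (\max_i `|a i|)%N (fun i => leq_bigmax (F := fun i => `|a i|%N) i).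
have [c c0 e] := opM ht hact (sublat be) (rep r).
apply: (subZ_inv hS c0); rewrite -e; exact: hs.
Qed.

(** V is generated over the sublattice by the finitely many vectors op (rep r) v0, so properness
    passes to unions of chains and Zorn's lemma applies. *)
Let maximal_exists : exists N, [/\ stable mon' act N, (exists v, ~ N v) &
  forall N', stable mon' act N' -> (forall x, N x -> N' x) ->
    (forall x, N' x -> N x) \/ (forall x, N' x)].
Proof.
have [v0 nv0] := v0_ex.
pose P (S : set V) := [/\ (forall (c : k) x y, S x -> S y -> S (c *: x + y)),
  (forall be x, S x -> S (act (mon' be) x)) & exists r, ~ S (op (rep r) v0)].
have [F FP Ftot|S [[h1 h2 [r hr]] hmax]] := Zorn_bigcup (P := P).
  split.
  - move=> c x y [X FX Xx] [Y FY Yy]; have [XY|YX] := Ftot _ _ FX FY.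
      by exists Y => //; have [h _ _] := FP _ FY; apply: h => //; apply: XY.
    by exists X => //; have [h _ _] := FP _ FX; apply: h => //; apply: YX.
  - by move=> be x [X FX Xx]; exists X => //; have [_ h _] := FP _ FX; apply: h.
  - apply: contrapT => hno.
    have hall r : (\bigcup_(X in F) X)%classic (op (rep r) v0).
      by apply: contrapT => h; apply: hno; exists r.
    suff [X FX hX] : exists2 X, F X & forall r, r \in enum Rep -> X (op (rep r) v0).
      by have [_ _ [r]] := FP _ FX; case; apply: hX; rewrite mem_enum.
    elim: (enum Rep) => [|r s [X FX hX]].
      by have [X FX _] := hall [ffun=> ord0]; exists X.
    have [Y FY hY] := hall r; have [XY|YX] := Ftot _ _ FX FY.
      by exists Y => // r'; rewrite inE => /orP[/eqP ->//|/hX/XY].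
    by exists X => // r'; rewrite inE => /orP[/eqP ->|/hX//]; apply: YX.
have nz r' : op (rep r') v0 <> 0.
  have [c c0] := opM ht hact (- rep r') (rep r').
  rewrite addNr => /(_ v0) e h; move: e; rewrite h (act0 hact) (op0 ht hact).
  by move/esym/eqP; rewrite scaler_eq0 (negPf c0) (negPf nv0).
(* [P] does not ask for 0 and so covers the union of an empty chain; a maximal element is not empty
   because the zero subspace satisfies [P]. *)
have S0 : S 0.
  apply: contrapT => nS0; apply: (hmax [set 0]%classic).
    split; last by move/(_ 0 erefl).
    move=> x Sx; exfalso; apply: nS0; rewrite -(scale0r x) -[X in S X]addr0.
    have := h1 (-1) x x Sx Sx; by rewrite scaleN1r addNr scale0r addr0.
  split; last by exists r; apply: nz.
    by move=> c x y -> ->; rewrite scaler0 addr0.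
  by move=> be x ->; rewrite (act0 hact).
have hS : lsubspace S by split.
exists S; split; [by split|by exists (op (rep r) v0)|].
move=> N' hN' SN'.
have [hall|hall] := pselect (forall r, N' (op (rep r) v0)).
  by right; apply: span_reps hall.
left; apply: contrapT => hne; apply: (hmax N').
  by split=> //.
split; [exact: hN'.1.2|exact: hN'.2|].
by apply: contrapT => h; apply: hall => r'; apply: contrapT => h'; apply: h; exists r'.
Qed.

Variables (i0 : 'I_n) (I : {set 'I_n}).
Hypothesis i0I : i0 \notin I.
Hypothesis hcomm : forall x y : lattice n, x i0 = 0 -> y i0 = 0 -> lam' x y = 1.
Hypothesis hY : forall x : lattice n, (forall i, i \notin I -> x i = 0) ->
  lam' (lbasis i0) x = 1 -> x = 0.
Hypothesis hZ : forall x : lattice n, (forall i, i \in i0 |: I -> x i = 0) ->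
  lam' (lbasis i0) x = 1.

(* [V] embeds into the product of the finitely many twists of [V / N]. *)
Let core N x : stable mon' act N -> (exists v, ~ N v) ->
  (forall r, N (op (rep r) x)) -> x = 0.
Proof.
move=> [hN hs] [v nv] hx.
have [] := hsimple.2 (fun x => forall a, N (op a x)).
- apply: submod_stable.
    split=> [a|c y z hy hz a]; rewrite ?(act0 hact) ?(actP hact); first exact: sub0.
    exact: hN.2.
  move=> a y hy a'; have [c c0 ->] := opM ht hact a' a; exact: (subZ _ hN).
- apply => a; have [K hK] := decompose.
  have [r [be [-> _]]] := hK a (\max_i `|a i|)%N (fun i => leq_bigmax (F := fun i => `|a i|%N) i).
  have [c c0 e] := opM ht hact (sublat be) (rep r).
  by apply: (subZ_inv hN c0); rewrite -e; apply: hs.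
- by move=> h; case: nv; rewrite -(op0 ht hact v).
Qed.

(** Families independent modulo [N] are independent, which gives the lower bound. For the upper
    bound x is sent to the family of all op (rep r) x modulo [N]; this is injective by [core], so
    dimensions grow by constant factors only. *)
Lemma finite_index_GKdim : exists2 d, d = 1%N \/ d = #|I| &
  GKdim_mod act = (d%:R : RR)%:E.
Proof.
have [N [hN hne hmax]] := maximal_exists.
have [v nv [C [d hd [hle hge]]]] := simple_torus_growth ht' hact hN hne hmax i0I hcomm hY hZ.
exists d => //; apply/eqP; rewrite eq_le; apply/andP; split; last first.
  apply: (@GKdim_mod_ge _ _ _ _ _ ht _ _ hact (fun a => sublat (epos predT a)) v).
    by move=> x y; rewrite eposD sublatD.
  move=> M; have [J [f [h1 h2 h3]]] := hge M; exists J, f; split=> // c hc.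
  by apply: h3; rewrite hc; apply: sub0 hN.1.
have nv0 : v != 0 by apply: contra_notN nv => /eqP ->; apply: sub0 hN.1.
have [K hK] := decompose.
have stable_box s x : lspanm N (fun y => exists2 be : lattice n,
    (forall i, `|be i| <= s)%N & y = act (mon' be) v) x -> forall be : lattice n, forall s',
    (forall i, `|be i| <= s')%N -> lspanm N (fun y => exists2 be : lattice n,
    (forall i, `|be i| <= s' + s)%N & y = act (mon' be) v) (act (mon' be) x).
  move=> hx be s' hbe; apply: (act_lspanm hact _ _ hx); first by move=> y; apply: hN.2.
  move=> _ [g hg ->]; have [c c0 ->] := opM ht' hact be g.
  apply: (subZ _ (lspanm_subspace _ _)); apply: lspanmP; exists (be + g) => // i.
  have -> : (be + g) i = (be i + g i)%R :> int by rewrite ffunE.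
  by move: (be i) (g i) (hbe i) (hg i) => x1 x2; lia.
have [s hs] : exists s, forall r, lspanm N (fun y => exists2 be : lattice n,
    (forall i, `|be i| <= s)%N & y = act (mon' be) v) (op (rep r) v).
  have mono s s' x : (s <= s')%N -> lspanm N (fun y => exists2 be : lattice n,
      (forall i, `|be i| <= s)%N & y = act (mon' be) v) x -> lspanm N (fun y => exists2 be : lattice n,
      (forall i, `|be i| <= s')%N & y = act (mon' be) v) x.
    move=> hss; apply: lspanm_mono => _ [be hb ->]; apply: lspanmP; exists be => // i.
    exact: leq_trans (hb i) hss.
  (* The vectors reached from [v] in some box form a stable subspace above [N], so by maximality
     they are all of V. *)
  have each x : exists s, lspanm N (fun y => exists2 be : lattice n,
      (forall i, `|be i| <= s)%N & y = act (mon' be) v) x.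
    pose S x := exists s, lspanm N (fun y => exists2 be : lattice n,
      (forall i, `|be i| <= s)%N & y = act (mon' be) v) x.
    have [||h|h] := hmax (fun x => S x); last exact: h.
    - split.
        split=> [|c y z [s1 h1] [s2 h2]]; first by exists 0%N; apply: (sub0 (lspanm_subspace _ _)).
        exists (s1 + s2)%N; apply: (lspanm_subspace _ _).2.
          by apply: mono h1; apply: leq_addr.
        by apply: mono h2; apply: leq_addl.
      move=> be y [s1 h1]; exists (\max_i `|be i| + s1)%N; apply: (stable_box _ _ h1) => i.
      exact: (leq_bigmax (F := fun i => `|be i|%N)).
    - by move=> y hy; exists 0%N; apply: lspanmN.
    case: nv; apply: h; exists 0%N; apply: lspanmP; exists 0; last by rewrite (op0 ht' hact).
    by move=> i; rewrite ffunE.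
  have /choice[f hf] r := each (op (rep r) v).
  exists (\max_r f r) => r; apply: (mono (f r)) => //; exact: leq_bigmax.
(* A radius in sublattice coordinates for op (rep r) applied to a box of radius M: absorbing rep r
   costs [Ni], the representative left over costs [s]. *)
pose SM M := (K * (M + Ni) + s)%N.
pose C' := (#|Rep| * (C * ((2 * (K * Ni.+1 + s)).+1 ^ d)))%N.
apply: (@GKdim_mod_le _ _ _ _ _ ht hspan _ _ hact v C') => [x|M]; first exact: cyclicA.
have [|J [w [hJ hw]]] := basis_exists (B := (C' * M.+1 ^ d)%N)
    (lspan_subspace (fun y => exists2 a : lattice n, (forall i, `|a i| <= M)%N & y = op a v)).
  move=> L u hu hL.
  have [J [w [hJ hw]]] := hle (2 * SM M)%N.
  pose NR (x : {ffun Rep -> V}) := forall r, N (x r).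
  have hNR : lsubspace NR.
    split=> [r|c x y hx hy r]; rewrite !ffunE; first exact: sub0 hN.1.
    exact: hN.1.2.
  (* [growth_le] covers nonnegative exponents only; translation by [sh] moves the symmetric box
     there. *)
  pose sh : lattice n := [ffun=> (SM M)%:Z].
  pose wR (rj : Rep * J) : {ffun Rep -> V} :=
    [ffun r => if r == rj.1 then act (mon' (- sh)) (w rj.2) else 0].
  apply: (@leq_trans #|{: Rep * J}|).
    apply: (@steinitz _ _ _ _ NR (fun i => [ffun r => op (rep r) (u i)]) wR hNR).
      move=> c hc; apply: hu; apply: (core hN hne) => r.
      have := hc r; rewrite sum_ffunE (act_sum hact).
      by under eq_bigr => i _ do rewrite !ffunE; under [X in _ -> N X]eq_bigr do rewrite (actZ hact).
    move=> i.
    have part r x : lspanm N (fun y => exists j, y = act (mon' (- sh)) (w j)) x ->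
        lspanm NR (fun y => exists rj, y = wR rj) [ffun r' => if r' == r then x else 0].
      apply: (lspanm_le (S := fun x => lspanm NR (fun y => exists rj, y = wR rj)
        [ffun r' => if r' == r then x else 0])).
      - split.
          have -> : [ffun r' => if r' == r then (0 : V) else 0] = 0 :> {ffun Rep -> V}.
            by apply/ffunP => r'; rewrite !ffunE; case: ifP.
          exact: (sub0 (lspanm_subspace _ _)).
        move=> c x1 x2 h1 h2; have -> : [ffun r' => if r' == r then c *: x1 + x2 else 0] =
            c *: [ffun r' => if r' == r then x1 else 0] + [ffun r' => if r' == r then x2 else 0]
            :> {ffun Rep -> V}.
          by apply/ffunP => r'; rewrite !ffunE; case: ifP => // _; rewrite scaler0 addr0.
        exact: (lspanm_subspace _ _).2.
      - move=> y hy; apply: lspanmN => r'; rewrite ffunE; case: ifP => // _; exact: sub0 hN.1.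
      - by move=> _ [j ->]; apply: lspanmP; exists (r, j).
    have -> : [ffun r => op (rep r) (u i)] =
        \sum_r [ffun r' => if r' == r then op (rep r) (u i) else 0] :> {ffun Rep -> V}.
      apply/ffunP => r; rewrite sum_ffunE (bigD1 r) //= big1 ?addr0 => [|r' ne].
        by rewrite !ffunE eqxx.
      by rewrite ffunE eq_sym (negPf ne).
    apply: (sub_sum _ (lspanm_subspace _ _)) => r _; apply: part.
    have hSM x : lspanm N (fun y => exists2 be : lattice n,
       (forall i, `|be i| <= SM M)%N & y = act (mon' be) v) x ->
       lspanm N (fun y => exists j, y = act (mon' (- sh)) (w j)) x.
      apply: lspanm_mono => _ [be hb ->].
      pose a : exps n := [ffun i => absz (be i + (SM M)%:Z)].
      have ea : be = - sh + epos predT a.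
        apply/ffunP => l; rewrite !ffunE /=.
        by move: (be l) (hb l) => z; lia.
      have ha l : (a l <= 2 * SM M)%N by rewrite ffunE; move: (be l) (hb l) => z; lia.
      have [c c0 e] := opM ht' hact (- sh) (epos predT a).
      rewrite ea; apply: (subZ_inv (lspanm_subspace _ _) c0); rewrite -e.
      apply: (act_lspanm hact _ _ (hw a ha)); first by move=> y; apply: hN.2.
      by move=> _ [j ->]; apply: lspanmP; exists j.
    apply: hSM; apply: (lspan_le (S := fun x => lspanm N (fun y => exists2 be : lattice n,
       (forall i, `|be i| <= SM M)%N & y = act (mon' be) v) (op (rep r) x)) _ _ (hL i)).
      exact: (preim_subspace hact _ (lspanm_subspace _ _)).
    move=> _ [a ha ->]; have [c c0 ->] := opM ht hact (rep r) a.
    apply: (subZ _ (lspanm_subspace _ _)).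
    have hra l : (`|(rep r + a)%R l| <= M + Ni)%N.
      have -> : (rep r + a) l = ((nat_of_ord (r l))%:Z + a l)%R :> int by rewrite !ffunE.
      have := ltn_ord (r l); move: (a l) (ha l) => z; lia.
    have [r' [be [-> hbe]]] := hK _ _ hra.
    have [c' c'0 e] := opM ht hact (sublat be) (rep r').
    apply: (subZ_inv (lspanm_subspace _ _) c'0); rewrite -e.
    exact: (stable_box _ _ (hs r') be (K * (M + Ni))%N hbe).
  rewrite card_prod /C' -!mulnA leq_mul2l; apply/orP; right.
  apply: leq_trans hJ _; rewrite leq_mul2l; apply/orP; right; rewrite -expnMn.
  have h : ((2 * SM M).+1 <= (2 * (K * Ni.+1 + s)).+1 * M.+1)%N by rewrite /SM; nia.
  by case: (d) => [|e]; rewrite ?expn0 ?leq_exp2r.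
exists J, w; split=> // a ha; apply: hw; apply: lspan_in; by exists a.
Qed.

End FiniteIndex.

(** * An adapted basis of a sublattice and the dimension of the centre *)

Section Dichotomy.
Variables (k : fieldType) (A : algType k) (n : nat).
Variables (mon : lattice n -> A) (lam : lattice n -> lattice n -> k).
Hypothesis ht : torus_mon mon lam.
Hypothesis hspan : forall x, lspan (fun y => exists a, y = mon a) x.
Hypothesis hindep : forall (s : seq (lattice n)) (c : lattice n -> k), uniq s ->
  \sum_(a <- s) c a *: mon a = 0 -> forall a, a \in s -> c a = 0.
Variables (V : lmodType k) (act : A -> V -> V).
Hypothesis hact : is_left_module act.
Hypothesis hsimple : simple_module act.
Variables (i0 : 'I_n) (c : nat) (w : 'I_n -> int).
Hypothesis c0 : (0 < c)%N.
Hypothesis hw : forall h j,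
  lam (lbasis h *~ c%:Z - lbasis i0 *~ w h) (lbasis j *~ c%:Z - lbasis i0 *~ w j) = 1.
Hypothesis hntor : ~ exists2 N, (0 < N)%N & forall h j, lam (lbasis h) (lbasis j) ^+ N = 1.

Lemma lam_sublat (b : 'I_n -> lattice n) (x a : lattice n) : lam (sublat b x) a = \prod_i lam (b i) a ^ x i.
Proof.
rewrite /sublat (big_morph (fun x : lattice n => lam x a) (fun x y : lattice n => lamDl ht x y a) (lam0l ht a)).
by apply: eq_bigr => i _; rewrite (lamMzl ht).
Qed.
Lemma lam_sublatr (b : 'I_n -> lattice n) (x a : lattice n) : lam a (sublat b x) = \prod_i lam a (b i) ^ x i.
Proof.
rewrite /sublat (big_morph (lam a) (fun x y : lattice n => lamDr ht x y a) (lam0r ht a)).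
by apply: eq_bigr => i _; rewrite (lamMzr ht).
Qed.
Lemma lam_sublat1 (b : 'I_n -> lattice n) (x a : lattice n) : (forall i, x i != 0 -> lam (b i) a = 1) -> lam (sublat b x) a = 1.
Proof.
move=> h; rewrite lam_sublat big1 // => i _.
by have [->|/h ->] := eqVneq (x i) 0; rewrite ?expr0z // exp1rz.
Qed.
Lemma lam_sublatr1 (b : 'I_n -> lattice n) (x a : lattice n) : (forall i, x i != 0 -> lam a (b i) = 1) -> lam a (sublat b x) = 1.
Proof.
move=> h; rewrite lam_sublatr big1 // => i _.
by have [->|/h ->] := eqVneq (x i) 0; rewrite ?expr0z // exp1rz.
Qed.

Lemma sublat_basis (b : 'I_n -> lattice n) i : sublat b (lbasis i) = b i.
Proof.
rewrite /sublat (bigD1 i) //= ffunE eqxx big1 ?addr0 => [|j /negPf ne].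
  by rewrite mulr1z.
by rewrite ffunE ne mulr0z.
Qed.
Lemma sublat_comp (b g : 'I_n -> lattice n) (x : lattice n) :
  sublat (fun h => sublat b (g h)) x = sublat b (sublat g x).
Proof.
by rewrite [sublat g x]/sublat sublat_sum; apply: eq_bigr => i _; rewrite sublatMz.
Qed.

Let e' h := lbasis h *~ c%:Z - lbasis i0 *~ w h.
Let free (I : {set 'I_n}) := forall x : lattice n, (forall i, i \notin I -> x i = 0) ->
  lam (lbasis i0) (sublat e' x) = 1 -> x = 0.

Let max_free : exists2 I : {set 'I_n}, i0 \notin I /\ free I & forall I' : {set 'I_n},
  i0 \notin I' -> free I' -> (#|I'| <= #|I|)%N.
Proof.
pose P (I : {set 'I_n}) := (i0 \notin I) && `[< free I >].
have P0 : P finset.set0.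
  rewrite /P finset.in_set0; apply/asboolP => x hx _; apply/ffunP => i.
  by rewrite hx ?finset.in_set0 // ffunE.
case: (arg_maxnP (fun I : {set 'I_n} => #|I|) P0) => I /andP[h1 /asboolP h2] hmax.
exists I => // I' h1' h2'; apply: hmax; rewrite /P h1'; exact/asboolP.
Qed.

Lemma commuting_dichotomy : GKdim_mod act = 1%:E \/
  GKdim_mod act = (GKdim_alg A - GKdim_sub (alg_center A) - 1%:E)%E.
Proof.
have [I [i0I hI] hmax] := max_free.
have cz : c%:Z != 0 by lia.
(* Outside [I] and i0, maximality of [I] provides a combination that commutes with X_i0; its own
   coordinate is nonzero because [I] is free. *)
have /choice[g hg] (j : 'I_n) : exists g : lattice n, [/\
    (j == i0 -> g = 0), (j \in I -> g = lbasis j) &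
    (j \notin i0 |: I -> [/\ g j != 0, forall i, i \notin j |: I -> g i = 0 &
      lam (lbasis i0) (sublat e' g) = 1])].
  have [->|ji0] := eqVneq j i0.
    by exists 0; split=> // [/negP|]; rewrite ?finset.setU11 // (negPf i0I).
  have [jI|jI] := boolP (j \in I).
    by exists (lbasis j); split=> //; rewrite finset.in_setU1 jI orbT.
  have [x hx] : exists x : lattice n, [/\ (forall i, i \notin j |: I -> x i = 0),
      lam (lbasis i0) (sublat e' x) = 1 & x <> 0].
    apply: contrapT => hno.
    have : (#|j |: I| <= #|I|)%N.
      apply: hmax; first by rewrite finset.in_setU1 negb_or eq_sym ji0.
      move=> x h1 h2; apply: contrapT => nx; apply: hno; by exists x.
    by rewrite cardsU1 jI add1n ltnn.
  case: hx => h1 h2 nx; exists x; split=> // _; split=> //; apply/negP => /eqP xj; apply: nx; apply: hI h2 => i iI.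
  by have [->|ij] := eqVneq i j; rewrite // h1 // finset.in_setU1 negb_or ij.
have g0 : g i0 = 0 by case: (hg i0) => -> //.
have gI i : i \in I -> g i = lbasis i by case: (hg i).
pose S := finset.setC (i0 |: I).
have gS j : j \in S -> [/\ g j j != 0, forall i, i \notin j |: I -> g j i = 0 &
      lam (lbasis i0) (sublat e' (g j)) = 1] by rewrite finset.in_setC; case: (hg j).
pose b (h : 'I_n) : lattice n := (if h == i0 then lbasis i0 else 0) + sublat e' (g h).
have b0 : b i0 = lbasis i0 by rewrite /b eqxx g0 sublat0 addr0.
have bE h : h != i0 -> b h = sublat e' (g h) by rewrite /b => /negPf ->; rewrite add0r.
have sbE (x : lattice n) : sublat b x = lbasis i0 *~ x i0 + sublat e' (sublat g x).
  rewrite -sublat_comp /sublat; under eq_bigr do rewrite mulrzDl.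
  rewrite big_split (bigD1 i0) //= eqxx big1 ?addr0 // => i /negPf ->; exact: mul0rz.
have ecomm x y : lam (sublat e' x) (sublat e' y) = 1.
  by apply: lam_sublat1 => h _; apply: lam_sublatr1 => j _; apply: hw.
have bb h j : h != i0 -> j != i0 -> lam (b h) (b j) = 1 by move=> /bE -> /bE ->.
have SP j : j \in S -> j != i0 /\ j \notin I.
  by rewrite finset.in_setC finset.in_setU1 negb_or => /andP.
have bS j : j \in S -> lam (lbasis i0) (b j) = 1.
  by move=> jS; rewrite bE ?(SP j jS).1 //; case: (gS j jS).
(* On the coordinates in [S] the new basis is diagonal, with entries c g_jj. *)
have coord x j : j \in S -> sublat b x j = c%:Z * g j j * x j.
  move=> jS; have [ji0 jI] := SP j jS.
  rewrite sbE ffunE latMzE ffunE (negPf ji0) mul0r add0r.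
  have e'E l : e' l j = (j == l)%:Z * c%:Z.
    have -> : e' l j = (lbasis l *~ c%:Z) j - (lbasis i0 *~ w l) j by rewrite !ffunE.
    by rewrite !latMzE !ffunE (negPf ji0) mul0r subr0.
  have eE y : sublat e' y j = c%:Z * y j.
    rewrite sum_ffunE (bigD1 j) //= big1 ?addr0 => [|l /negPf nl].
      by rewrite latMzE e'E eqxx mul1r.
    by rewrite latMzE e'E eq_sym nl !mul0r.
  rewrite eE -mulrA; congr (_ * _).
  rewrite sum_ffunE (bigD1 j) //= latMzE big1 ?addr0 // => l nl.
  rewrite latMzE; have [->|li0] := eqVneq l i0; first by rewrite g0 ffunE mul0r.
  have [lI|lI] := boolP (l \in I); first by rewrite gI // ffunE eq_sym (negPf nl) mul0r.
  have lS : l \in S by rewrite finset.in_setC finset.in_setU1 negb_or li0.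
  by have [_ hl _] := gS l lS; rewrite hl ?mul0r // finset.in_setU1 negb_or eq_sym nl.
have hcomm (x y : lattice n) : x i0 = 0 -> y i0 = 0 -> lam (sublat b x) (sublat b y) = 1.
  by move=> hx hy; rewrite !sbE hx hy !mulr0z !add0r.
have hY (x : lattice n) : (forall i, i \notin I -> x i = 0) -> lam (sublat b (lbasis i0)) (sublat b x) = 1 -> x = 0.
  move=> hx; rewrite sublat_basis b0 sbE hx // mulr0z add0r.
  suff -> : sublat g x = x by apply: hI.
  rewrite [RHS]lattice_basis; apply: eq_bigr => i _.
  by have [/gI ->|/hx ->] := boolP (i \in I); rewrite ?mulr0z.
have hZ (x : lattice n) : (forall i, i \in i0 |: I -> x i = 0) -> lam (sublat b (lbasis i0)) (sublat b x) = 1.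
  move=> hx; rewrite sublat_basis b0; apply: lam_sublatr1 => i xi; apply: bS.
  by rewrite finset.in_setC; apply: contra xi => /hx ->.
pose im a := exists x, a = sublat b x.
have imD a a' : im a -> im a' -> im (a + a').
  by move=> [x ->] [y ->]; exists (x + y); rewrite sublatD.
have imM a z : im a -> im (a *~ z) by move=> [x ->]; exists (x *~ z); rewrite sublatMz.
have imb i : im (b i) by exists (lbasis i); rewrite sublat_basis.
pose d j : int := if j \in S then g j j else 1.
have d0 j : d j != 0 by rewrite /d; case: ifP => // /gS[].
have ime h : h != i0 -> im (e' h *~ d h).
  move=> hi0; have [hI'|hI'] := boolP (h \in I).
    have -> : d h = 1 by rewrite /d finset.in_setC finset.in_setU1 hI' orbT.
    by rewrite mulr1z; have := imb h; rewrite bE // gI // sublat_basis.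
  have hS : h \in S by rewrite finset.in_setC finset.in_setU1 negb_or hi0.
  have [_ gsupp _] := gS h hS; rewrite /d hS.
  have -> : e' h *~ g h h = b h + (\sum_(i in I) b i *~ g h i) *~ -1.
    rewrite mulrN1z bE // [sublat _ _](bigD1 h) //=; apply/eqP; rewrite eq_sym subr_eq; apply/eqP.
    congr (_ + _); rewrite (bigID (mem I)) /= [X in _ + X]big1 ?addr0.
      apply: eq_big => [i|i /andP[_ iI]]; first by rewrite andb_idl // => iI; apply: contraNneq hI' => <-.
      by rewrite bE ?(gI i) ?sublat_basis //; apply: contraNneq i0I => <-.
    by move=> i /andP[ih iI]; rewrite gsupp ?mulr0z // finset.in_setU1 negb_or ih.
  apply: (imD _ _ (imb h)); apply: (imM _ _ _).
  elim/big_ind: _ => [||i _]; [by exists 0; rewrite sublat0|exact: imD|exact: imM].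
have imc h : im (lbasis h *~ (c%:Z * d h)).
  have [->|hi0] := eqVneq h i0; first by rewrite -b0; apply: imM.
  have -> : lbasis h *~ (c%:Z * d h) = e' h *~ d h + b i0 *~ (w h * d h).
    by rewrite b0 /e' mulrzBl -!mulrzA subrK.
  by apply: imD; [exact: ime|exact: imM].
(* For each h the multiple c d_h of the basis vector e_h lies in the sublattice; [Ni] is a common
   multiple of these factors. *)
pose Ni := (c * \prod_j `|d j|)%N.
have Ni0 : (0 < Ni)%N.
  by rewrite muln_gt0 c0 prodn_gt0 // => j; rewrite absz_gt0.
have hfin i : exists x, lbasis i *~ Ni%:Z = sublat b x.
  suff [m ->] : exists m, Ni%:Z = c%:Z * d i * m by rewrite mulrzA; apply: imM.
  exists (sgz (d i) * (\prod_(j | j != i) `|d j|)%N%:Z).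
  by rewrite /Ni (bigD1 i) //= !PoszM abszEsg; ring.
have cS j y : j \in S -> lam (b j) (sublat b y) = 1.
  move=> jS; apply: lam_sublatr1 => h _; have [->|hi0] := eqVneq h i0.
    by rewrite b0; have := lamV ht (b j) (lbasis i0); rewrite bS // mulr1.
  by rewrite bb // (SP j jS).1.
have [d' hd' ->] := finite_index_GKdim ht hspan hact hsimple Ni0 hfin i0I hcomm hY hZ.
(* With [I] empty all vectors b_h commute, so [lam] is trivial on multiples by Ni and every
   commutation scalar is a root of unity of order dividing Ni^2. *)
have I0 : I <> finset.set0.
  move=> I0; apply: hntor; exists (Ni * Ni)%N; first by rewrite muln_gt0 Ni0.
  move=> h j; have [x hx] := hfin h; have [y hy] := hfin j.
  have hS l : l != i0 -> l \in S by rewrite finset.in_setC finset.in_setU1 I0 finset.in_set0 orbF.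
  have : lam (lbasis h *~ Ni%:Z) (lbasis j *~ Ni%:Z) = 1.
    rewrite hx hy; apply: lam_sublat1 => l _; have [->|/hS/cS //] := eqVneq l i0.
    apply: lam_sublatr1 => l' _; rewrite b0; have [->|/hS/bS //] := eqVneq l' i0.
    by rewrite b0 (lamaa ht).
  by rewrite (lamMzl ht) (lamMzr ht) -!exprnP exprM.
have cardS : n = (#|S| + #|I| + 1)%N.
  have := cardsC (i0 |: I); rewrite cardsU1 i0I card_ord -/S => h.
  by rewrite -[LHS]h addnC addnCA add1n addn1.
have hcen : GKdim_sub (alg_center A) = ((#|S|%:R : RR)%:E).
  apply/eqP; rewrite eq_le; apply/andP; split.
    apply: (GKdim_center_le ht hspan hindep) => a ha aS.
    have [be hbe] : exists be, a *~ Ni%:Z = sublat b be.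
      have /choice[u hu] := hfin; exists (sublat u a).
      rewrite -sublat_comp {1}(lattice_basis a) mulrz_suml.
      by apply: eq_bigr => i _; rewrite -hu -!mulrzA mulrC.
    have hac y : lam (sublat b be) y = 1 by rewrite -hbe (lamMzl ht) ha exp1rz.
    have hac' y : lam y (sublat b be) = 1 by have := lamV ht y (sublat b be); rewrite hac mulr1.
    have beI i : i \in I -> be i = 0.
      suff /ffunP h : [ffun i => if i \in I then be i else 0] = 0 :> lattice n.
        by move=> iI; have := h i; rewrite !ffunE iI.
      apply: hY => [l /negPf lI|]; first by rewrite ffunE lI.
      rewrite -[RHS](hac' (sublat b (lbasis i0))) !lam_sublatr; apply: eq_bigr => l _.
      rewrite ffunE; case: ifP => // lI; rewrite sublat_basis b0 expr0z.
      have [->|li0] := eqVneq l i0; first by rewrite b0 (lamaa ht) exp1rz.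
      by rewrite bS ?exp1rz // finset.in_setC finset.in_setU1 negb_or li0 lI.
    have [i iI] : exists i, i \in I.
      by apply: contrapT => h; apply: I0; apply/setP => i; rewrite finset.in_set0; apply/negP => iI; apply: h; exists i.
    have ii0 : i != i0 by apply: contraNneq i0I => <-.
    (* Commuting with b_i for one i in [I], which exists since [I] is not empty, excludes a
       component along b_i0. *)
    have be0 : be i0 = 0.
      have : lbasis i *~ be i0 = 0.
        apply: hY => [l lI|].
          by rewrite latMzE ffunE; case: eqP => [e|_]; [rewrite -e (negPf lI) in iI|rewrite mul0r].
        rewrite sublatMz (lamMzr ht) -(lamMzl ht) -sublatMz.
        rewrite -[RHS](hac (sublat b (lbasis i))) !lam_sublat; apply: eq_bigr => l _.
        have [->|li0] := eqVneq l i0; first by rewrite latMzE ffunE eqxx mul1r.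
        by rewrite sublat_basis bb ?exp1rz.
      by move/ffunP/(_ i); rewrite latMzE !ffunE eqxx mul1r.
    have be_0 : be = 0.
      apply/ffunP => j; rewrite ffunE; have [->//|ji0] := eqVneq j i0.
      have [/beI//|jI] := boolP (j \in I).
      have jS : j \in S by rewrite finset.in_setC finset.in_setU1 negb_or ji0.
      have := coord be j jS; rewrite -hbe latMzE aS // mul0r => /esym/eqP.
      by rewrite !mulf_eq0 (negPf cz) /=; have [/negPf -> _ _] := gS j jS => /eqP.
    apply/ffunP => j; move/ffunP/(_ j): hbe; rewrite be_0 sublat0 latMzE !ffunE => /eqP.
    by rewrite mulf_eq0; case/orP => /eqP //; move: Ni0; clear; lia.
  (* The factor Ni may be moved to the other argument of [lam], where it brings every exponent into
     the sublattice. *)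
  pose E (a : exps n) := sublat b (epos (mem S) a) *~ Ni%:Z.
  apply: (@GKdim_sub_ge _ _ _ _ _ ht _ E).
  - by move=> x y; rewrite /E eposD sublatD mulrzDl.
  - move=> a x; apply/esym; apply: (lspan_commute _ (hspan x)) => _ [y ->].
    rewrite (monC ht (E a)).
    suff -> : lam (E a) y = 1 by rewrite scale1r.
    rewrite (lattice_basis y) -/(sublat _ _); apply: lam_sublatr1 => l _.
    rewrite (lamMzlr ht); have [u ->] := hfin l.
    apply: lam_sublat1 => j; rewrite ffunE; case: ifP => [jS _|]; last by rewrite eqxx.
    exact: cS.
  - move=> M; pose L := {ffun {i : 'I_n | i \in S} -> 'I_M.+1}.
    pose ext (f : L) : exps n := [ffun i => if insub i is Some s then nat_of_ord (f s) else 0%N].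
    exists L, ext; split.
    + by rewrite card_ffun card_ord card_sig.
    + by move=> f i; rewrite /ext ffunE; case: insubP => // s _ _; rewrite -ltnS.
    apply: mon_indep => // f f' /ffunP e; apply/ffunP => -[j jS].
    have := e j; rewrite !latMzE !coord // !ffunE /= jS insubT /=.
    have Nz : Ni%:Z != 0 by move: Ni0; clear; lia.
    have gz : c%:Z * g j j != 0 by rewrite mulf_neq0 //; case: (gS j jS).
    by move/(mulIf Nz)/(mulfI gz) => -[] /val_inj.
case: hd' => ->; first by left.
right; rewrite (GKdim_algE ht hspan hindep) hcen -!EFinB; congr EFin.
have -> : n%:R = #|S|%:R + #|I|%:R + 1 :> RR by rewrite -natrD natr1 -addn1 -cardS.
ring.
Qed.
End Dichotomy.

Theorem theorem1 (k : fieldType) (n : nat) (q : 'M[k]_n)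
  (A : algType k) (X Xi : 'I_n -> A) (V : lmodType k) (act : A -> V -> V) :
  mult_antisym q ->
  is_quantum_torus q X Xi ->
  @krull_dim A (n%:Z - 1) ->
  is_left_module act ->
  simple_module act ->
  GKdim_mod act = 1%:E \/
  GKdim_mod act = (GKdim_alg A - GKdim_sub (alg_center A) - 1%:E)%E.
Proof.
move=> hq hA [m [/addIr [em] hdev hmin]] hact hsimple; move: hdev hmin; rewrite -em => hdev hmin.
have ht := qtorus_mon hq hA.1; have hspan := qmon_span hq hA.
(* For n = 0 the Krull dimension would be -1, that is, the algebra would be zero. *)
have n0 : (0 < n)%N.
  rewrite lt0n; apply/negP => /eqP n0; move: hdev; rewrite n0 => /(_ 1 Logic.I)/eqP.
  by rewrite oner_eq0.
have hndev : ~ dev_lt n.-1 (fun x : A => x = 0) (fun _ : A => True).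
  by move/hmin; rewrite -ltnS prednK // ltnn.
have [i0 [c c0 [w hw]]] := large_deviation_commutation ht hspan n0 hndev.
apply: (commuting_dichotomy ht hspan (qmon_indep hq hA) hact hsimple c0 hw).
move=> [N N0 hN]; apply: (torsion_deviation hq hA N0) => // i j.
(* On basis vectors the character [qlam] returns the entries of [q], so these would all be roots of
   unity. *)
have := hN i j; rewrite /qlam (bigD1 i) //= [X in _ * X]big1 ?mulr1; last first.
  by move=> l /negPf nl; rewrite big1 // => l' _; rewrite ffunE nl mul0r expr0z.
rewrite (bigD1 j) //= [X in _ * X]big1 ?mulr1; last first.
  by move=> l /negPf nl; rewrite [lbasis j l]ffunE nl mulr0 expr0z.
by rewrite !ffunE !eqxx mulr1 expr1z.
Qed.
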